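(* Let $N>2$ be an even integer, let $X$ be the pseudo-process associated with $\partial u/\partial t=\kappa_N\,\partial^N u/\partial x^N$, and for $a\in\mathbb{R}$ let $\tau_a^+=\inf\{t\ge0:X(t)>a\}$, $\tau_a^-=\inf\{t\ge0:X(t)<a\}$. For $\Re(\lambda)>0$ and $\mu\in\mathbb{R}$, $$\mathbb{E}_x\left[e^{-\lambda\tau_a^++i\mu X(\tau_a^+)}\right]=\sum_{j\in J}A_j\prod_{l\in J\setminus\{j\}}\left(1-\frac{i\mu}{\sqrt[N]{\lambda}}\,\bar\theta_l\right)e^{\theta_j\sqrt[N]{\lambda}\,(x-a)}\,e^{i\mu a}\quad\text{for }x\le a,$$ $$\mathbb{E}_x\left[e^{-\lambda\tau_a^-+i\mu X(\tau_a^-)}\right]=\sum_{k\in K}B_k\prod_{l\in K\setminus\{k\}}\left(1-\frac{i\mu}{\sqrt[N]{\lambda}}\,\bar\theta_l\right)e^{\theta_k\sqrt[N]{\lambda}\,(x-a)}\,e^{i\mu a}\quad\text{for }x\ge a.$$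
   Context: Notation. $\kappa_N=(-1)^{1+N/2}$; $\theta_l=e^{i(2l+N/2+1)\pi/N}$, $0\le l\le N-1$, are the $N$th roots of $\kappa_N$; $J=\{l:\Re\theta_l>0\}$, $K=\{l:\Re\theta_l<0\}$; $A_j=\prod_{l\in J\setminus\{j\}}\frac{\theta_l}{\theta_l-\theta_j}$ for $j\in J$, $B_k=\prod_{l\in K\setminus\{k\}}\frac{\theta_l}{\theta_l-\theta_k}$ for $k\in K$; $\sqrt[N]{\lambda}$ is the principal root; bar is complex conjugation. Kernel. $p(t;\xi)=\frac1{2\pi}\int_{-\infty}^{+\infty}e^{-i\xi u+\kappa_N t(-iu)^N}\,du$ ($t>0$) is the fundamental solution of $\partial u/\partial t=\kappa_N\partial^N u/\partial x^N$; $\int p(t;\xi)\,d\xi=1$ and $\rho=\int|p(t;\xi)|\,d\xi<\infty$ does not depend on $t$. Pseudo-process. $X$ is governed by signed measures $\mathbb{P}_x$ with expectations $\mathbb{E}_x$: for $0=t_0<t_1<\dots<t_k$, $x_0=x$, and bounded Borel $F$, $\mathbb{E}_x[F(X(t_1),\dots,X(t_k))]=\int_{\mathbb{R}^k}F(x_1,\dots,x_k)\prod_{i=1}^k p(t_i-t_{i-1};x_{i-1}-x_i)\,dx_1\cdots dx_k$, and $X(0)=x$ under $\mathbb{P}_x$. Expectations of hitting functionals. For $n\in\mathbb{N}$ put $t_{n,k}=k/2^n$, $X_{n,k}=X(t_{n,k})$, $M_{n,k}=\max_{0\le j\le k}X_{n,j}$. The expectation of a functional of $X$ is by definition the limit as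 $n\to\infty$ of the expectations of the same functional of the step-process $X_n(t)=\sum_k X_{n,k}\mathbf 1_{[t_{n,k},t_{n,k+1})}(t)$, computed term by term in a series of bounded functions of finitely many $X_{n,j}$. Concretely, for $x\le a$, with $\tau_{a,n}^+$ the first $t_{n,k}$ such that $X_{n,k}>a$, $\mathbb{E}_x[e^{-\lambda\tau_a^++i\mu X(\tau_a^+)}]=\lim_{n\to\infty}\mathbb{E}_x[e^{-\lambda\tau_{a,n}^++i\mu X_n(\tau_{a,n}^+)}]$, where $$\mathbb{E}_x\big[e^{-\lambda\tau_{a,n}^++i\mu X_n(\tau_{a,n}^+)}\big]=\sum_{k=0}^\infty\mathbb{E}_x\Big[\big(e^{-\lambda t_{n,k}+i\mu X_{n,k}}-e^{-\lambda t_{n,k+1}+i\mu X_{n,k+1}}\big)\mathbf 1_{\{M_{n,k}>a\}}\Big]$$ (absolutely convergent for $\Re(\lambda)>2^n\ln\rho$, extended analytically to $\Re(\lambda)>0$). The definition for $\tau_a^-$, $x\ge a$, is the same with $\mathbf 1_{\{\min_{0\le j\le k}X_{n,j}<a\}}$. *)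

(* Defs.v *)
From HB Require Import structures.
From mathcomp Require Import all_boot all_order all_algebra.
From mathcomp Require Import all_classical all_reals all_analysis.
From mathcomp Require Import complex.

Set Implicit Arguments.
Unset Strict Implicit.
Unset Printing Implicit Defensive.

Import Order.TTheory GRing.Theory Num.Theory.
Import numFieldNormedType.Exports.

Local Open Scope classical_set_scope.
Local Open Scope ring_scope.
Local Open Scope complex_scope.

Section complex_functions.
Variable R : realType.

Definition cmod (z : R[i]) : R := ComplexField.Normc.normc z.

Definition cexp (z : R[i]) : R[i] :=
  (expR (complex.Re z))%:C * (cos (complex.Im z) +i* sin (complex.Im z)).

(* Principal argument, with values in ]-pi, pi] for z != 0. *)
Definition carg (z : R[i]) : R :=
  let phi := acos (complex.Re z / cmod z) in
  if 0 <= complex.Im z then phi else - phi.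

(* Principal N-th root.  The library's [N.-root] is another branch: its values
   have nonnegative imaginary part. *)
Definition croot (N : nat) (z : R[i]) : R[i] :=
  (cmod z `^ N%:R^-1)%:C * cexp ('i%C * (carg z / N%:R)%:C).

Definition cintegral d (T : measurableType d) (mu : {measure set T -> \bar R})
    (f : T -> R[i]) : R[i] :=
  Rintegral mu setT (fun x => complex.Re (f x)) +i*
  Rintegral mu setT (fun x => complex.Im (f x)).

Definition holomorphic_on (D : set R[i]) (f : R[i] -> R[i]) : Prop :=
  forall z, D z -> derivable (f : R[i]^o -> R[i]^o) z 1.

End complex_functions.

Section lebesgue_tuple.
Variable R : realType.
Local Notation RB := (measurableTypeR R).
Local Open Scope ereal_scope.

Section cons.
Variables (k : nat) (m : {sigma_finite_measure set (k.-tuple RB) -> \bar R}).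

Definition tcons (p : RB * k.-tuple RB) : k.+1.-tuple RB :=
  [the k.+1.-tuple RB of p.1 :: p.2].

Lemma measurable_tcons : measurable_fun setT tcons.
Proof. exact: measurable_cons. Qed.

Definition lebesgue_cons : set (k.+1.-tuple RB) -> \bar R :=
  pushforward (lebesgue_measure \x m) tcons.

Let lebesgue_cons0 : lebesgue_cons set0 = 0.
Proof. by rewrite /lebesgue_cons /pushforward preimage_set0 measure0. Qed.

Let lebesgue_cons_ge0 A : 0 <= lebesgue_cons A.
Proof. exact: (measure_ge0 (lebesgue_measure \x m)). Qed.

Let mtcons (A : set (k.+1.-tuple RB)) :
  measurable A -> measurable (tcons @^-1` A).
Proof. by move=> mA; rewrite -[X in measurable X]setTI; exact: measurable_tcons. Qed.

Let lebesgue_cons_sigma_additive : semi_sigma_additive lebesgue_cons.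
Proof.
move=> F mF tF mUF; rewrite /lebesgue_cons /pushforward preimage_bigcup.
apply: measure_semi_sigma_additive.
- by move=> n; exact: mtcons.
- apply/trivIsetP => /= i j _ _ ij; rewrite -preimage_setI.
  by move/trivIsetP : tF => /(_ _ _ _ _ ij) ->//; rewrite preimage_set0.
- by rewrite -preimage_bigcup; exact: mtcons.
Qed.

HB.instance Definition _ := isMeasure.Build _ _ _ lebesgue_cons
  lebesgue_cons0 lebesgue_cons_ge0 lebesgue_cons_sigma_additive.

Let tconsK (p : RB * k.-tuple RB) :
  (thead (tcons p), [tuple of behead (tcons p)]) = p.
Proof. by case: p => x w; congr pair; exact/val_inj. Qed.

Let lebesgue_cons_sigma_finite : sigma_finite setT lebesgue_cons.
Proof.
have /sigma_finiteP[F [TF ndF Foo]] := sigma_finiteT (@lebesgue_measure R).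
have /sigma_finiteP[G [TG ndG Goo]] := sigma_finiteT m.
pose uncons (t : k.+1.-tuple RB) := (thead t, [tuple of behead t]).
exists (fun n => uncons @^-1` (F n `*` G n)).
  rewrite predeqE => t; split=> // _.
  have [i _ Fi] : (\bigcup_i F i) (thead t) by rewrite -TF.
  have [j _ Gj] : (\bigcup_i G i) [tuple of behead t] by rewrite -TG.
  exists (maxn i j) => //; split => /=.
  - by move: Fi; exact/subsetPset/ndF/leq_maxl.
  - by move: Gj; exact/subsetPset/ndG/leq_maxr.
move=> n; have [mF Fn] := Foo n; have [mG Gn] := Goo n; split.
  rewrite -[X in measurable X]setTI.
  have mu : measurable_fun setT uncons.
    by apply/measurable_fun_pair; [exact: measurable_tnth|exact: measurable_behead].
  by apply: mu => //; exact: measurableX.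
rewrite /lebesgue_cons /pushforward [X in (_ \x _) X](_ : _ = F n `*` G n).
  by rewrite product_measure1E// lte_mul_pinfty// ge0_fin_numE.
by apply/funext => p; rewrite /preimage /uncons -[in RHS](tconsK p).
Qed.

HB.instance Definition _ := Measure_isSigmaFinite.Build _ _ _ lebesgue_cons
  lebesgue_cons_sigma_finite.

End cons.

(* Lebesgue measure on the Borel sets of R^k; R^0 is a point of mass 1. *)
Fixpoint lebesgue_tuple k : {sigma_finite_measure set (k.-tuple RB) -> \bar R} :=
  if k is k'.+1 then lebesgue_cons (lebesgue_tuple k')
  else \d_([tuple] : 0.-tuple RB).

End lebesgue_tuple.

Section roots_of_kappa.
Variables (R : realType) (N : nat).

Definition kappa : R[i] := (-1) ^+ (1 + N./2).

Definition theta (l : 'I_N) : R[i] :=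
  cexp ('i%C * ((2 * l + N./2 + 1)%:R * pi / N%:R)%:C).

Definition indexJ : {set 'I_N} := [set l | 0 < complex.Re (theta l)]%SET.
Definition indexK : {set 'I_N} := [set l | complex.Re (theta l) < 0]%SET.

Definition rootA (j : 'I_N) : R[i] :=
  \prod_(l in indexJ :\ j) (theta l / (theta l - theta j)).
Definition rootB (k : 'I_N) : R[i] :=
  \prod_(l in indexK :\ k) (theta l / (theta l - theta k)).

End roots_of_kappa.

Section pseudo_process.
Variables (R : realType) (N : nat).
Local Notation RB := (measurableTypeR R).

Definition pp_kernel (t xi : R) : R[i] :=
  ((2 * pi)^-1)%:C *
  cintegral lebesgue_measure (fun u : RB =>
    cexp (- 'i%C * xi%:C * u%:C + kappa R N * t%:C * (- 'i%C * u%:C) ^+ N)).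

(* The L^1 norm of [pp_kernel t] is the same for all t > 0; we take t = 1. *)
Definition pp_rho : R :=
  Rintegral lebesgue_measure setT (fun xi : RB => cmod (pp_kernel 1 xi)).

(* E_x of F(X(t_1), ..., X(t_k)) for 0 < t_1 < ... < t_k.  Prepending 0 to [t]
   and [x] to [w] supplies t_0 = 0 and x_0 = x. *)
Definition pp_expectation (x : R) (k : nat) (t : k.-tuple R)
    (F : k.-tuple R -> R[i]) : R[i] :=
  cintegral (lebesgue_tuple R k) (fun w : k.-tuple RB =>
    F w * \prod_(i < k)
      pp_kernel (nth 0 (0 :: t) i.+1 - nth 0 (0 :: t) i)
                (nth 0 (x :: w) i - nth 0 (x :: w) i.+1)).

Definition dyadic (n k : nat) : R := k%:R / 2 ^+ n.

(* [crossed X k] tells whether the sampled path X has crossed the level by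
   step k. *)
Definition above (a : R) (X : nat -> R) (k : nat) : bool :=
  a < \big[Num.max/X 0%N]_(j < k.+1) X j.
Definition below (a : R) (X : nat -> R) (k : nat) : bool :=
  \big[Num.min/X 0%N]_(j < k.+1) X j < a.

Definition step_hit_term (crossed : (nat -> R) -> nat -> bool) (n : nat)
    (x mu : R) (lam : R[i]) (k : nat) : R[i] :=
  pp_expectation x [tuple dyadic n i.+1 | i < k.+1] (fun w =>
    let X := nth 0 (x :: w) in
    (cexp (- lam * (dyadic n k)%:C + 'i%C * mu%:C * (X k)%:C) -
     cexp (- lam * (dyadic n k.+1)%:C + 'i%C * mu%:C * (X k.+1)%:C)) *
    (crossed X k)%:R).

(* [E lam] is the expectation of exp(- lam tau_n + i mu X_n(tau_n)) under P_x,
   where tau_n is the crossing time of the step-process, for all lam with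
   Re lam > 0.  The series converges only for Re lam large; [E] is its analytic
   extension to the half-plane, unique by the identity theorem. *)
Definition is_step_hit_expectation (crossed : (nat -> R) -> nat -> bool)
    (n : nat) (x mu : R) (E : R[i] -> R[i]) : Prop :=
  holomorphic_on [set z | 0 < complex.Re z] E /\
  forall lam : R[i], 2 ^+ n * ln pp_rho < complex.Re lam ->
    (series (step_hit_term crossed n x mu lam) : nat -> R[i]^o) @ \oo -->
    (E lam : R[i]^o).

(* The expectation of exp(- lam tau + i mu X(tau)) under P_x is [v]: by
   definition, the limit of those of the step-processes. *)
Definition is_hit_expectation (crossed : (nat -> R) -> nat -> bool)
    (x mu : R) (lam v : R[i]) : Prop :=
  exists E : nat -> R[i] -> R[i],
    (forall n, is_step_hit_expectation crossed n x mu (E n)) /\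
    (fun n => E n lam : R[i]^o) @ \oo --> (v : R[i]^o).

End pseudo_process.

(* Main.v *)
Require Import Defs.
From mathcomp Require Import all_boot all_order all_algebra.
From mathcomp Require Import all_classical all_reals all_analysis.
From mathcomp Require Import complex measurable_realfun ring lra zify.

(* After a translation and a reflection the level is 0 and the walk starts at
   x <= 0.  Write s = 2^-n, z = exp (- lam s), and P for the convolution with
   p(s; .).  Peeling off the first step of the walk and summing by parts turns
   the n-th series into E_n = sum_k z^(k+1) c_k, with
     c_0 = 1_{<= 0} P (1_{> 0} e_mu),   c_{k+1} = 1_{<= 0} P c_k,
   where e_mu(x) = exp (i mu x).  The Fourier transform of p(s; .) takes its
   values in ]0, 1], so P is a symmetric positive contraction of L^2: the c_k are
   bounded and the series is analytic in Re lam > 0.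

   Let v = e_mu on the right half-line and v = sum_j L_j exp (c_j x) on the left
   one, c_j being the roots with positive real part of kappa c^N = lam, and L_j
   the Lagrange weights that make v of class C^(N/2 - 1) at 0.  The error
   e = (E_n - v) 1_{<= 0} satisfies e - z P e = - (v - z P v) on the left
   half-line.  Testing this with e gives an a priori bound in the energy norm
   |e|^2 + <e - P e, e> / s, which controls sup |P e|.  For the right-hand side,
   replace v by v_eps, which is v shifted by eps > 0 and is analytic up to eps: a
   Taylor expansion and the moments of p(s; .) give v_eps - z P v_eps = O(s^(1 + 1/N)),
   whereas v - v_eps is small in energy norm, uniformly in s, by Plancherel's
   theorem for its derivative of order N/2.  Hence E_n -> v. *)

Set Implicit Arguments.
Unset Strict Implicit.
Unset Printing Implicit Defensive.

Import Order.TTheory GRing.Theory Num.Theory.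
Import numFieldNormedType.Exports.

Local Open Scope classical_set_scope.
Local Open Scope ring_scope.

(** * Lebesgue integration on the real line *)

Section integrals.
Variable R : realType.
Local Notation leb := (@lebesgue_measure R).
Implicit Types f g h : R -> R.

(** The moments of p of orders 1 to N - 1 vanish, so for N > 2 the kernel changes sign: [P] need not
    contract the sup norm and no maximum principle is at hand. Positivity in L^2 replaces both. As 1
    - |z| is only of order s, inverting 1 - z P on the left half-line costs a factor 1 / s, so
    residuals must be o(s) in L^2. That of v itself is in general too large near 0, where the
    derivative of order N/2 may jump. Hence v - v_eps is not estimated through its residual in L^2:
    it enters the tested equation as <e, (1 - P) (v - v_eps)>, and Cauchy-Schwarz for the energy
    form gives a bound with its own factor s; the rest of it carries 1 - z = O(s). The bound on v -
    v_eps is independent of s, so the number of terms goes to infinity first, then s to 0, then eps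
    to 0. The L_j are the Lagrange basis polynomials with nodes c_j, evaluated at i mu: N/2 nodes
    match the derivatives of orders 0 to N/2 - 1 at 0, and for c_j = theta_j lam^(1/N) the weights
    are the A_j times the products of the theorem. *)

Definition Int f : R := \int[leb]_x f x.
Definition itg f : Prop := leb.-integrable setT (EFin \o f).
Definition msb f : Prop := measurable_fun [set: measurableTypeR R] (f : measurableTypeR R -> measurableTypeR R).

Lemma itg_msb f : itg f -> msb f.
Proof. by move=> /measurable_int /measurable_EFinP. Qed.

Lemma itg_le f g : msb f -> itg g -> (forall x, `|f x| <= g x) -> itg f.
Proof.
move=> mf ig fg; apply: (le_integrable measurableT _ _ ig).
  exact/measurable_EFinP.
by move=> x _ /=; rewrite lee_fin (le_trans (fg x))// ler_norm.
Qed.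

Lemma itgD f g : itg f -> itg g -> itg (fun x => f x + g x).
Proof.
move=> i1 i2; rewrite /itg (_ : _ \o _ = (EFin \o f) \+ (EFin \o g))%E//.
exact: integrableD.
Qed.

Lemma itgZ r f : itg f -> itg (fun x => r * f x).
Proof.
move=> i1; rewrite /itg (_ : _ \o _ = (fun x => r%:E * (EFin \o f) x))%E//.
exact: integrableZl.
Qed.

Lemma itgN f : itg f -> itg (fun x => - f x).
Proof. by move=> /(itgZ (-1)); under eq_fun do rewrite mulN1r. Qed.

Lemma itgB f g : itg f -> itg g -> itg (fun x => f x - g x).
Proof. by move=> i1 /itgN; exact: itgD. Qed.

Lemma itg_abs f : itg f -> itg (fun x => `|f x|).
Proof. by move=> /integrable_norm. Qed.

Lemma itg0 : itg (fun=> 0).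
Proof. exact: integrable0. Qed.

Lemma eq_Int f g : f =1 g -> Int f = Int g.
Proof. by move=> /funext ->. Qed.

Lemma IntD f g : itg f -> itg g -> Int (fun x => f x + g x) = Int f + Int g.
Proof. by move=> i1 i2; exact: RintegralD. Qed.

Lemma IntB f g : itg f -> itg g -> Int (fun x => f x - g x) = Int f - Int g.
Proof. by move=> i1 i2; exact: RintegralB. Qed.

Lemma IntZ r f : itg f -> Int (fun x => r * f x) = r * Int f.
Proof. by move=> i1; exact: RintegralZl. Qed.

Lemma IntZr r f : itg f -> Int (fun x => f x * r) = Int f * r.
Proof. by move=> i1; exact: RintegralZr. Qed.

Lemma IntN f : itg f -> Int (fun x => - f x) = - Int f.
Proof.
by move=> i1; rewrite -[RHS]mulN1r -IntZ//; apply: eq_Int => x; rewrite mulN1r.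
Qed.

Lemma Int0 : Int (fun=> 0) = 0.
Proof. by rewrite /Int Rintegral_cst// mul0r. Qed.

Lemma Int_ge0 f : (forall x, 0 <= f x) -> 0 <= Int f.
Proof. by move=> f0; apply: Rintegral_ge0. Qed.

Lemma le_Int f g : itg f -> itg g -> (forall x, f x <= g x) -> Int f <= Int g.
Proof. by move=> i1 i2 fg; apply: le_Rintegral. Qed.

Lemma le_abs_Int f : itg f -> `|Int f| <= Int (fun x => `|f x|).
Proof. by move=> i1; apply: le_normr_Rintegral. Qed.

Lemma abs_Int_le f g : msb f -> itg g -> (forall x, `|f x| <= g x) -> `|Int f| <= Int g.
Proof.
move=> mf ig fg; have i1 := itg_le mf ig fg.
by apply: le_trans (le_abs_Int i1) _; apply: le_Int => //; exact: itg_abs.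
Qed.

Lemma msb_cst r : msb (fun=> r).
Proof. exact: measurable_cst. Qed.

Lemma msb_cont f : continuous f -> msb f.
Proof. exact: continuous_measurable_fun. Qed.

Lemma msb_id : msb (fun x => x).
Proof. exact: measurable_id. Qed.

Lemma msbD f g : msb f -> msb g -> msb (fun x => f x + g x).
Proof. exact: measurable_funD. Qed.

Lemma msbB f g : msb f -> msb g -> msb (fun x => f x - g x).
Proof. exact: measurable_funB. Qed.

Lemma msbM f g : msb f -> msb g -> msb (fun x => f x * g x).
Proof. exact: measurable_funM. Qed.

Lemma msbX f n : msb f -> msb (fun x => f x ^+ n).
Proof. exact: measurable_funX. Qed.

Lemma msbN f : msb f -> msb (fun x => - f x).
Proof. by move=> ?; apply: measurableT_comp. Qed.

Lemma msb_comp f g : msb f -> msb g -> msb (fun x => f (g x)).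
Proof. by move=> mf mg; apply: (measurableT_comp mf mg). Qed.

Lemma msb_abs f : msb f -> msb (fun x => `|f x|).
Proof. by move=> ?; apply: measurableT_comp. Qed.

Lemma msb_if (b : R -> bool) f g :
  measurable_fun [set: measurableTypeR R] b ->
  msb f -> msb g -> msb (fun x => if b x then f x else g x).
Proof. by move=> mb mf mg; apply: measurable_fun_ifT. Qed.

Lemma mle c : measurable_fun [set: measurableTypeR R] (fun x : R => x <= c).
Proof. by apply: measurable_fun_ler => //. Qed.

Lemma mge c : measurable_fun [set: measurableTypeR R] (fun x : R => c <= x).
Proof. by apply: measurable_fun_ler => //. Qed.

Lemma mlt c : measurable_fun [set: measurableTypeR R] (fun x : R => x < c).
Proof. by apply: measurable_fun_ltr => //. Qed.

Lemma mgt c : measurable_fun [set: measurableTypeR R] (fun x : R => c < x).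
Proof. by apply: measurable_fun_ltr => //. Qed.

Lemma dct (F : nat -> R -> R) f g : (forall n, msb (F n)) -> msb f -> itg g ->
  (forall n x, `|F n x| <= g x) -> (forall x, F ^~ x @ \oo --> f x) ->
  itg f /\ (fun n => Int (F n)) @ \oo --> Int f.
Proof.
move=> mF mf ig Fg Ff.
have fg x : `|f x| <= g x.
  have h : (fun n => `|F n x|) @ \oo --> `|f x| by apply: cvg_norm; exact: Ff.
  rewrite -(cvg_lim _ h)//; apply: limr_le; first by apply/cvg_ex; eexists; exact: h.
  by near=> n; exact: Fg.
have i1 := itg_le mf ig fg; split => //.
have [] := @dominated_convergence _ _ _ leb setT measurableT
  (fun n => EFin \o F n) (EFin \o f) (EFin \o g).
- by move=> n; apply/measurable_EFinP; exact: mF.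
- exact/measurable_EFinP.
- by apply: aeW => x _ /=; apply: cvg_EFin; [exact: nearW | exact: Ff].
- exact: ig.
- by apply: aeW => x n _ /=; rewrite lee_fin.
move=> _ _ h; have /fine_cvgP[_ h2] : (\int[leb]_x (EFin \o F n) x @[n --> \oo] --> (Int f)%:E)%E.
  by rewrite /Int /Rintegral fineK//; exact: integrable_fin_num i1.
exact: h2.
Unshelve. all: by end_near. Qed.

(** Integrability of the limit is part of the conclusion: this is how integrals are shown to be
    finite below, for nonnegative derivatives of bounded functions and for [fsq]. *)
Lemma fatou_bound (F : nat -> R -> R) f C : (forall n, itg (F n)) -> msb f ->
  (forall n x, 0 <= F n x) -> (forall x, F ^~ x @ \oo --> f x) ->
  (forall n, Int (F n) <= C) -> itg f /\ Int f <= C.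
Proof.
move=> iF mf F0 Ff FC.
have f0 x : 0 <= f x.
  rewrite -(cvg_lim _ (Ff x))//; apply: limr_ge; first by apply/cvg_ex; eexists; exact: Ff.
  by near=> n; exact: F0.
have key : (\int[leb]_x (f x)%:E <= C%:E)%E.
  have := @fatou _ _ _ leb setT measurableT (fun n => EFin \o F n).
  move=> /(_ (fun n => measurable_int leb (iF n))).
  move=> /(_ (fun n x _ => F0 n x)) h.
  rewrite [leLHS](_ : _ = (\int[leb]_x limn_einf ((fun n => (EFin \o F n) x)))%E); last first.
    apply: eq_integral => x _; rewrite is_cvg_limn_einfE//=.
      by apply/esym/cvg_lim => //; apply: cvg_EFin; [exact: nearW | exact: Ff].
    by apply/cvg_ex; exists (f x)%:E; apply: cvg_EFin; [exact: nearW | exact: Ff].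
  apply: le_trans h _.
  rewrite limn_einf_lim; apply: lime_le; first exact: is_cvg_einfs.
  apply: nearW => n; apply: (@le_trans _ _ (\int[leb]_x (F n x)%:E)%E).
    by apply: ereal_inf_lbound; exists n => //=.
  rewrite -[leLHS]fineK ?lee_fin; last exact: integrable_fin_num (iF n).
  exact: FC.
have i1 : itg f.
  apply/integrableP; split; first exact/measurable_EFinP.
  apply: le_lt_trans (ltry C); apply: le_trans key; apply: ge0_le_integral => //.
  - by apply: measurableT_comp => //; exact/measurable_EFinP.
  - exact/measurable_EFinP.
  - by move=> x _ /=; rewrite lee_fin ger0_norm.
split => //; rewrite -lee_fin /Int /Rintegral fineK//; exact: integrable_fin_num i1.
Unshelve. all: by end_near. Qed.

(** The image of Lebesgue measure under x -> c x + d, multiplied by c, gives every half-open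
    interval its length, hence is Lebesgue measure by uniqueness. *)
Let ge0_affine c d g : 0 < c -> (forall x, 0 <= g x) -> itg g ->
  itg (fun x => g (c * x + d)) /\ Int g = c * Int (fun x => g (c * x + d)).
Proof.
move=> c0 g0 ig.
pose phi : measurableTypeR R -> measurableTypeR R := fun x => c * x + d.
have mphi : measurable_fun setT phi.
  by apply: msbD; [apply: msbM; [exact: msb_cst|exact: msb_id]|exact: msb_cst].
pose nu0 : {measure set (measurableTypeR R) -> \bar R} :=
  mscale (NngNum (ltW c0)) (pushforward leb phi).
pose nu := nu0 mphi.
have leb_nu A : measurable A -> leb A = nu A.
  apply: lebesgue_measure_unique => _ [[a b]] _ <-.
  rewrite /nu /nu0 /= /mscale /= /pushforward.
  rewrite (_ : phi @^-1` _ = `](a - d) / c, (b - d) / c]%classic); last first.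
    apply/seteqP; split => x /=; rewrite !in_itv/= /phi.
      by rewrite ltr_pdivrMr// ler_pdivlMr// ltrBlDr lerBrDr mulrC.
    by rewrite ltr_pdivrMr// ler_pdivlMr// ltrBlDr lerBrDr mulrC.
  rewrite !lebesgue_measure_itv/= !lte_fin ltr_pM2r ?invr_gt0// ltrD2r.
  case: ifPn => _; last by rewrite mule0.
  rewrite -!EFinD -EFinM; congr (_%:E).
  rewrite -mulrBl mulrCA divff ?gt_eqF// mulr1; ring.
have mg := itg_msb ig.
have mge : measurable_fun [set: measurableTypeR R] (EFin \o g) by exact/measurable_EFinP.
have key : (\int[leb]_x (g x)%:E = c%:E * \int[leb]_x (g (c * x + d))%:E)%E.
  rewrite (@eq_measure_integral _ _ _ _ nu); last by move=> A mA _; exact: leb_nu.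
  rewrite /nu /nu0 ge0_integral_mscale//=; last by move=> x _; rewrite lee_fin.
  rewrite ge0_integral_pushforward//.
  by move=> x _ /=; rewrite lee_fin.
have i1 : itg (fun x => g (c * x + d)).
  apply/integrableP; split; first by apply/measurable_EFinP; exact: msb_comp.
  rewrite [X in integral _ _ X](_ : _ = (fun x => (g (c * x + d))%:E)); last first.
    by apply/funext => x /=; rewrite ger0_norm.
  have : (\int[leb]_x (g x)%:E < +oo)%E by apply: integrable_lty ig.
  rewrite key ltNge leye_eq => /negP h; rewrite ltNge leye_eq; apply/negP => /eqP e.
  by apply: h; rewrite e gt0_muley// lte_fin.
split => //; rewrite /Int /Rintegral key fineM//.
exact: integrable_fin_num i1.
Qed.

Lemma Int_affine c d f : 0 < c -> itg f ->
  itg (fun x => f (c * x + d)) /\ Int (fun x => f (c * x + d)) = c^-1 * Int f.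
Proof.
move=> c0 ig.
have [i1 e1] := ge0_affine d c0 (fun x => normr_ge0 (f x)) (itg_abs ig).
(* f is the difference of the nonnegative functions |f| and |f| - f, to which the previous result
   applies. *)
have h0 x : 0 <= `|f x| - f x by rewrite subr_ge0 ler_norm.
have ih := itgB (itg_abs ig) ig.
have [i2 e2] := ge0_affine d c0 h0 ih.
have i3 : itg (fun x => f (c * x + d)).
  have := itgB i1 i2; rewrite /itg; congr (integrable _ _ _).
  by apply/funext => x /=; congr EFin; ring.
split => //; suff <- : c * Int (fun x => f (c * x + d)) = Int f.
  by rewrite mulrA mulVf ?mul1r// gt_eqF.
transitivity (Int (fun x => `|f x|) - Int (fun x => `|f x| - f x)).
  by rewrite e1 e2 IntB//; ring.
rewrite -IntB//; last exact: itg_abs.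
by apply: eq_Int => x; ring.
Qed.

Lemma Int_opp f : itg f -> itg (fun x => f (- x)) /\ Int (fun x => f (- x)) = Int f.
Proof.
move=> ig; have mg := itg_msb ig.
pose phi : measurableTypeR R -> measurableTypeR R := -%R.
have mphi : measurable_fun setT phi by apply: msbN; exact: msb_id.
have key (g : measurableTypeR R -> \bar R) : measurable_fun setT g ->
    (forall x, 0 <= g x)%E -> (\int[leb]_x g x = \int[leb]_x g (phi x))%E.
  move=> mg' g0.
  rewrite (@eq_measure_integral _ _ _ _ (pushforward leb phi)); last first.
    by move=> A mA _; apply/esym; exact: lebesgue_measureN.
  by rewrite ge0_integral_pushforward.
have i1 : itg (fun x => f (- x)).
  apply/integrableP; split; first by apply/measurable_EFinP; exact: msb_comp.
  have /integrableP[_] := ig.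
  rewrite (key (fun x => `|(f x)%:E|)%E)//.
  by apply: measurableT_comp => //; exact/measurable_EFinP.
split => //; rewrite /Int /Rintegral; congr fine.
rewrite [RHS](@eq_measure_integral _ _ _ _ (pushforward leb phi)); last first.
  by move=> A mA _; apply/esym; exact: lebesgue_measureN.
by rewrite integral_pushforward//; exact/measurable_EFinP.
Qed.

Section Fubini.
Variables (F : R * R -> R) (g h : R -> R).
Hypothesis mF : measurable_fun [set: measurableTypeR R * measurableTypeR R]
  (F : measurableTypeR R * measurableTypeR R -> measurableTypeR R).
Hypothesis ig : itg g.
Hypothesis ih : itg h.
Hypothesis Fgh : forall x y, `|F (x, y)| <= g x * h y.

Let msec1 x : msb (fun y => F (x, y)).
Proof. by apply: (measurableT_comp mF); exact: measurable_fun_pair. Qed.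

Let msec2 y : msb (fun x => F (x, y)).
Proof. by apply: (measurableT_comp mF); exact: measurable_fun_pair. Qed.

(** Integrating the majorant |g x| |h y| first in y leaves a multiple of |g|, so the iterated
    integral of |F| is finite, which is Tonelli's criterion. *)
Let iF : (leb \x leb)%E.-integrable setT (EFin \o F).
Proof.
apply/integrable12ltyP; first exact/measurable_EFinP.
have g0 x : 0 <= `|g x| * `|h x| by rewrite mulr_ge0.
apply: (@le_lt_trans _ _ (\int[leb]_x (`|g x| * Int (fun y => `|h y|))%:E)%E); last first.
  under eq_integral do rewrite mulrC.
  exact: (integrable_lty measurableT (itgZ _ (itg_abs ig))).
apply: ge0_le_integral => //.
- by move=> x _; apply: integral_ge0.
- apply: (@measurable_fun_fubini_tonelli_F _ _ (measurableTypeR R) (measurableTypeR R) R leb (abse \o (EFin \o F))) => //=.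
  by apply: measurableT_comp => //; exact/measurable_EFinP.
- by apply/measurable_EFinP; apply: msbM; [apply: msb_abs; exact: itg_msb|exact: msb_cst].
- move=> x _; apply: (@le_trans _ _ (\int[leb]_y (`|g x| * `|h y|)%:E)%E).
    apply: ge0_le_integral => //.
    + by apply: measurableT_comp => //; apply/measurable_EFinP; exact: msec1.
    + by apply/measurable_EFinP; apply: msbM; [exact: msb_cst|apply: msb_abs; exact: itg_msb].
    + move=> y _ /=; rewrite lee_fin; apply: le_trans (Fgh x y) _.
      by rewrite -normrM ler_norm.
  rewrite -IntZ; last exact: itg_abs.
  rewrite /Int /Rintegral fineK//; apply: integrable_fin_num => //.
  by apply: itgZ; exact: itg_abs.
Qed.

Lemma itg_section1 x : itg (fun y => F (x, y)).
Proof. exact: itg_le (itgZ (g x) ih) (Fgh x). Qed.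

Lemma itg_section2 y : itg (fun x => F (x, y)).
Proof.
apply: (@itg_le _ (fun x => h y * g x)); last by move=> x; rewrite mulrC.
  exact: msec2.
exact: itgZ.
Qed.

Let FE x : ((Int (fun y => F (x, y)))%:E = \int[leb]_y (F (x, y))%:E)%E.
Proof. by rewrite /Int /Rintegral fineK//; apply: integrable_fin_num => //; exact: itg_section1. Qed.

Let GE y : ((Int (fun x => F (x, y)))%:E = \int[leb]_x (F (x, y))%:E)%E.
Proof. by rewrite /Int /Rintegral fineK//; apply: integrable_fin_num => //; exact: itg_section2. Qed.

Lemma itg_Fubini1 : itg (fun x => Int (fun y => F (x, y))).
Proof.
have := integrable_fubini_F iF; rewrite /itg /fubini_F; congr (integrable _ _ _).
by apply/funext => x /=; rewrite FE.
Qed.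

Lemma Int_Fubini :
  Int (fun x => Int (fun y => F (x, y))) = Int (fun y => Int (fun x => F (x, y))).
Proof.
rewrite {1}/Int {2}/Int /Rintegral; congr fine.
under eq_integral do rewrite FE.
under [RHS]eq_integral do rewrite GE.
exact: (Fubini iF).
Qed.

End Fubini.

End integrals.

(** * Newton-Leibniz formulas, decay classes and Cauchy-Schwarz *)

Section calculus_on_the_line.
Variable R : realType.
Local Notation leb := (@lebesgue_measure R).
Implicit Types f g h F : R -> R.

Lemma mitv (a b : R) :
  measurable_fun [set: measurableTypeR R] (fun x : R => (a <= x) && (x <= b)).
Proof. by apply: measurable_and; [exact: mge|exact: mle]. Qed.

Lemma ftc_itv f F (a b : R) : a <= b -> continuous f -> (forall x : R, is_derive x (1 : R) F (f x)) ->
  itg (fun x => if (a <= x) && (x <= b) then f x else 0) /\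
  Int (fun x => if (a <= x) && (x <= b) then f x else 0) = F b - F a.
Proof.
move=> ab cf dF.
have E : (fun x => if (a <= x) && (x <= b) then f x else 0) = f \_ `[a, b].
  by apply/funext => x; rewrite patchE mem_setE in_itv.
have i1 : leb.-integrable `[a, b] (EFin \o f).
  apply: continuous_compact_integrable; first exact: segment_compact.
  exact: continuous_subspaceT.
split.
  rewrite E /itg (_ : _ \o _ = (EFin \o f) \_ `[a, b]); last first.
    by apply/funext => x; rewrite /= !patchE; case: ifP.
  by rewrite -integrable_mkcond//.
rewrite /Int E -Rintegral_mkcond /Rintegral.
move: ab; rewrite le_eqVlt => /predU1P[<-|ab].
  by rewrite set_itv1 integral_set1/= subrr.
have cF : continuous F.
  by move=> x; apply: differentiable_continuous; apply/derivable1_diffP.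
rewrite (@continuous_FTC2 _ _ F)//.
- exact: continuous_subspaceT.
- split; first by move=> x _.
  + by apply: cvg_at_right_filter; exact: cF.
  + by apply: cvg_at_left_filter; exact: cF.
- by move=> x _; rewrite derive1E; exact: derive_val.
Qed.

Let cvg_cut f (x : R) :
  (fun n : nat => if (- n%:R <= x) && (x <= n%:R) then f x else 0) @ \oo --> f x.
Proof.
apply: cvg_near_cst; near=> n.
have : `|x| <= n%:R by near: n; exact: nbhs_infty_ger.
by rewrite ler_norml => ->.
Unshelve. all: by end_near. Qed.

(** Over [-n, n] the integral is F n - F (- n), at most 2 M; Fatou's lemma does the rest. *)
Lemma ftc_ge0_itg f F M : continuous f -> (forall x : R, is_derive x (1 : R) F (f x)) ->
  (forall x, 0 <= f x) -> (forall x, `|F x| <= M) -> itg f.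
Proof.
move=> cf dF f0 FM.
pose G (n : nat) x := if (- n%:R <= x) && (x <= n%:R) then f x else 0.
have hn (n : nat) : (- n%:R : R) <= n%:R by rewrite (@le_trans _ _ 0)// oppr_le0.
have [] // := @fatou_bound R G f (M + M).
- by move=> n; have [] := ftc_itv (hn n) cf dF.
- exact: msb_cont.
- by move=> n x; rewrite /G; case: ifP.
- by move=> x; exact: cvg_cut.
- move=> n; have [_ ->] := ftc_itv (hn n) cf dF.
  apply: le_trans (ler_norm _) _; apply: le_trans (ler_normB _ _) _.
  by apply: lerD.
Qed.

Lemma ftc_line f F l l' : continuous f -> (forall x : R, is_derive x (1 : R) F (f x)) -> itg f ->
  (fun n : nat => F n%:R) @ \oo --> l -> (fun n : nat => F (- n%:R)) @ \oo --> l' ->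
  Int f = l - l'.
Proof.
move=> cf dF fi Fl Fl'.
pose G (n : nat) x := if (- n%:R <= x) && (x <= n%:R) then f x else 0.
have hn (n : nat) : (- n%:R : R) <= n%:R by rewrite (@le_trans _ _ 0)// oppr_le0.
have [] := @dct R G f (fun x => `|f x|).
- by move=> n; apply: msb_if; [exact: mitv|exact: msb_cont|exact: msb_cst].
- exact: msb_cont.
- exact: itg_abs.
- by move=> n x; rewrite /G; case: ifP => // _; rewrite normr0.
- by move=> x; exact: cvg_cut.
move=> _ h; have h2 : (fun n => Int (G n)) @ \oo --> l - l'.
  rewrite (_ : (fun n => _) = (fun n : nat => F n%:R - F (- n%:R))).
    exact: cvgB.
  by apply/funext => n; have [_ ->] := ftc_itv (hn n) cf dF.
exact: (cvg_unique _ h h2).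
Qed.

Lemma ftc_left f F (a : R) : continuous f -> (forall x : R, is_derive x (1 : R) F (f x)) ->
  itg (fun x => if x <= a then f x else 0) ->
  (fun n : nat => F (- n%:R)) @ \oo --> (0 : R) ->
  Int (fun x => if x <= a then f x else 0) = F a.
Proof.
move=> cf dF fi Fl'.
(* The minimum keeps [b n, a] nonempty for the small n with - n > a; eventually b n = - n. *)
pose b (n : nat) := Num.min a (- n%:R).
pose G (n : nat) x := if (b n <= x) && (x <= a) then f x else 0.
have hn n : b n <= a by rewrite /b ge_min lexx.
have [] := @dct R G (fun x => if x <= a then f x else 0) (fun x => `|if x <= a then f x else 0|).
- by move=> n; apply: msb_if; [exact: mitv|exact: msb_cont|exact: msb_cst].
- by apply: msb_if; [exact: mle|exact: msb_cont|exact: msb_cst].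
- exact: itg_abs.
- by move=> n x; rewrite /G; case: (x <= a); rewrite ?andbF// andbT; case: ifP => // _; rewrite normr0.
- move=> x; apply: cvg_near_cst; near=> n.
  have : - x <= n%:R by near: n; exact: nbhs_infty_ger.
  by rewrite lerNl /G /b ge_min => ->; rewrite orbT.
move=> _ h; have h2 : (fun n => Int (G n)) @ \oo --> F a.
  rewrite -[F a]subr0.
  rewrite (_ : (fun n => _) = (fun n : nat => F a - F (b n))).
    apply: cvgB; first exact: cvg_cst.
    apply: cvg_trans Fl'; apply: near_eq_cvg; near=> n.
    have : - a <= n%:R by near: n; exact: nbhs_infty_ger.
    by rewrite lerNl /b => /min_idPr ->.
  by apply/funext => n; have [_ ->] := ftc_itv (hn n) cf dF.
exact: (cvg_unique _ h h2).
Unshelve. all: by end_near. Qed.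

(** The derivative of [atan], whence its integral pi. It serves both as the unit of decay for the
    functions below and as the profile of the Poisson kernel. *)
Definition w1 (x : R) := (1 + x ^+ 2)^-1.

Let w1_den_gt0 (x : R) : 0 < 1 + x ^+ 2.
Proof. by rewrite ltr_wpDr// sqr_ge0. Qed.

Lemma w1_gt0 x : 0 < w1 x.
Proof. by rewrite invr_gt0. Qed.

Lemma w1_ge0 x : 0 <= w1 x.
Proof. exact/ltW/w1_gt0. Qed.

Lemma w1_le1 x : w1 x <= 1.
Proof. by rewrite invf_le1// lerDl sqr_ge0. Qed.

Lemma w1_cont : continuous w1.
Proof.
move=> x; rewrite /continuous_at /w1; apply: cvgV; first by rewrite gt_eqF.
by apply: cvgD; [exact: cvg_cst|exact: exprn_continuous].
Qed.

Lemma w1_msb : msb w1.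
Proof. by apply: msb_cont; exact: w1_cont. Qed.

(** A form of Peetre's inequality, which lets a convolution inherit the decay of its factors. The
    difference 2 (1 + y^2) (1 + (x - y)^2) - (1 + x^2) is 1 plus a sum of squares. *)
Lemma w1_tri x y : w1 (x - y) * w1 y <= 2 * w1 x.
Proof.
rewrite /w1 -invfM -[leRHS]invrK lef_pV2 ?posrE ?invr_gt0 ?mulr_gt0 ?invr_gt0//.
rewrite invfM invrK mulrC ler_pdivrMr// -subr_ge0.
rewrite (_ : _ - _ = 1 + (x - 2 * y) ^+ 2 + 2 * (y * (x - y)) ^+ 2); last by ring.
by rewrite !addr_ge0 ?sqr_ge0// mulr_ge0// sqr_ge0.
Qed.

Lemma w1_itg : itg w1.
Proof.
apply: (@ftc_ge0_itg w1 atan pi).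
- exact: w1_cont.
- exact: w1_ge0.
- move=> x; rewrite ler_norml; apply/andP; split.
    by apply: le_trans _ (ltW (atan_gtNpi2 x)); rewrite lerN2 ler_pdivrMr// ler_peMr ?pi_ge0// ler1n.
  by apply: le_trans (ltW (atan_ltpi2 x)) _; rewrite ler_pdivrMr// ler_peMr ?pi_ge0// ler1n.
Qed.

Lemma Int_w1 : Int w1 = pi.
Proof.
rewrite (@ftc_line w1 atan (pi / 2) (- (pi / 2)))//; first by field.
- exact: w1_cont.
- exact: w1_itg.
- by have /cvg_pinftyP/(_ _ cvgr_idn) := @cvgy_atan R.
- under eq_cvg do rewrite atanN.
  by apply: cvgN; have /cvg_pinftyP/(_ _ cvgr_idn) := @cvgy_atan R.
Qed.

(** The working space: it lies in L^1, in L^2 and in the bounded functions, is closed under cutting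
    at a point, and is stable under convolution with the kernel ([P_dec]). *)
Definition dec f := msb f /\ exists C, forall x, `|f x| <= C * w1 x ^+ 2.

Lemma dec_le f g C : msb f -> dec g -> (forall x, `|f x| <= C * `|g x|) -> dec f.
Proof.
move=> mf [mg [D gD]] fg; split => //; exists (`|C| * D) => x.
apply: le_trans (fg x) _; rewrite -mulrA; apply: le_trans (ler_wpM2l _ (gD x)) => //.
by rewrite ler_wpM2r// ler_norm.
Qed.

Lemma decC_ge0 f C : (forall x, `|f x| <= C * w1 x ^+ 2) -> 0 <= C.
Proof.
move=> /(_ 0)/(le_trans (normr_ge0 _)); rewrite pmulr_lge0//.
by rewrite exprn_gt0// w1_gt0.
Qed.

Lemma dec_itg f : dec f -> itg f.
Proof.
move=> [mf [C fC]]; apply: (itg_le mf (itgZ C w1_itg)) => x.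
apply: le_trans (fC x) _; rewrite ler_wpM2l ?(decC_ge0 fC)// expr2.
by rewrite ler_piMr ?w1_ge0 ?w1_le1.
Qed.

Lemma dec_bnd f : dec f -> exists2 C, 0 <= C & forall x, `|f x| <= C.
Proof.
move=> [mf [C fC]]; exists C; first exact: decC_ge0 fC.
move=> x; apply: le_trans (fC x) _; rewrite ler_piMr ?(decC_ge0 fC)//.
by rewrite exprn_ile1 ?w1_ge0 ?w1_le1.
Qed.

Lemma decM f g C : dec f -> msb g -> (forall x, `|g x| <= C) -> dec (fun x => g x * f x).
Proof.
move=> df mg gC; apply: (@dec_le _ f C) => //; first by apply: msbM => //; case: df.
by move=> x; rewrite normrM ler_wpM2r.
Qed.

Lemma dec_mul f g : dec f -> dec g -> dec (fun x => f x * g x).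
Proof. by move=> df dg; have [C _ fC] := dec_bnd df; apply: decM dg _ fC; case: df. Qed.

Lemma decZ r f : dec f -> dec (fun x => r * f x).
Proof. by move=> df; apply: (@decM f (fun=> r) `|r|) => //; exact: msb_cst. Qed.

Lemma decD f g : dec f -> dec g -> dec (fun x => f x + g x).
Proof.
move=> [mf [C fC]] [mg [D gD]]; split; first exact: msbD.
by exists (C + D) => x; rewrite mulrDl (le_trans (ler_normD _ _))// lerD.
Qed.

Lemma decN f : dec f -> dec (fun x => - f x).
Proof. by move=> /(decZ (-1)); under eq_fun do rewrite mulN1r. Qed.

Lemma decB f g : dec f -> dec g -> dec (fun x => f x - g x).
Proof. by move=> df /decN; exact: decD. Qed.

Lemma dec0 : dec (fun=> 0).
Proof. by split; [exact: msb_cst|exists 0 => x; rewrite normr0 mul0r]. Qed.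

Lemma dec_if (b : R -> bool) f g :
  measurable_fun [set: measurableTypeR R] b -> dec f -> dec g ->
  dec (fun x => if b x then f x else g x).
Proof.
move=> mb [mf [C fC]] [mg [D gD]]; split; first exact: msb_if.
exists (C + D) => x; rewrite mulrDl; case: ifP => _.
  by rewrite -[leLHS]addr0 lerD// (le_trans (normr_ge0 _) (gD x)).
by rewrite -[leLHS]add0r lerD// (le_trans (normr_ge0 _) (fC x)).
Qed.

(** The source of Cauchy-Schwarz for every positive semidefinite form met below: the L^2 product,
    <f, P g> and <f, g - P g>. *)
Lemma discriminant (a b c : R) : (forall s t : R, 0 <= a * s ^+ 2 - 2 * b * s * t + c * t ^+ 2) ->
  b ^+ 2 <= a * c.
Proof.
move=> h; have a0 : 0 <= a.
  by have := h 1 0; rewrite (_ : _ + _ = a)//; ring.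
move: a0; rewrite le_eqVlt => /predU1P[a0|a0]; last first.
  have := h b a; rewrite (_ : _ + _ = a * (a * c - b ^+ 2)); last by ring.
  by rewrite pmulr_rge0// subr_ge0.
rewrite -a0 mul0r; have [->|b0] := eqVneq b 0; first by rewrite expr0n.
(* When a = 0 and t = 1 the form is affine in s; this value of s makes it equal to -1. *)
have := h ((c + 1) / (2 * b)) 1; rewrite -a0 (_ : _ + _ = -1); last by field.
by rewrite lerNr oppr0 ler10.
Qed.

Lemma CS_Int f g : itg (fun x => f x ^+ 2) -> itg (fun x => g x ^+ 2) -> itg (fun x => f x * g x) ->
  Int (fun x => f x * g x) ^+ 2 <= Int (fun x => f x ^+ 2) * Int (fun x => g x ^+ 2).
Proof.
move=> i1 i2 i3; apply: discriminant => s t.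
have -> : Int (fun x => f x ^+ 2) * s ^+ 2 - 2 * Int (fun x => f x * g x) * s * t +
    Int (fun x => g x ^+ 2) * t ^+ 2 = Int (fun x => (s * f x - t * g x) ^+ 2).
  transitivity (Int (fun x => s ^+ 2 * f x ^+ 2 - (2 * s * t) * (f x * g x) + t ^+ 2 * g x ^+ 2)).
    rewrite IntD ?IntB ?IntZ//; try exact: itgZ.
    - by ring.
    - by apply: itgB; exact: itgZ.
  by apply: eq_Int => x; ring.
by apply: Int_ge0 => x; exact: sqr_ge0.
Qed.

End calculus_on_the_line.

(** * Fourier transforms *)

Section fourier.
Variable R : realType.
Local Notation leb := (@lebesgue_measure R).
Local Notation RB := (measurableTypeR R).
Implicit Types f g h w : R -> R.

Lemma msb_cos : msb (@cos R). Proof. by apply: msb_cont; exact: continuous_cos. Qed.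
Lemma msb_sin : msb (@sin R). Proof. by apply: msb_cont; exact: continuous_sin. Qed.
Lemma msb_expR : msb (@expR R). Proof. by apply: msb_cont; exact: continuous_expR. Qed.

Lemma msb2_comp d (T : measurableType d) f (g : T -> RB) : msb f -> measurable_fun setT g ->
  measurable_fun setT (fun x => f (g x) : RB).
Proof. by move=> mf mg; apply: (measurableT_comp mf mg). Qed.

(** Two real transforms stand for the complex one: convolution with an even kernel multiplies both
    by the same real factor. *)
Definition fcos f (u : R) := Int (fun x => f x * cos (u * x)).
Definition fsin f (u : R) := Int (fun x => f x * sin (u * x)).

Lemma msb_cosM (u : R) : msb (fun x => cos (u * x)).
Proof. by apply: msb_comp; [exact: msb_cos|apply: msbM; [exact: msb_cst|exact: msb_id]]. Qed.

Lemma msb_sinM (u : R) : msb (fun x => sin (u * x)).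
Proof. by apply: msb_comp; [exact: msb_sin|apply: msbM; [exact: msb_cst|exact: msb_id]]. Qed.

Lemma itgM f g C : itg f -> msb g -> (forall x, `|g x| <= C) -> itg (fun x => f x * g x).
Proof.
move=> fi mg gC; apply: (itg_le _ (itgZ C (itg_abs fi))); first by apply: msbM => //; exact: itg_msb.
by move=> x; rewrite normrM mulrC ler_wpM2r.
Qed.

Lemma itg_cos f (u : R) : itg f -> itg (fun x => f x * cos (u * x)).
Proof. by move=> fi; apply: (itgM fi (msb_cosM u)) => x; exact: cos_max. Qed.

Lemma itg_sin f (u : R) : itg f -> itg (fun x => f x * sin (u * x)).
Proof. by move=> fi; apply: (itgM fi (msb_sinM u)) => x; exact: sin_max. Qed.

Lemma fcos_le f u : itg f -> `|fcos f u| <= Int (fun x => `|f x|).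
Proof.
move=> fi; apply: abs_Int_le; [by apply: itg_msb; exact: itg_cos|exact: itg_abs|] => x.
by rewrite normrM ler_piMr// cos_max.
Qed.

Lemma fsin_le f u : itg f -> `|fsin f u| <= Int (fun x => `|f x|).
Proof.
move=> fi; apply: abs_Int_le; [by apply: itg_msb; exact: itg_sin|exact: itg_abs|] => x.
by rewrite normrM ler_piMr// sin_max.
Qed.

(** Measurability in u is extracted from Fubini's theorem, which asks for integrability in u as
    well: the factor [w1 u] provides it and is divided out at the end. *)
Lemma msb_param (k : R -> R) f : msb k -> (forall x, `|k x| <= 1) -> itg f ->
  msb (fun u => Int (fun x => f x * k (u * x))).
Proof.
move=> mk k1 fi.
have h := @itg_Fubini1 R (fun z => w1 z.1 * (f z.2 * k (z.1 * z.2))) (@w1 R) (fun x => `|f x|).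
have {h}/itg_msb h : itg (fun u => Int (fun x => w1 u * (f x * k (u * x)))).
  apply: h => //=; last 2 first.
  - exact: itg_abs.
  - move=> x y; rewrite !normrM (ger0_norm (w1_ge0 _)) ler_wpM2l ?w1_ge0//.
    by rewrite ler_piMr.
  - apply: measurable_funM; first by apply: (msb2_comp (@w1_msb R)); exact: measurable_fst.
    apply: measurable_funM; first by apply: (msb2_comp (itg_msb fi)); exact: measurable_snd.
    by apply: (msb2_comp mk); apply: measurable_funM.
  - exact: w1_itg.
have -> : (fun u => Int (fun x => f x * k (u * x))) =
    (fun u => (1 + u ^+ 2) * Int (fun x => w1 u * (f x * k (u * x)))).
  apply/funext => u; rewrite IntZ; last first.
    apply: (@itgM f (fun x => k (u * x)) 1) => //.
    by apply: msb_comp => //; apply: msbM; [exact: msb_cst|exact: msb_id].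
  by rewrite mulrA divff ?mul1r// gt_eqF// ltr_wpDr// sqr_ge0.
by apply: msbM => //; apply: msbD; [exact: msb_cst|apply: msbX; exact: msb_id].
Qed.

Lemma msb_fcos f : itg f -> msb (fcos f).
Proof. by apply: msb_param; [exact: msb_cos|exact: cos_max]. Qed.

Lemma msb_fsin f : itg f -> msb (fsin f).
Proof. by apply: msb_param; [exact: msb_sin|exact: sin_max]. Qed.

(** [w] lives on the frequency side: the convolution kernel is its transform, so [w] acts as a
    multiplier. Both the fundamental solution and the Poisson kernel have this form. *)
Lemma conv_fcos w f x : itg w -> itg f ->
  Int (fun y => fcos w (x - y) * f y) =
  Int (fun u => w u * (cos (u * x) * fcos f u + sin (u * x) * fsin f u)).
Proof.
move=> iw fi.
transitivity (Int (fun y => Int (fun u => f y * (w u * cos ((x - y) * u))))).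
  by apply: eq_Int => y; rewrite IntZ; [rewrite mulrC|exact: itg_cos].
rewrite (@Int_Fubini R (fun z => f z.1 * (w z.2 * cos ((x - z.1) * z.2)))
    (fun y => `|f y|) (fun u => `|w u|)) /=; last 4 first.
- apply: measurable_funM; first by apply: (msb2_comp (itg_msb fi)); exact: measurable_fst.
  apply: measurable_funM; first by apply: (msb2_comp (itg_msb iw)); exact: measurable_snd.
  by apply: (msb2_comp msb_cos); apply: measurable_funM => //; apply: measurable_funB.
- exact: itg_abs.
- exact: itg_abs.
- by move=> y u; rewrite !normrM ler_wpM2l// ler_piMr// cos_max.
apply: eq_Int => u.
transitivity (Int (fun y => (w u * cos (u * x)) * (f y * cos (u * y)) +
                            (w u * sin (u * x)) * (f y * sin (u * y)))).
  by apply: eq_Int => y; rewrite mulrBl cosB (mulrC x) (mulrC y); ring.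
rewrite IntD; [|by apply: itgZ; exact: itg_cos|by apply: itgZ; exact: itg_sin].
rewrite IntZ; last exact: itg_cos.
rewrite IntZ; last exact: itg_sin.
by rewrite /fcos /fsin; ring.
Qed.

(** The form is diagonal in frequency, hence symmetric, and positive as soon as [w] is
    nonnegative. *)
Lemma form_fcos w f g : itg w -> itg f -> itg g ->
  Int (fun x => g x * Int (fun y => fcos w (x - y) * f y)) =
  Int (fun u => w u * (fcos f u * fcos g u + fsin f u * fsin g u)).
Proof.
move=> iw fi gi.
pose I1 h := Int (fun x => `|h x|).
have I10 h : 0 <= I1 h by apply: Int_ge0.
have hb u x : `|cos (u * x) * fcos f u + sin (u * x) * fsin f u| <= I1 f + I1 f.
  apply: le_trans (ler_normD _ _) _; rewrite !normrM.
  apply: lerD; rewrite -[leRHS]mul1r; apply: ler_pM => //.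
  - exact: cos_max.
  - exact: fcos_le.
  - exact: sin_max.
  - exact: fsin_le.
transitivity (Int (fun x => Int (fun u => g x * (w u *
    (cos (u * x) * fcos f u + sin (u * x) * fsin f u))))).
  apply: eq_Int => x; rewrite conv_fcos// IntZ//.
  apply: (itgM iw (C := I1 f + I1 f)) => //.
  apply: msbD; apply: msbM; [|exact: msb_fcos| |exact: msb_fsin].
  - by under eq_fun do rewrite mulrC; exact: msb_cosM.
  - by under eq_fun do rewrite mulrC; exact: msb_sinM.
rewrite (@Int_Fubini R (fun z => g z.1 * (w z.2 *
    (cos (z.2 * z.1) * fcos f z.2 + sin (z.2 * z.1) * fsin f z.2)))
    (fun x => `|g x|) (fun u => (I1 f + I1 f) * `|w u|)) /=; last 4 first.
- apply: measurable_funM; first by apply: (msb2_comp (itg_msb gi)); exact: measurable_fst.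
  apply: measurable_funM; first by apply: (msb2_comp (itg_msb iw)); exact: measurable_snd.
  apply: measurable_funD; apply: measurable_funM.
  + by apply: (msb2_comp msb_cos); apply: measurable_funM.
  + by apply: (msb2_comp (msb_fcos fi)); exact: measurable_snd.
  + by apply: (msb2_comp msb_sin); apply: measurable_funM.
  + by apply: (msb2_comp (msb_fsin fi)); exact: measurable_snd.
- exact: itg_abs.
- exact/itgZ/itg_abs.
- by move=> x u; rewrite 2!normrM ler_wpM2l// mulrC ler_wpM2r.
apply: eq_Int => u.
transitivity (Int (fun x => (w u * fcos f u) * (g x * cos (u * x)) +
                            (w u * fsin f u) * (g x * sin (u * x)))).
  by apply: eq_Int => x; ring.
rewrite IntD; [|by apply: itgZ; exact: itg_cos|by apply: itgZ; exact: itg_sin].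
rewrite IntZ; last exact: itg_cos.
rewrite IntZ; last exact: itg_sin.
by rewrite /fcos /fsin; ring.
Qed.

Lemma Int_split f (a : R) : itg f -> Int f =
  Int (fun x => if x <= a then f x else 0) + Int (fun x => if a <= x then f x else 0).
Proof.
move=> fi; have mf := itg_msb fi.
have i1 : itg (fun x => if x <= a then f x else 0).
  apply: (itg_le _ (itg_abs fi)); first by apply: msb_if; [exact: mle| |exact: msb_cst].
  by move=> x; case: ifP => // _; rewrite normr0.
have i2 : itg (fun x => if a <= x then f x else 0).
  apply: (itg_le _ (itg_abs fi)); first by apply: msb_if; [exact: mge| |exact: msb_cst].
  by move=> x; case: ifP => // _; rewrite normr0.
(* The point a belongs to both halves; the surplus lives on the degenerate interval [a, a] and
   integrates to 0. *)
have [i3 e3] := @ftc_itv R (fun=> f a) (fun x => f a * x) a a (lexx _) (fun x => cvg_cst _)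
  (fun x => is_derive_eq (is_deriveZ (f a) (is_derive_id x 1)) (mulr1 (f a))).
rewrite -IntD// -[LHS]addr0 -[X in _ + X](subrr (f a * a)) -e3 -IntD//.
apply: eq_Int => x; case: (ltgtP x a) => [xa|ax|->] //=; rewrite ?addr0 ?add0r//.
Qed.

Lemma cvg0_le (u : nat -> R) C (v : nat -> R) : (forall n, `|u n| <= C * v n) ->
  v @ \oo --> (0 : R) -> u @ \oo --> (0 : R).
Proof.
move=> uv v0; have Cv : (fun n => C * v n) @ \oo --> (0 : R).
  by rewrite -(mulr0 C); apply: cvgM => //; exact: cvg_cst.
apply: (@squeeze_cvgr _ _ _ _ (fun n => - (C * v n)) (fun n => C * v n)) => //.
  by apply: nearW => n; have := uv n; rewrite ler_norml.
by rewrite -oppr0; exact: cvgN.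
Qed.

(** Abel's convergence factor: it makes the frequency integrals converge and is removed by letting e
    tend to 0. Its transform is explicit and positive. *)
Definition expabs (e u : R) := expR (- (e * `|u|)).

Let expabs_der (e xi u : R) : 0 < e ->
  is_derive u (1 : R) (fun u => w1 (xi / e) / e ^+ 2 * (expR (e * u) * (e * cos (xi * u) + xi * sin (xi * u))))
  (expR (e * u) * cos (xi * u)).
Proof.
move=> e0.
have H : e != 0 by rewrite gt_eqF.
have H2 : e ^+ 2 + xi ^+ 2 != 0.
  by rewrite gt_eqF// ltr_wpDr ?sqr_ge0// exprn_gt0.
apply: is_derive_eq.
rewrite /w1 /GRing.scale /=.
have -> : 1 + (xi / e) ^+ 2 = (e ^+ 2 + xi ^+ 2) / e ^+ 2 by field.
by field; rewrite H H2.
Qed.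

Let expabs_msb e : msb (expabs e).
Proof.
apply: (msb_comp msb_expR); apply: msbN; apply: msbM; first exact: msb_cst.
by apply: msb_abs; exact: msb_id.
Qed.

Let expabs_itg e : 0 < e -> itg (expabs e).
Proof.
move=> e0; have e20 : 0 < e ^+ 2 by rewrite exprn_gt0.
have H : e != 0 by rewrite gt_eqF.
have [i1 _] : itg (fun x => w1 (e * x + 0)) /\ Int (fun x => w1 (e * x + 0)) = e^-1 * Int (@w1 R).
  by apply: Int_affine => //; exact: w1_itg.
apply: (itg_le (expabs_msb e) (itgZ 2 i1)) => u.
rewrite addr0 /expabs expRN normfV ger0_norm ?expR_ge0// /w1.
rewrite ler_pdivlMr ?ltr_wpDr ?sqr_ge0// mulrC ler_pdivrMr ?expR_gt0//.
have := @expR_ge1Dxn R (e * `|u|) 1 (mulr_ge0 (ltW e0) (normr_ge0 u)).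
rewrite (_ : (e * `|u|) ^+ 2 = (e * u) ^+ 2); last by rewrite !exprMn real_normK ?num_real.
by rewrite (_ : 2`!%:R = 2)//; have := sqr_ge0 (e * u); lra.
Qed.

(* The Poisson kernel, as the Fourier transform of [expabs]. *)
Lemma fcos_expabs e xi : 0 < e -> fcos (expabs e) xi = 2 / e * w1 (xi / e).
Proof.
move=> e0; have H : e != 0 by rewrite gt_eqF.
have ie := itg_cos xi (expabs_itg e0).
have left_half : Int (fun x => if x <= 0 then expabs e x * cos (xi * x) else 0) = w1 (xi / e) / e.
  pose F (u : R) := w1 (xi / e) / e ^+ 2 * (expR (e * u) * (e * cos (xi * u) + xi * sin (xi * u))).
  have E : (fun x => if x <= 0 then expabs e x * cos (xi * x) else 0) =
      (fun x => if x <= 0 then expR (e * x) * cos (xi * x) else 0).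
    apply/funext => x; case: ifP => // x0; rewrite /expabs ler0_norm//.
    by rewrite mulrN opprK.
  have -> : w1 (xi / e) / e = F 0 by rewrite /F !mulr0 expR0 cos0 sin0; field.
  rewrite E; apply: (@ftc_left R (fun x => expR (e * x) * cos (xi * x)) F 0).
  - move=> x; apply: cvgM; apply: continuous_comp.
    + exact: mulrl_continuous.
    + exact: continuous_expR.
    + exact: mulrl_continuous.
    + exact: continuous_cos.
  - by move=> x; apply: expabs_der.
  - rewrite -E; apply: (itg_le _ (itg_abs ie)).
      by apply: msb_if; [exact: mle|exact: itg_msb|exact: msb_cst].
    by move=> x; case: ifP => // _; rewrite normr0.
  - apply: (@cvg0_le _ (w1 (xi / e) / e ^+ 2 * (e + `|xi|)) (fun n : nat => expR (- (e * n%:R)))).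
      move=> n; rewrite /F !normrM (ger0_norm (w1_ge0 _)) normfV mulrN.
      rewrite (ger0_norm (expR_ge0 _)) (ger0_norm (sqr_ge0 _)) -[leRHS]mulrA ler_wpM2l//.
        by rewrite mulr_ge0 ?w1_ge0// invr_ge0 sqr_ge0.
      rewrite mulrC ler_wpM2r ?expR_ge0//.
      apply: le_trans (ler_normD _ _) _; rewrite !normrM (gtr0_norm e0).
      apply: lerD; first by rewrite ler_piMr ?cos_max// ltW.
      by rewrite ler_piMr ?sin_max.
    have /cvg_pinftyP := @cvgr_expR R; apply.
    apply/cvgryPge => A; near=> n; rewrite mulrC -ler_pdivrMr//.
    by near: n; exact: nbhs_infty_ger.
have right_half : Int (fun x => if 0 <= x then expabs e x * cos (xi * x) else 0) = w1 (xi / e) / e.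
  have i1 : itg (fun x => if x <= 0 then expabs e x * cos (xi * x) else 0).
    apply: (itg_le _ (itg_abs ie)).
      by apply: msb_if; [exact: mle|exact: itg_msb|exact: msb_cst].
    by move=> x; case: ifP => // _; rewrite normr0.
  rewrite -left_half; have [_ <-] := Int_opp i1.
  apply: eq_Int => x; rewrite oppr_le0; case: ifP => // _.
  by rewrite /expabs normrN mulrN cosN.
by rewrite /fcos (Int_split 0 ie) left_half right_half; field.
Unshelve. all: by end_near. Qed.

(** With y = x + e s the Poisson kernel becomes the fixed weight [w1], and e moves into the argument
    of f, where it can tend to 0. *)
Lemma poisson_subst e x f C : 0 < e -> msb f -> (forall y, `|f y| <= C) ->
  itg (fun y => fcos (expabs e) (x - y) * f y) /\
  Int (fun y => fcos (expabs e) (x - y) * f y) = 2 * Int (fun s => w1 s * f (e * s + x)).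
Proof.
move=> e0 mf fC; have H : e != 0 by rewrite gt_eqF.
have ei0 : 0 < e^-1 by rewrite invr_gt0.
pose G s := w1 s * f (e * s + x).
have iG : itg G.
  apply: (itgM (@w1_itg R) _ (C := C)) => //; apply: (msb_comp mf).
  by apply: msbD; [apply: msbM; [exact: msb_cst|exact: msb_id]|exact: msb_cst].
have [i1 e1] := @Int_affine R e^-1 (- (x / e)) G ei0 iG.
have E : (fun y => fcos (expabs e) (x - y) * f y) = (fun y => (2 / e) * G (e^-1 * y + - (x / e))).
  apply/funext => y; rewrite fcos_expabs// /G /w1.
  have -> : e * (e^-1 * y - x / e) + x = y by field.
  have -> : ((x - y) / e) ^+ 2 = (e^-1 * y - x / e) ^+ 2 by field.
  by rewrite mulrA.
rewrite E; split; first exact: itgZ.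
by rewrite IntZ// e1 invrK mulrA divfK.
Qed.

Lemma approx_id f x C (u : nat -> R) : msb f -> (forall y, `|f y| <= C) -> {for x, continuous f} ->
  u @ \oo --> (0 : R) ->
  (fun n : nat => 2 * Int (fun s => w1 s * f (u n * s + x))) @ \oo --> 2 * pi * f x.
Proof.
move=> mf fC cf u0; rewrite -mulrA -Int_w1 -IntZr ?w1_itg//; last exact: w1_itg.
apply: cvgM; first exact: cvg_cst.
apply: (dct (g := fun s => C * w1 s) _ _ _ _ _).2.
- move=> n; apply: msbM; first exact: w1_msb.
  apply: (msb_comp mf); apply: msbD; last exact: msb_cst.
  by apply: msbM; [exact: msb_cst|exact: msb_id].
- by apply: msbM; [exact: w1_msb|exact: msb_cst].
- exact/itgZ/w1_itg.
- by move=> n s; rewrite normrM (ger0_norm (w1_ge0 _)) mulrC ler_wpM2r ?w1_ge0.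
- move=> s; apply: cvgM; first exact: cvg_cst.
  apply: (@cvg_comp _ _ _ (fun n => u n * s + x) f _ (nbhs x)); last exact: cf.
  have : (fun n => u n * s + x) @ \oo --> 0 * s + x.
    by apply: cvgD; [apply: cvgM => //; exact: cvg_cst|exact: cvg_cst].
  by rewrite mul0r add0r.
Qed.

Definition fsq f u := fcos f u ^+ 2 + fsin f u ^+ 2.

Lemma fsq_ge0 f u : 0 <= fsq f u.
Proof. by rewrite addr_ge0// sqr_ge0. Qed.

Lemma msb_fsq f : itg f -> msb (fsq f).
Proof. by move=> fi; apply: msbD; apply: msbX; [exact: msb_fcos|exact: msb_fsin]. Qed.

Let eps (n : nat) : R := n.+1%:R^-1.

Let eps_gt0 n : 0 < eps n.
Proof. by rewrite invr_gt0. Qed.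

Let eps_cvg : eps @ \oo --> (0 : R).
Proof. exact: cvg_harmonic. Qed.

Let shift_meas f e : msb f ->
  measurable_fun setT (fun z : RB * RB => f z.1 * (w1 z.2 * f (e * z.2 + z.1)) : RB).
Proof.
move=> mf; apply: measurable_funM; first by apply: (msb2_comp mf); exact: measurable_fst.
apply: measurable_funM; first by apply: (msb2_comp (@w1_msb R)); exact: measurable_snd.
apply: (msb2_comp mf); apply: measurable_funD; last exact: measurable_fst.
by apply: measurable_funM; [exact: measurable_cst|exact: measurable_snd].
Qed.

Let shift_bnd f e C : (forall x, `|f x| <= C) ->
  forall x s, `|f x * (w1 s * f (e * s + x))| <= `|f x| * (C * w1 s).
Proof.
move=> fC x s; rewrite 2!normrM ler_wpM2l// (ger0_norm (w1_ge0 _)) mulrC.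
by rewrite ler_wpM2r ?w1_ge0.
Qed.

Let shift_itg f e x C : msb f -> (forall x, `|f x| <= C) -> itg (fun s => w1 s * f (e * s + x)).
Proof.
move=> mf fC; apply: (itgM (@w1_itg R) _ (C := C)) => //; apply: (msb_comp mf).
by apply: msbD; [apply: msbM; [exact: msb_cst|exact: msb_id]|exact: msb_cst].
Qed.

Let shift_Int_itg f e : dec f -> itg (fun x => Int (fun s => f x * (w1 s * f (e * s + x)))).
Proof.
move=> df; have fi := dec_itg df; have [C C0 fC] := dec_bnd df.
apply: (@itg_Fubini1 R (fun z => f z.1 * (w1 z.2 * f (e * z.2 + z.1))) (fun x => `|f x|)
  (fun s => C * w1 s)).
- by apply: shift_meas; exact: itg_msb.
- exact: itg_abs.
- by apply: itgZ; exact: w1_itg.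
- by move=> x y /=; exact: shift_bnd.
Qed.

(** The integral in x stays outside: for continuous f the inner integral converges at each x, which
    suits the dominated convergence of [Plancherel_ge]. *)
Let abel_form1 f n : dec f ->
  Int (fun u => expabs (eps n) u * fsq f u) =
  Int (fun x => 2 * Int (fun s => f x * (w1 s * f (eps n * s + x)))).
Proof.
move=> df; have fi := dec_itg df; have [C C0 fC] := dec_bnd df; have mf := itg_msb fi.
transitivity (Int (fun x => f x * Int (fun y => fcos (expabs (eps n)) (x - y) * f y))).
  rewrite form_fcos//; last exact: expabs_itg.
apply: eq_Int => x; have [_ ->] := poisson_subst x (eps_gt0 n) mf fC.
by rewrite [in RHS]IntZ; [rewrite mulrCA|exact: (shift_itg _ _ mf fC)].
Qed.

(** The integral over the shift s is now outside: at fixed s the inner integral is a correlation of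
    f with a translate of itself. This is the form that [Bessel] bounds. *)
Let abel_form f n : dec f ->
  Int (fun u => expabs (eps n) u * fsq f u) =
  2 * Int (fun s => w1 s * Int (fun x => f x * f (eps n * s + x))).
Proof.
move=> df; have fi := dec_itg df; have [C C0 fC] := dec_bnd df; have mf := itg_msb fi.
rewrite abel_form1// IntZ; last exact: shift_Int_itg.
congr (_ * _).
rewrite (@Int_Fubini R (fun z => f z.1 * (w1 z.2 * f (eps n * z.2 + z.1)))
    (fun x => `|f x|) (fun s => C * w1 s)) /=; last 4 first.
- exact: shift_meas.
- exact: itg_abs.
- by apply: itgZ; exact: w1_itg.
- by move=> x y /=; exact: shift_bnd.
apply: eq_Int => s; rewrite -IntZ; first by apply: eq_Int => x; ring.
apply: (itgM fi (C := C)) => //; apply: (msb_comp mf).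
by apply: msbD; [exact: msb_cst|exact: msb_id].
Qed.

Let expabs_cvg u : expabs (eps n) u @[n --> \oo] --> (1 : R).
Proof.
rewrite -expR0; apply: (@cvg_comp _ _ _ (fun n => - (eps n * `|u|)) expR _ (nbhs 0)); last first.
  exact: continuous_expR.
rewrite -oppr0 -(mul0r `|u|); apply: cvgN; apply: cvgM; [exact: eps_cvg|exact: cvg_cst].
Qed.

Let expabs_le1 n u : expabs (eps n) u <= 1.
Proof. by rewrite expR_le1 oppr_le0 mulr_ge0// ltW. Qed.

Let itg_expabs_fsq n f : itg f -> itg (fun u => expabs (eps n) u * fsq f u).
Proof.
move=> fi; apply: (itgM (expabs_itg (eps_gt0 n)) (msb_fsq fi)
  (C := Int (fun x => `|f x|) ^+ 2 + Int (fun x => `|f x|) ^+ 2)) => u.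
rewrite ger0_norm ?fsq_ge0//; apply: lerD.
  by rewrite -[leLHS]real_normK ?num_real// lerXn2r ?nnegrE ?fcos_le// (le_trans _ (fcos_le 0 fi)).
by rewrite -[leLHS]real_normK ?num_real// lerXn2r ?nnegrE ?fsin_le// (le_trans _ (fcos_le 0 fi)).
Qed.

Lemma dec_sq_itg f : dec f -> itg (fun x => f x ^+ 2).
Proof. by move=> df; apply: dec_itg; exact: dec_mul. Qed.

(** An inequality that holds across jumps: it will be applied to functions cut at 0 and to a
    possibly discontinuous derivative of order N/2. *)
Lemma Bessel f : dec f -> itg (fsq f) /\ Int (fsq f) <= 2 * pi * Int (fun x => f x ^+ 2).
Proof.
move=> df; have fi := dec_itg df; have [C C0 fC] := dec_bnd df; have mf := itg_msb fi.
have fi2 := dec_sq_itg df.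
apply: (@fatou_bound R (fun n u => expabs (eps n) u * fsq f u)).
- by move=> n; exact: itg_expabs_fsq.
- exact: msb_fsq.
- by move=> n x; rewrite mulr_ge0 ?expR_ge0 ?fsq_ge0.
- move=> u; rewrite -[X in _ --> X]mul1r; apply: cvgM; [exact: expabs_cvg|exact: cvg_cst].
move=> n; rewrite abel_form// -mulrA ler_wpM2l// -Int_w1 -IntZr; last exact: w1_itg.
apply: le_trans (ler_norm _) _.
have shift s : itg (fun x => f (1 * x + eps n * s) ^+ 2) /\
    Int (fun x => f (1 * x + eps n * s) ^+ 2) = Int (fun x => f x ^+ 2).
  by have [i1 e1] := Int_affine (eps n * s) ltr01 fi2; split => //; rewrite e1 invr1 mul1r.
have im s : itg (fun x => f x * f (eps n * s + x)).
  apply: (itgM fi (C := C)) => //; apply: (msb_comp mf).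
  by apply: msbD; [exact: msb_cst|exact: msb_id].
apply: abs_Int_le.
- apply: (itg_msb (f := fun s => _)).
  have := @itg_Fubini1 R (fun z => w1 z.1 * (f z.2 * f (eps n * z.1 + z.2)))
    (fun s => C * w1 s) (fun x => `|f x|).
  have -> : (fun s => w1 s * Int (fun x => f x * f (eps n * s + x))) =
      (fun s => Int (fun x => w1 s * (f x * f (eps n * s + x)))).
    by apply/funext => s; rewrite IntZ.
  rewrite /=.
  apply; [|exact/itgZ/w1_itg|exact: itg_abs|].
    apply: measurable_funM; first by apply: (msb2_comp (@w1_msb R)); exact: measurable_fst.
    apply: measurable_funM; first by apply: (msb2_comp mf); exact: measurable_snd.
    apply: (msb2_comp mf); apply: measurable_funD; last exact: measurable_snd.
    by apply: measurable_funM; [exact: measurable_cst|exact: measurable_fst].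
  move=> s x; rewrite 2!normrM (ger0_norm (w1_ge0 _)).
  by rewrite (_ : C * w1 s * _ = w1 s * (`|f x| * C)) ?ler_wpM2l ?w1_ge0//; ring.
- by under eq_fun do rewrite mulrC; apply: itgZ; exact: w1_itg.
- move=> s; rewrite normrM (ger0_norm (w1_ge0 _)) ler_wpM2l ?w1_ge0//.
  have [i1 e1] := shift s.
  (* Translation invariance and 2 |a b| <= a^2 + b^2 bound each correlation by the squared norm. *)
  apply: (@le_trans _ _ (Int (fun x => 2^-1 * (f x ^+ 2 + f (1 * x + eps n * s) ^+ 2)))); last first.
    by rewrite IntZ ?IntD// ?e1; [lra|exact: itgD].
  apply: abs_Int_le; [exact: itg_msb (im s)|by apply: itgZ; exact: itgD|].
  move=> x; rewrite mul1r (addrC x); set a := f x; set b := f _.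
  rewrite ler_norml; apply/andP; split.
    by have := sqr_ge0 (a + b); rewrite sqrrD; lra.
  by have := sqr_ge0 (a - b); rewrite sqrrB; lra.
Qed.

(** The converse of [Bessel]. Continuity enters through the pointwise limit of the Poisson averages
    of f ([approx_id]). *)
Lemma Plancherel_ge f : dec f -> continuous f -> 2 * pi * Int (fun x => f x ^+ 2) <= Int (fsq f).
Proof.
move=> df cf; have fi := dec_itg df; have [C C0 fC] := dec_bnd df; have mf := itg_msb fi.
have fi2 := dec_sq_itg df; have [isq _] := Bessel df.
have h : Int (fun u => expabs (eps n) u * fsq f u) @[n --> \oo] --> 2 * pi * Int (fun x => f x ^+ 2).
  under eq_cvg do rewrite abel_form1//.
  rewrite -IntZ//.
  apply: (dct (g := fun x => (2 * (C * pi)) * `|f x|) _ _ _ _ _).2.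
  - by move=> n; apply: itg_msb; apply: itgZ; exact: shift_Int_itg.
  - by apply: msbM; [exact: msb_cst|exact: msbX].
  - by apply: itgZ; exact: itg_abs.
  - move=> n x; rewrite IntZ; last exact: (shift_itg _ _ mf fC).
    rewrite 2!normrM (_ : 2 * (C * pi) * `|f x| = `|2| * (`|f x| * (C * pi))); last first.
      by rewrite normr_nat; ring.
    do 2 rewrite ler_wpM2l//.
    rewrite -Int_w1 -IntZ; last exact: w1_itg.
    apply: abs_Int_le; [exact: itg_msb (shift_itg _ _ mf fC)|by apply: itgZ; exact: w1_itg|].
    by move=> s; rewrite normrM (ger0_norm (w1_ge0 _)) mulrC ler_wpM2r ?w1_ge0.
  - move=> x; rewrite (_ : 2 * pi * _ = f x * (2 * pi * f x)); last by ring.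
    rewrite (_ : (fun n => _) = (fun n => f x * (2 * Int (fun s => w1 s * f (eps n * s + x))))).
      by apply: cvgM; [exact: cvg_cst|exact: (approx_id mf fC (cf x))].
    by apply/funext => n; rewrite IntZ; [ring|exact: (shift_itg _ _ mf fC)].
rewrite -(cvg_lim _ h)//; apply: limr_le; first by apply/cvg_ex; eexists; exact: h.
apply: nearW => n; apply: le_Int => //; first exact: itg_expabs_fsq.
by move=> u; rewrite ler_piMl ?fsq_ge0.
Qed.

(** Abel summation: the regularised integral tends to the left-hand side by domination and, being a
    Poisson average of w, also to 2 pi w t. *)
Lemma Fourier_inversion w t : dec w -> continuous w -> itg (fcos w) -> itg (fsin w) ->
  Int (fun u => cos (u * t) * fcos w u + sin (u * t) * fsin w u) = 2 * pi * w t.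
Proof.
move=> dw cw ic isn; have iw := dec_itg dw; have [C C0 wC] := dec_bnd dw; have mw := itg_msb iw.
pose G u := cos (u * t) * fcos w u + sin (u * t) * fsin w u.
have iG : itg G.
  apply: itgD; under eq_fun do rewrite mulrC.
    apply: (itgM ic (C := 1)) => [|x]; last exact: cos_max.
    by under eq_fun do rewrite mulrC; exact: msb_cosM.
  apply: (itgM isn (C := 1)) => [|x]; last exact: sin_max.
  by under eq_fun do rewrite mulrC; exact: msb_sinM.
have h1 : Int (fun u => expabs (eps n) u * G u) @[n --> \oo] --> Int G.
  apply: (dct (g := fun u => `|G u|) _ _ _ _ _).2.
  - by move=> n; apply: msbM; [exact: expabs_msb|exact: itg_msb].
  - exact: itg_msb.
  - exact: itg_abs.
  - by move=> n u; rewrite normrM ler_piMl// ger0_norm ?expR_ge0.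
  - by move=> u; rewrite -[X in _ --> X]mul1r; apply: cvgM; [exact: expabs_cvg|exact: cvg_cst].
have h2 : Int (fun u => expabs (eps n) u * G u) @[n --> \oo] --> 2 * pi * w t.
  rewrite (_ : (fun n => _) = (fun n => 2 * Int (fun s => w1 s * w (eps n * s + t)))).
    exact: (approx_id mw wC (cw t)).
  apply/funext => n; have [_ <-] := poisson_subst t (eps_gt0 n) mw wC.
  by rewrite conv_fcos//; exact: expabs_itg.
exact: (cvg_unique _ h1 h2).
Qed.

End fourier.

(** * The fundamental solution *)

Section rapid_decay.
Variable R : realType.
Implicit Types f g : R -> R.

Definition rapid f := msb f /\ forall m, exists C, forall x, `|f x| <= C * w1 x ^+ m.

Lemma rapid_dec f : rapid f -> dec f.
Proof. by move=> [mf h]; split => //; exact: h. Qed.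

Lemma w1V (x : R) : (w1 x)^-1 = 1 + x ^+ 2.
Proof. by rewrite /w1 invrK. Qed.

Lemma w1_abs (x : R) : `|x| * w1 x <= 1.
Proof.
rewrite -ler_pdivlMr ?w1_gt0// w1V mul1r ler_norml; apply/andP; split.
  by have := sqr_ge0 (x + 1); have := sqr_ge0 x; rewrite sqrrD; lra.
by have := sqr_ge0 (x - 1); have := sqr_ge0 x; rewrite sqrrB; lra.
Qed.

Lemma rapid_poly f (q : {poly R}) : rapid f -> rapid (fun x => q.[x] * f x).
Proof.
move=> [mf fC]; split.
  by apply: msbM => //; apply: msb_cont; exact: continuous_horner.
have [k [D D0 qD]] : exists k, exists2 D, 0 <= D & forall x : R, `|q.[x]| * w1 x ^+ k <= D.
  elim/poly_ind: q => [|q c [k [D D0 qD]]].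
    by exists 0%N; exists 0 => // x; rewrite horner0 normr0 mul0r.
  exists k.+1; exists (D + `|c|); first by rewrite addr_ge0.
  move=> x; rewrite hornerMXaddC (le_trans (ler_wpM2r _ (ler_normD _ _)))//.
    by rewrite exprn_ge0// w1_ge0.
  rewrite mulrDl lerD// ?normrM; last first.
    by rewrite ler_piMr// exprn_ile1// ?w1_ge0 ?w1_le1.
  rewrite exprSr mulrACA -[leRHS]mulr1 ler_pM//.
  - by rewrite mulr_ge0// exprn_ge0// w1_ge0.
  - by rewrite mulr_ge0// w1_ge0.
  - exact: w1_abs.
move=> m; have [C h] := fC (m + k)%N; exists (D * C) => x.
have wk : 0 < w1 x ^+ k by rewrite exprn_gt0// w1_gt0.
rewrite normrM; apply: le_trans (ler_wpM2l (normr_ge0 _) (h x)) _.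
rewrite exprD (_ : _ * _ = (`|q.[x]| * w1 x ^+ k) * (C * w1 x ^+ m)); last by ring.
rewrite -[leRHS]mulrA ler_wpM2r// -(pmulr_lge0 _ wk) -mulrA -exprD.
exact: le_trans (h x).
Qed.

Lemma pow_bound (y : R) m : 0 <= y -> (1 + y) ^+ m <= 2 ^+ m * (1 + y ^+ m).
Proof.
move=> y0; have [y1|y1] := leP y 1.
  apply: (@le_trans _ _ (2 ^+ m)).
    by rewrite lerXn2r ?nnegrE// ?addr_ge0//; lra.
  by rewrite ler_peMr ?exprn_ge0// lerDl exprn_ge0.
apply: (@le_trans _ _ ((2 * y) ^+ m)).
  by rewrite lerXn2r ?nnegrE// ?addr_ge0// ?mulr_ge0//; lra.
by rewrite exprMn ler_wpM2l ?exprn_ge0// lerDr.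
Qed.

Lemma rapidP f : msb f -> (forall k, exists C, forall x, `|x| ^+ k * `|f x| <= C) -> rapid f.
Proof.
move=> mf fC; split => // m; have [C hC] := fC (m.*2)%N; have [C0 hC0] := fC 0%N.
exists (2 ^+ m * (C0 + C)) => x.
have wm : 0 < w1 x ^+ m by rewrite exprn_gt0// w1_gt0.
rewrite -ler_pdivrMr// -exprVn w1V.
have x2 : 0 <= x ^+ 2 by exact: sqr_ge0.
apply: le_trans (ler_wpM2l (normr_ge0 _) (pow_bound m x2)) _.
rewrite mulrCA ler_wpM2l ?exprn_ge0// mulrDr mulr1 lerD//.
  by have := hC0 x; rewrite expr0 mul1r.
by have := hC x; rewrite -mul2n exprM real_normK ?num_real// mulrC.
Qed.

End rapid_decay.

Section fourier_calculus.
Variable R : realType.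
Implicit Types f g F : R -> R.

Lemma dec_cvg0 F : dec F -> (fun n : nat => F n%:R) @ \oo --> (0 : R) /\
  (fun n : nat => F (- n%:R)) @ \oo --> (0 : R).
Proof.
move=> [mF [C FC]]; have C0 := decC_ge0 FC.
have h (v : nat -> R) : (forall n, `|v n| = n%:R) -> (fun n => F (v n)) @ \oo --> (0 : R).
  move=> vn; apply/cvgr0Pnorm_lt => e e0; near=> n.
  apply: le_lt_trans (FC _) _; apply: (@le_lt_trans _ _ (C * w1 (v n))).
    by rewrite ler_wpM2l// expr2 ler_piMr ?w1_ge0 ?w1_le1.
  have wn := w1_gt0 (v n).
  rewrite -ltr_pdivlMr// -ltr_pdivrMl// mulrC w1V -(@real_normK _ (v n)) ?num_real// vn.
  apply: (@lt_le_trans _ _ (n%:R)).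
    by near: n; exact: nbhs_infty_gtr.
  have : 0 <= (n%:R - 1 / 2 : R) ^+ 2 by exact: sqr_ge0.
  by rewrite sqrrB; lra.
split; apply: h => n; first exact: normr_nat.
by rewrite normrN normr_nat.
Unshelve. all: by end_near. Qed.

(** Newton-Leibniz on the whole line for cos (xi x) f and sin (xi x) f, which vanish at infinity. *)
Lemma fcos_der f g xi : dec f -> dec g -> continuous g -> (forall x : R, is_derive x (1 : R) f (g x)) ->
  fcos g xi = xi * fsin f xi /\ fsin g xi = - (xi * fcos f xi).
Proof.
move=> df dg cg fg.
have cf : continuous f.
  by move=> x; apply: differentiable_continuous; apply/derivable1_diffP.
have csin x : {for x, continuous (fun u : R => sin (xi * u))}.
  by apply: continuous_comp; [exact: mulrl_continuous|exact: continuous_sin].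
have ccos x : {for x, continuous (fun u : R => cos (xi * u))}.
  by apply: continuous_comp; [exact: mulrl_continuous|exact: continuous_cos].
have [fi gi] := (dec_itg df, dec_itg dg).
have bsin F : dec F -> dec (fun x => sin (xi * x) * F x).
  by move=> dF; apply: (@decM _ F _ 1) => //; [exact: msb_sinM|move=> x; exact: sin_max].
have bcos F : dec F -> dec (fun x => cos (xi * x) * F x).
  by move=> dF; apply: (@decM _ F _ 1) => //; [exact: msb_cosM|move=> x; exact: cos_max].
split.
  have := @ftc_line R (fun x => g x * cos (xi * x) - xi * (f x * sin (xi * x)))
    (fun x => cos (xi * x) * f x) 0 0.
  have i1 := itg_cos xi gi; have i2 := itgZ xi (itg_sin xi fi).
  rewrite IntB// IntZ; last exact: itg_sin.
  move=> h; apply/eqP; rewrite -subr_eq0 -[X in _ == X](subrr 0); apply/eqP; apply: h.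
  - move=> x; apply: cvgB; first by apply: cvgM; [exact: cg|exact: ccos].
    by apply: cvgM; [exact: cvg_cst|apply: cvgM; [exact: cf|exact: csin]].
  - by move=> x; apply: is_derive_eq; rewrite /GRing.scale /=; ring.
  - exact: itgB.
  - by have [] := dec_cvg0 (bcos _ df).
  - by have [] := dec_cvg0 (bcos _ df).
have := @ftc_line R (fun x => g x * sin (xi * x) + xi * (f x * cos (xi * x)))
  (fun x => sin (xi * x) * f x) 0 0.
have i1 := itg_sin xi gi; have i2 := itgZ xi (itg_cos xi fi).
rewrite IntD// IntZ; last exact: itg_cos.
move=> h; apply/eqP; rewrite -addr_eq0 -[X in _ == X](subrr 0); apply/eqP; apply: h.
- move=> x; apply: cvgD; first by apply: cvgM; [exact: cg|exact: csin].
  by apply: cvgM; [exact: cvg_cst|apply: cvgM; [exact: cf|exact: ccos]].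
- by move=> x; apply: is_derive_eq; rewrite /GRing.scale /=; ring.
- exact: itgD.
- by have [] := dec_cvg0 (bsin _ df).
- by have [] := dec_cvg0 (bsin _ df).
Qed.

End fourier_calculus.

(** * Decay, moments and scaling of the kernel *)

Section kernel.
Variables (R : realType) (N : nat).
Hypothesis N_even : ~~ odd N.
Hypothesis N_gt0 : (0 < N)%N.
Implicit Types (q : {poly R}) (s : R).

(** A class closed under differentiation, through [Dpexp] on the polynomial; it contains the symbol
    exp (- s u^N) and all its derivatives. *)
Definition pexp q s (u : R) := q.[u] * expR (- (s * u ^+ N)).

Lemma even_pow_ge (u : R) : u ^+ 2 - 1 <= u ^+ N.
Proof.
have -> : u ^+ N = (u ^+ 2) ^+ N./2.
  by rewrite -exprM mul2n even_halfK.
have h0 : 0 <= u ^+ 2 by exact: sqr_ge0.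
have [u1|u1] := leP (u ^+ 2) 1.
  by apply: (@le_trans _ _ 0); [lra|exact: exprn_ge0].
apply: (@le_trans _ _ (u ^+ 2)); first lra.
rewrite ler_eXnr ?ltW// half_gt0.
by case: N N_even N_gt0 => [|[|]].
Qed.

Lemma even_pow_ge0 (u : R) : 0 <= u ^+ N.
Proof. by rewrite exprn_even_ge0. Qed.

Lemma pexp_cont q s : continuous (pexp q s).
Proof.
move=> x; apply: cvgM; first exact: continuous_horner.
apply: (@continuous_comp _ _ _ (fun u : R => - (s * u ^+ N)) expR); last exact: continuous_expR.
by apply: cvgN; apply: cvgM; [exact: cvg_cst|exact: exprn_continuous].
Qed.

Lemma pexp_rapid q s : 0 < s -> rapid (pexp q s).
Proof.
move=> s0; apply: rapid_poly; split.
  by have := msb_cont (@pexp_cont 1 s); rewrite /pexp; under eq_fun do rewrite hornerC mul1r.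
move=> m; exists (expR (2 * s) * (m`!%:R / s ^+ m)) => x.
have x20 : 0 <= 1 + x ^+ 2 by rewrite addr_ge0// sqr_ge0.
have sm : 0 < s ^+ m by rewrite exprn_gt0.
rewrite ger0_norm ?expR_ge0// -ler_pdivrMr ?exprn_gt0 ?w1_gt0// -exprVn w1V.
(* From x^N >= x^2 - 1 one gets exp (- s x^N) <= exp (2 s) exp (- s (1 + x^2)); then y^m exp (- y)
   <= m! is used with y = s (1 + x^2). *)
apply: (@le_trans _ _ (expR (2 * s) * (expR (- (s * (1 + x ^+ 2))) * (1 + x ^+ 2) ^+ m))).
  rewrite mulrA -expRD ler_wpM2r ?exprn_ge0// ler_expR.
  have := ler_wpM2l (ltW s0) (even_pow_ge x); lra.
rewrite ler_wpM2l ?expR_ge0// ler_pdivlMr// expRN -mulrA -exprMn [leLHS]mulrC.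
rewrite ler_pdivrMr ?expR_gt0// [s * _]mulrC.
case: m {sm} => [|m].
  by rewrite expr0 fact0 mul1r; apply: le_trans (expR_ge1Dx _); rewrite lerDl mulr_ge0// ltW.
have mf : (0 : R) < m.+1`!%:R by rewrite ltr0n fact_gt0.
have := @expR_ge1Dxn R ((1 + x ^+ 2) * s) m (mulr_ge0 x20 (ltW s0)).
by move=> h; rewrite [leRHS]mulrC -ler_pdivrMr//; apply: le_trans h; rewrite lerDr.
Qed.

Definition Dpexp s q := q^`() - (s * N%:R)%:P * 'X^(N.-1) * q.

Lemma pexp_der q s (u : R) : is_derive u (1 : R) (pexp q s) (pexp (Dpexp s q) s u).
Proof.
have d2 : is_derive u (1 : R) (fun u : R => expR (- (s * u ^+ N)))
    (expR (- (s * u ^+ N)) * - (s * (N%:R * u ^+ N.-1))).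
  have -> : (fun u : R => expR (- (s * u ^+ N))) = expR \o horner (- (s%:P * 'X^N)).
    by apply/funext => v; rewrite /= !hornerE.
  apply: (is_derive_eq (is_derive1_comp (is_derive_expR _) (is_derive_poly _ u))).
  by rewrite derivN derivM derivC mul0r add0r derivXn -mulr_natl !hornerE /= hornerMn hornerC; ring.
apply: (is_derive_eq (is_deriveM (is_derive_poly q u) d2)).
by rewrite /GRing.scale /= /pexp /Dpexp !hornerE /=; ring.
Qed.

(** Each factor xi is traded for one derivative of the integrand, which stays in the class. *)
Lemma fcos_pexp_bnd q s k : 0 < s ->
  exists C, forall xi, `|xi| ^+ k * `|fcos (pexp q s) xi| <= C /\ `|xi| ^+ k * `|fsin (pexp q s) xi| <= C.
Proof.
move=> s0; elim: k q => [|k IH] q.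
  have iq := dec_itg (rapid_dec (pexp_rapid q s0)).
  by exists (Int (fun u => `|pexp q s u|)) => xi; rewrite !mul1r; split; [exact: fcos_le|exact: fsin_le].
have [C hC] := IH (Dpexp s q); exists C => xi.
have [h1 h2] := hC xi.
have [e1 e2] := fcos_der xi (rapid_dec (pexp_rapid q s0)) (rapid_dec (pexp_rapid (Dpexp s q) s0))
  (@pexp_cont _ _) (pexp_der q s).
move: h1 h2; rewrite e1 e2 normrN !normrM !exprSr !mulrA; by split.
Qed.

Lemma fcos_pexp_rapid q s : 0 < s -> rapid (fcos (pexp q s)).
Proof.
move=> s0; apply: rapidP; first by apply: msb_fcos; exact/dec_itg/rapid_dec/pexp_rapid.
by move=> k; have [C h] := fcos_pexp_bnd q k s0; exists C => x; have [] := h x.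
Qed.

Lemma fsin_pexp_rapid q s : 0 < s -> rapid (fsin (pexp q s)).
Proof.
move=> s0; apply: rapidP; first by apply: msb_fsin; exact/dec_itg/rapid_dec/pexp_rapid.
by move=> k; have [C h] := fcos_pexp_bnd q k s0; exists C => x; have [] := h x.
Qed.

Definition npi : R := (2 * pi)^-1.

(* [ker s xi] is p(s; xi). *)
Definition ker s := fcos (pexp npi%:P s).

Lemma npi_gt0 : 0 < npi.
Proof. by rewrite invr_gt0 mulr_gt0// pi_gt0. Qed.

Lemma ker_rapid s : 0 < s -> rapid (ker s).
Proof. exact: fcos_pexp_rapid. Qed.

Lemma fcos_even (f : R -> R) xi : fcos f (- xi) = fcos f xi.
Proof. by apply: eq_Int => x; rewrite mulNr cosN. Qed.

Lemma ker_even s xi : ker s (- xi) = ker s xi.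
Proof. exact: fcos_even. Qed.

Lemma Int_odd (f : R -> R) : itg f -> (forall x, f (- x) = - f x) -> Int f = 0.
Proof.
move=> fi fo; have [i1 e1] := Int_opp fi; move: e1.
rewrite (_ : (fun x => f (- x)) = (fun x => - f x)); last exact/funext.
by rewrite IntN//; lra.
Qed.

Lemma fsin_even (f : R -> R) xi : itg f -> (forall x, f (- x) = f x) -> fsin f xi = 0.
Proof.
by move=> fi fe; apply: Int_odd; [exact: itg_sin|move=> x; rewrite fe mulrN sinN mulrN].
Qed.

(** [ker s] is itself the transform of an even function, so that transforming it again returns this
    function up to the factor 2 pi, which [npi] cancels. *)
Lemma ker_fourier s t : 0 < s -> fcos (ker s) t = expR (- (s * t ^+ N)).
Proof.
move=> s0; have rw := pexp_rapid npi%:P s0; have dw := rapid_dec rw.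
have := Fourier_inversion t dw (@pexp_cont _ _) (dec_itg (rapid_dec (fcos_pexp_rapid _ s0)))
  (dec_itg (rapid_dec (fsin_pexp_rapid _ s0))).
rewrite /pexp hornerC mulrA divff ?mul1r; last by rewrite gt_eqF// mulr_gt0// pi_gt0.
move=> <-; apply: eq_Int => u.
have -> : fsin (fun u0 => npi%:P.[u0] * expR (- (s * u0 ^+ N))) u = 0.
  apply: fsin_even; first exact: (dec_itg dw).
  by move=> x; rewrite !hornerC exprNn -signr_odd (negbTE N_even) mul1r.
by rewrite mulr0 addr0 /ker mulrC (mulrC t).
Qed.

Lemma ker_fsin s t : 0 < s -> fsin (ker s) t = 0.
Proof.
by move=> s0; apply: fsin_even; [exact/dec_itg/rapid_dec/ker_rapid|exact: ker_even].
Qed.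


(** Times exp (- s u^N), this is the j-th derivative of the symbol divided by 2 pi; its value at 0
    gives the j-th moment of the kernel up to sign and 2 pi. *)
Let mom_poly s j := iter j (Dpexp s) (npi%:P : {poly R}).

(** The zero u^(N - 1) of the first derivative loses one order at each further derivative, so the
    value at 0 vanishes for 0 < j < N and is - npi s N! for j = N. *)
Let mom_poly_shape s j : (0 < j <= N)%N -> exists2 e : {poly R},
  mom_poly s j = 'X^(N - j) * e & e.[0] = - (npi * s * (N ^_ j)%:R).
Proof.
elim: j => [//|[_ _|j IH /andP[_ jN]]].
  exists (- (npi * s * N%:R)%:P); last by rewrite hornerN hornerC ffactn1.
  rewrite /mom_poly /= /Dpexp derivC sub0r subn1 !polyCM; ring.
have [|e E e0] := IH; first by rewrite (ltnW jN).
set m := (N - j.+1)%N.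
have mE : m = (N - j.+2).+1 by rewrite /m subnSK.
exists (m%:R%:P * e + 'X * e^`() - (s * N%:R)%:P * 'X^N * e).
  rewrite /mom_poly iterS -/(mom_poly s j.+1) E /Dpexp -/m mE derivM derivXn /=.
  have -> : 'X^N = 'X^(N.-1) * 'X :> {poly R} by rewrite -exprSr prednK.
  rewrite -mulr_natl polyC_natr !exprS; ring.
rewrite !hornerE /= expr0n (gtn_eqF N_gt0) !(mulr0, mul0r, subr0, addr0) e0.
by rewrite [(N ^_ j.+2)%N]ffactnSr natrM -/m; ring.
Qed.

Let ker_mom_even s m xi : 0 < s -> fcos (pexp (mom_poly s m.*2) s) xi = (-1) ^+ m * (xi ^+ m.*2 * ker s xi).
Proof.
move=> s0; have dp q := rapid_dec (pexp_rapid q s0).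
elim: m => [|m IH]; first by rewrite !mul1r.
rewrite doubleS /mom_poly 2!iterS -/(mom_poly s m.*2).
have [-> _] := fcos_der xi (dp _) (dp _) (@pexp_cont _ _) (pexp_der (Dpexp s (mom_poly s m.*2)) s).
have [_ ->] := fcos_der xi (dp _) (dp _) (@pexp_cont _ _) (pexp_der (mom_poly s m.*2) s).
by rewrite IH !exprS; ring.
Qed.

Lemma ker_pow_itg s i : 0 < s -> itg (fun xi => xi ^+ i * ker s xi).
Proof.
move=> s0; have := dec_itg (rapid_dec (rapid_poly 'X^i (ker_rapid s0))).
by under eq_fun do rewrite hornerXn.
Qed.

(** The symbol is 1 - s u^N + ... near 0, so nothing survives between the orders 0 and N: to leading
    order [P s] acts on smooth functions as 1 + kappa s d^N/dx^N. Odd orders go by parity, even ones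
    by [mom_poly]. *)
Lemma ker_moment s i : 0 < s -> (i <= N)%N -> Int (fun xi => xi ^+ i * ker s xi) =
  if i == 0%N then 1 else if i == N then - (-1) ^+ N./2 * s * N`!%:R else 0.
Proof.
move=> s0 iN; have ii := ker_pow_itg i s0.
have [io|ie] := boolP (odd i).
  rewrite (Int_odd ii); last first.
    by move=> x; rewrite ker_even exprNn -signr_odd io; ring.
  case: eqP io => [->//|_ io]; case: eqP io => [-> No|//].
  by move: N_even; rewrite No.
have iE : i = (i./2).*2 by rewrite even_halfK.
(* Fourier inversion at the point 0. *)
have inv0 q : Int (fcos (pexp q s)) = 2 * pi * q.[0].
  have rq := pexp_rapid q s0.
  have := Fourier_inversion 0 (rapid_dec rq) (@pexp_cont _ _)
    (dec_itg (rapid_dec (fcos_pexp_rapid _ s0))) (dec_itg (rapid_dec (fsin_pexp_rapid _ s0))).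
  rewrite {3}/pexp expr0n (gtn_eqF N_gt0) mulr0 oppr0 expR0 mulr1 => <-.
  by apply: eq_Int => u; rewrite mulr0 cos0 sin0 mul1r mul0r addr0.
have pi0 : (pi : R) != 0 by rewrite gt_eqF// pi_gt0.
have -> : Int (fun xi => xi ^+ i * ker s xi) = (-1) ^+ i./2 * (2 * pi * (mom_poly s i).[0]).
  rewrite -inv0 -IntZ; last exact: dec_itg (rapid_dec (fcos_pexp_rapid _ s0)).
  apply: eq_Int => xi; rewrite [in RHS]iE ker_mom_even// -iE mulrA -exprMn mulrNN mulr1 expr1n.
  by rewrite mul1r.
have [i0|i0] := eqVneq i 0%N.
  by rewrite i0 /mom_poly /= hornerC expr0 mul1r divff// mulf_neq0.
have [|e -> e0] := @mom_poly_shape s i; first by rewrite lt0n i0.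
rewrite hornerM hornerXn e0; case: eqVneq => [->|iN'].
  have np : 2 * pi * npi = 1 by rewrite divff// mulf_neq0.
  rewrite subnn expr0 ffactnn.
  rewrite (_ : _ * _ = - (-1) ^+ N./2 * s * N`!%:R * (2 * pi * npi)); last by ring.
  by rewrite np mulr1.
by rewrite expr0n subn_eq0 leqNgt ltn_neqAle iN' iN /= mul0r !mulr0.
Qed.

Lemma ker_scale r xi : 0 < r -> ker (r ^+ N) xi = r^-1 * ker 1 (r^-1 * xi).
Proof.
move=> r0; have dw := rapid_dec (pexp_rapid npi%:P ltr01).
have [i1 e1] := Int_affine 0 r0 (itg_cos (r^-1 * xi) (dec_itg dw)).
rewrite {2}/ker /fcos -e1; apply: eq_Int => u; rewrite addr0 /pexp !hornerC.
rewrite mul1r exprMn; congr (_ * cos _).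
by rewrite mulrACA mulVf ?gt_eqF// mul1r mulrC.
Qed.

Lemma ker_abs_itg k s : 0 < s -> itg (fun xi => `|xi| ^+ k * (1 + xi ^+ 2) ^+ 2 * `|ker s xi|).
Proof.
move=> s0; have := dec_itg (rapid_dec (rapid_poly ('X^k * (1 + 'X^2) ^+ 2) (ker_rapid s0))).
move=> /itg_abs; congr itg; apply/funext => x.
have -> : ('X^k * (1 + 'X^2) ^+ 2).[x] = x ^+ k * (1 + x ^+ 2) ^+ 2.
  by rewrite hornerM horner_exp !hornerE.
by rewrite !normrM !normrX (ger0_norm (_ : 0 <= 1 + x ^+ 2))// addr_ge0// sqr_ge0.
Qed.

Lemma ker_abs_moment k : exists2 C, 0 <= C & forall r, 0 < r <= 1 ->
  Int (fun xi => `|xi| ^+ k * (1 + xi ^+ 2) ^+ 2 * `|ker (r ^+ N) xi|) <= C * r ^+ k.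
Proof.
pose G (xi : R) := `|xi| ^+ k * (1 + xi ^+ 2) ^+ 2 * `|ker 1 xi|.
have iG r := @ker_abs_itg k r.
exists (Int G); first (apply: Int_ge0 => x; apply: mulr_ge0 => //).
  by apply: mulr_ge0; apply: exprn_ge0 => //; rewrite addr_ge0// sqr_ge0.
move=> r /andP[r0 r1]; have ri0 : 0 < r^-1 by rewrite invr_gt0.
have [i1 e1] := Int_affine 0 ri0 (iG 1 ltr01).
have rE : r * r^-1 = 1 by rewrite divff ?gt_eqF.
apply: (@le_trans _ _ (Int (fun xi => (r ^+ k * r^-1) * G (r^-1 * xi + 0)))); last first.
  rewrite IntZ// e1 invrK -/G (_ : _ * (r * _) = (r * r^-1) * (Int G * r ^+ k)); last by ring.
  by rewrite rE mul1r.
apply: le_Int.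
- by apply: iG; rewrite exprn_gt0.
- exact: itgZ.
move=> xi; rewrite addr0 /G ker_scale// !normrM (gtr0_norm ri0) exprMn.
rewrite [leLHS](_ : _ = (r ^+ k * r^-1) * (((r^-1) ^+ k * `|xi| ^+ k) * (1 + xi ^+ 2) ^+ 2 * `|ker 1 (r^-1 * xi)|)); last first.
  have hk : r ^+ k * r^-1 ^+ k = 1 by rewrite -exprMn rE expr1n.
  by rewrite -[LHS]mulr1 -hk; ring.
apply: ler_wpM2l; first by rewrite mulr_ge0 ?exprn_ge0 ?ltW.
apply: ler_wpM2r => //; apply: ler_wpM2l; first by rewrite mulr_ge0 ?exprn_ge0// ltW.
(* As r <= 1, the factor 1 + xi^2 is at most 1 + (xi / r)^2. *)
rewrite lerXn2r ?nnegrE ?addr_ge0 ?sqr_ge0// lerD2l exprMn ler_peMl ?sqr_ge0//.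
by rewrite exprn_ege1// invf_ge1.
Qed.

End kernel.

(** * Convolution with the fundamental solution *)

Opaque fcos fsin.

Section heat_operator.
Variables (R : realType) (N : nat).
Hypothesis N_even : ~~ odd N.
Hypothesis N_gt0 : (0 < N)%N.
Implicit Types (f g d : R -> R) (s : R).

Local Notation ker := (ker N).

Definition P s f (x : R) := Int (fun y => ker s (x - y) * f y).

Lemma ker_dec s : 0 < s -> dec (ker s).
Proof. by move=> s0; apply: rapid_dec; exact: ker_rapid. Qed.

Let mBx (x : R) : msb (fun y => x - y).
Proof. by apply: msbB; [exact: msb_cst|exact: msb_id]. Qed.

Lemma P_itg_bnd s f x C : 0 < s -> msb f -> (forall y, `|f y| <= C) -> itg (fun y => ker s (x - y) * f y).
Proof.
move=> s0 mf fC; have [i1 _] := Int_affine x (ltr01 : 0 < 1 :> R) (Int_opp (dec_itg (ker_dec s0))).1.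
have [i2 _] := Int_affine (- x) (ltr01 : 0 < 1 :> R) (dec_itg (ker_dec s0)).
apply: (itgM (C := C) _ mf fC).
move: i2; congr itg; apply/funext => y.
by rewrite mul1r -(ker_even N) opprB.
Qed.

Lemma P_itg s f x : 0 < s -> dec f -> itg (fun y => ker s (x - y) * f y).
Proof. by move=> s0 df; have [C _ fC] := dec_bnd df; apply: P_itg_bnd fC => //; case: df. Qed.

(** The kernel is O(w1^3). Two factors w1 (x - y) combine with the two of f, by [w1_tri], into decay
    in x; the third is integrated in y. *)
Lemma P_dec s f : 0 < s -> dec f -> dec (P s f).
Proof.
move=> s0 df; have [mf [C fC]] := df; have [mk hk] := ker_rapid N_even N_gt0 s0.
have [K hK] := hk 3%N.
have C0 := decC_ge0 fC.
have K0 : 0 <= K.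
  have := hK 0; rewrite /w1 expr0n addr0 invr1 expr1n mulr1; exact: le_trans.
have kf x y : `|ker s (x - y) * f y| <= K * (2 * w1 x) ^+ 2 * (C * w1 (x - y)).
  rewrite normrM; apply: le_trans (ler_pM (normr_ge0 _) (normr_ge0 _) (hK _) (fC _)) _.
  have h := w1_tri x y; have h0 : 0 <= w1 (x - y) * w1 y by rewrite mulr_ge0 ?w1_ge0.
  rewrite [leLHS](_ : _ = K * C * w1 (x - y) * (w1 (x - y) * w1 y) ^+ 2); last by ring.
  rewrite [leRHS](_ : _ = K * C * w1 (x - y) * (2 * w1 x) ^+ 2); last by ring.
  apply: ler_wpM2l; first by rewrite !mulr_ge0// w1_ge0.
  by rewrite lerXn2r// nnegrE// mulr_ge0// w1_ge0.
have iw (x : R) : itg (fun y => w1 (x - y)) /\ Int (fun y => w1 (x - y)) = pi.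
  have [i1 e1] := Int_affine (- x) (ltr01 : 0 < 1 :> R) (@w1_itg R).
  have E : (fun y => w1 (x - y)) = (fun y => w1 (1 * y + - x)).
    by apply/funext => y; rewrite mul1r /w1 -sqrrN opprB.
  by rewrite E; split => //; rewrite e1 invr1 mul1r Int_w1.
split.
  apply: (itg_msb (f := P s f)).
  apply: (@itg_Fubini1 R (fun z => ker s (z.1 - z.2) * f z.2) (fun x => (2 * K * C) * w1 x) (@w1 R)).
  - apply: measurable_funM; last by apply: (msb2_comp mf); exact: measurable_snd.
    by apply: (msb2_comp mk); apply: measurable_funB.
  - by apply: itgZ; exact: w1_itg.
  - exact: w1_itg.
  - move=> x y /=; rewrite normrM.
    apply: le_trans (ler_pM (normr_ge0 _) (normr_ge0 _) (hK _) (fC _)) _.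
    rewrite [leLHS](_ : _ = K * C * (w1 (x - y) ^+ 2 * (w1 (x - y) * w1 y) * w1 y)); last by ring.
    rewrite [leRHS](_ : _ = K * C * (1 * (2 * w1 x) * w1 y)); last by ring.
    apply: ler_wpM2l; first exact: mulr_ge0.
    apply: ler_wpM2r; first exact: w1_ge0.
    apply: ler_pM; [by rewrite exprn_ge0// w1_ge0|by rewrite mulr_ge0 ?w1_ge0| |exact: w1_tri].
    by rewrite exprn_ile1// ?w1_ge0 ?w1_le1.
exists (K * C * 4 * pi) => x; have [i1 e1] := iw x.
apply: le_trans (abs_Int_le _ _ (kf x)) _.
- by apply: itg_msb; exact: P_itg.
- by apply: itgZ; exact: itgZ.
- rewrite IntZ; last exact: itgZ.
  by rewrite IntZ// e1; lra.
Qed.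

Let wt s := pexp N (npi R)%:P s.

Let wt_itg s : 0 < s -> itg (wt s).
Proof. by move=> s0; apply: dec_itg; apply: rapid_dec; exact: pexp_rapid. Qed.

Let wtE s u : wt s u = npi R * expR (- (s * u ^+ N)).
Proof. by rewrite /wt /pexp hornerC. Qed.

Let prod_bnd (a b c d A B : R) : `|a| <= A -> `|b| <= B -> `|c| <= A -> `|d| <= B ->
  `|a * b + c * d| <= A * B + A * B.
Proof.
move=> aA bB cA dB; apply: le_trans (ler_normD _ _) _; rewrite !normrM.
by apply: lerD; apply: ler_pM.
Qed.

(** The multiplier exp (- s u^N) lies in ]0, 1]; symmetry, positivity and contraction of [P] in L^2
    are read off this formula. *)
Lemma P_form s f g : 0 < s -> dec f -> dec g ->
  Int (fun x => g x * P s f x) =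
  npi R * Int (fun u => expR (- (s * u ^+ N)) * (fcos f u * fcos g u + fsin f u * fsin g u)).
Proof.
move=> s0 df dg; rewrite /P (form_fcos (wt_itg s0) (dec_itg df) (dec_itg dg)).
rewrite -IntZ; first by apply: eq_Int => u; rewrite wtE mulrA.
have [mA mB] := (msb_fcos (dec_itg df), msb_fcos (dec_itg dg)).
have [mC mD] := (msb_fsin (dec_itg df), msb_fsin (dec_itg dg)).
have := itgZ (npi R)^-1 (itgM (wt_itg s0) (msbD (msbM mA mB) (msbM mC mD))
  (C := Int (fun x => `|f x|) * Int (fun x => `|g x|) + Int (fun x => `|f x|) * Int (fun x => `|g x|)) _).
have -> : (fun x => (npi R)^-1 * (wt s x * (fcos f x * fcos g x + fsin f x * fsin g x))) =
    (fun u => expR (- (s * u ^+ N)) * (fcos f u * fcos g u + fsin f u * fsin g u)).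
  by apply/funext => u; rewrite wtE -[npi R * _ * _]mulrA mulKf// gt_eqF// npi_gt0.
apply => x; apply: prod_bnd.
- exact: fcos_le (dec_itg df).
- exact: fcos_le (dec_itg dg).
- exact: fsin_le (dec_itg df).
- exact: fsin_le (dec_itg dg).
Qed.

Lemma P_sym s f g : 0 < s -> dec f -> dec g ->
  Int (fun x => g x * P s f x) = Int (fun x => f x * P s g x).
Proof.
move=> s0 df dg; rewrite (P_form s0 df dg) (P_form s0 dg df); congr (_ * _); apply: eq_Int => u; congr (_ * _).
by rewrite mulrC [fsin f u * _]mulrC.
Qed.

Lemma PD s f g x : 0 < s -> dec f -> dec g -> P s (fun y => f y + g y) x = P s f x + P s g x.
Proof.
move=> s0 df dg; rewrite /P -IntD; [|exact: P_itg..].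
by apply: eq_Int => y; rewrite mulrDr.
Qed.

Lemma PZ s r f x : 0 < s -> dec f -> P s (fun y => r * f y) x = r * P s f x.
Proof.
move=> s0 df; rewrite /P -IntZ; last exact: P_itg.
by apply: eq_Int => y; ring.
Qed.

(** The square of the L^2 norm; [en] is the quadratic form of 1 - P. *)
Definition nrm f := Int (fun x => f x ^+ 2).
Definition en s f := nrm f - Int (fun x => f x * P s f x).

Lemma nrm_ge0 f : 0 <= nrm f.
Proof. by apply: Int_ge0 => x; exact: sqr_ge0. Qed.

Lemma dec_P_itg s f g : 0 < s -> dec f -> dec g -> itg (fun x => g x * P s f x).
Proof. by move=> s0 df dg; apply: dec_itg; apply: dec_mul => //; exact: P_dec. Qed.

Let expw_le1 s u : 0 < s -> expR (- (s * u ^+ N)) <= 1.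
Proof. by move=> s0; rewrite expR_le1 oppr_le0 mulr_ge0// ?even_pow_ge0// ltW. Qed.

Let expw_msb s : msb (fun u => expR (- (s * u ^+ N))).
Proof.
by have := msb_cont (@pexp_cont R N 1 s); rewrite /pexp; under eq_fun do rewrite hornerC mul1r.
Qed.

Let expw_fsq_itg s f : 0 < s -> dec f -> itg (fun u => expR (- (s * u ^+ N)) * fsq f u).
Proof.
move=> s0 df; under eq_fun do rewrite mulrC.
apply: (itgM (Bessel df).1 (expw_msb s) (C := 1)) => u.
by rewrite ger0_norm ?expR_ge0// expw_le1.
Qed.

Let form_fsq s f : 0 < s -> dec f ->
  Int (fun x => f x * P s f x) = npi R * Int (fun u => expR (- (s * u ^+ N)) * fsq f u).
Proof. by move=> s0 df; rewrite (P_form s0 df df). Qed.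

Lemma P_pos s f : 0 < s -> dec f -> 0 <= Int (fun x => f x * P s f x).
Proof.
move=> s0 df; rewrite (form_fsq s0 df) mulr_ge0 ?(ltW (npi_gt0 _))//; apply: Int_ge0 => u.
by rewrite mulr_ge0 ?expR_ge0 ?fsq_ge0.
Qed.

Let Bessel' f : dec f -> npi R * Int (fsq f) <= nrm f.
Proof.
move=> df; have [_ h] := Bessel df.
by rewrite /npi ler_pdivrMl// mulr_gt0// pi_gt0.
Qed.

(** The form of P is known exactly, while the norm is bounded below by [Bessel]: hence this
    direction for every f of the class. *)
Lemma en_ge s f : 0 < s -> dec f ->
  npi R * Int (fun u => (1 - expR (- (s * u ^+ N))) * fsq f u) <= en s f.
Proof.
move=> s0 df; have [i1 _] := Bessel df.
under eq_Int do rewrite mulrBl mul1r.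
rewrite IntB//; last exact: expw_fsq_itg.
by rewrite mulrBr /en (form_fsq s0 df) lerD2r Bessel'.
Qed.

(** Continuity brings in [Plancherel_ge], and with it the opposite direction. *)
Lemma en_le s f : 0 < s -> dec f -> continuous f ->
  en s f <= npi R * Int (fun u => (1 - expR (- (s * u ^+ N))) * fsq f u).
Proof.
move=> s0 df cf; have [i1 _] := Bessel df.
under eq_Int do rewrite mulrBl mul1r.
rewrite IntB//; last exact: expw_fsq_itg.
rewrite mulrBr /en (form_fsq s0 df) lerD2r /npi ler_pdivlMl ?mulr_gt0 ?pi_gt0//.
exact: Plancherel_ge.
Qed.

Lemma en_ge0 s f : 0 < s -> dec f -> 0 <= en s f.
Proof.
move=> s0 df; apply: le_trans (en_ge s0 df); rewrite mulr_ge0 ?(ltW (npi_gt0 _))//.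
by apply: Int_ge0 => u; rewrite mulr_ge0 ?fsq_ge0// subr_ge0 expw_le1.
Qed.

Let form_comb s f g a b : 0 < s -> dec f -> dec g ->
  Int (fun x => (a * f x - b * g x) * P s (fun x => a * f x - b * g x) x) =
  Int (fun x => f x * P s f x) * a ^+ 2 - 2 * Int (fun x => g x * P s f x) * a * b +
  Int (fun x => g x * P s g x) * b ^+ 2.
Proof.
move=> s0 df dg; have dh : dec (fun x => - b * g x) by exact: decZ.
have E x : P s (fun x => a * f x - b * g x) x = a * P s f x - b * P s g x.
  have -> : (fun x => a * f x - b * g x) = (fun x => a * f x + - b * g x).
    by apply/funext => y; rewrite mulNr.
  by rewrite PD ?PZ ?mulNr//; exact: decZ.
transitivity (Int (fun x => a ^+ 2 * (f x * P s f x) - (a * b) * (g x * P s f x + f x * P s g x) +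
    b ^+ 2 * (g x * P s g x))).
  by apply: eq_Int => x; rewrite E; ring.
have [i1 i2] := (dec_P_itg s0 df df, dec_P_itg s0 df dg).
have [i3 i4] := (dec_P_itg s0 dg df, dec_P_itg s0 dg dg).
rewrite IntD; [|by apply: itgB; apply: itgZ => //; exact: itgD|exact: itgZ].
rewrite IntB; [|exact: itgZ|by apply: itgZ; exact: itgD].
rewrite !IntZ//; last exact: itgD.
by rewrite IntD// (P_sym s0 dg df); ring.
Qed.

Let nrm_comb f g a b : dec f -> dec g ->
  nrm (fun x => a * f x - b * g x) = nrm f * a ^+ 2 - 2 * Int (fun x => g x * f x) * a * b + nrm g * b ^+ 2.
Proof.
move=> df dg.
transitivity (Int (fun x => a ^+ 2 * f x ^+ 2 - (2 * a * b) * (g x * f x) + b ^+ 2 * g x ^+ 2)).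
  by apply: eq_Int => x; ring.
have [i1 i2] := (dec_sq_itg df, dec_sq_itg dg); have i3 := dec_itg (dec_mul dg df).
rewrite IntD; [|by apply: itgB; exact: itgZ|exact: itgZ].
rewrite IntB; [|exact: itgZ|exact: itgZ].
by rewrite !IntZ// /nrm; ring.
Qed.

Lemma nrm_CS f g : dec f -> dec g -> Int (fun x => g x * f x) ^+ 2 <= nrm f * nrm g.
Proof.
move=> df dg; apply: discriminant => a b; rewrite -nrm_comb//; exact: nrm_ge0.
Qed.

Lemma form_CS s f g : 0 < s -> dec f -> dec g ->
  Int (fun x => g x * P s f x) ^+ 2 <= nrm f * nrm g.
Proof.
move=> s0 df dg.
apply: (@le_trans _ _ (Int (fun x => f x * P s f x) * Int (fun x => g x * P s g x))).
  apply: discriminant => a b; rewrite -form_comb//; apply: P_pos => //.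
  by apply: decB; exact: decZ.
apply: ler_pM; [exact: P_pos|exact: P_pos| |].
  by have := en_ge0 s0 df; rewrite /en; lra.
by have := en_ge0 s0 dg; rewrite /en; lra.
Qed.

Lemma en_CS s f g : 0 < s -> dec f -> dec g ->
  Int (fun x => g x * (f x - P s f x)) ^+ 2 <= en s f * en s g.
Proof.
move=> s0 df dg; apply: discriminant => a b.
have dh : dec (fun x => a * f x - b * g x) by apply: decB; exact: decZ.
have := en_ge0 s0 dh; rewrite /en nrm_comb// form_comb//.
have -> : Int (fun x => g x * (f x - P s f x)) = Int (fun x => g x * f x) - Int (fun x => g x * P s f x).
  rewrite -IntB; [by apply: eq_Int => x; rewrite mulrBr|exact: dec_itg (dec_mul dg df)|exact: dec_P_itg].
by move=> h; apply: le_trans h _; rewrite le_eqVlt; apply/orP; left; apply/eqP; ring.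
Qed.

Definition cutP s f x := if x <= 0 then P s f x else 0.

Lemma cutP_dec s f : 0 < s -> dec f -> dec (cutP s f).
Proof. by move=> s0 df; apply: dec_if; [exact: mle|exact: P_dec|exact: dec0]. Qed.

(** For g = [cutP s f] one has <g, g> = <g, P f>, and Cauchy-Schwarz for the form gives |g|^2 <= |f|
    |g|: cutting preserves the contraction. *)
Lemma cutP_nrm s f : 0 < s -> dec f -> nrm (cutP s f) <= nrm f.
Proof.
move=> s0 df; have dg := cutP_dec s0 df.
have E : nrm (cutP s f) = Int (fun x => cutP s f x * P s f x).
  by apply: eq_Int => x; rewrite /cutP; case: ifP => _; rewrite ?mul0r ?expr0n// expr2.
have := form_CS s0 df dg; rewrite -E expr2.
have := nrm_ge0 (cutP s f); rewrite le_eqVlt => /predU1P[<- _|h]; first exact: nrm_ge0.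
by rewrite ler_pM2r.
Qed.

(** The constant depends on s, unlike that of [P_sup]: this serves at a fixed time step, to bound
    all the [cseq] at once. *)
Lemma P_bnd s : 0 < s -> exists2 C, 0 <= C & forall f x, dec f -> (P s f x) ^+ 2 <= C * nrm f.
Proof.
move=> s0; exists (nrm (ker s)); first exact: nrm_ge0.
move=> f x df; have i2 := dec_sq_itg (ker_dec s0).
have [i1 e1] := Int_affine (- x) (ltr01 : 0 < 1 :> R) i2.
have E : (fun y => ker s (1 * y - x) ^+ 2) = (fun y => ker s (x - y) ^+ 2).
  by apply/funext => y; rewrite mul1r -(ker_even N) opprB.
move: i1 e1; rewrite E invr1 mul1r => i1 e1.
rewrite -[nrm (ker s)]e1; apply: CS_Int => //; [exact: dec_sq_itg|exact: P_itg].
Qed.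

(* The Sobolev-type bound: the weight [1 + u^N] needed for the Cauchy-Schwarz
   inequality is paid by the energy, as [y e^(-y) <= 1 - e^(-y)]. *)
Lemma P_sup : exists2 C, 0 <= C & forall s f x, 0 < s -> dec f ->
  (P s f x) ^+ 2 <= C * (nrm f + s^-1 * en s f).
Proof.
(* A^2 is comparable to 1 + u^N, the weight that norm and energy carry together, and 1 / A^2 is
   integrable because N >= 2. *)
pose A (u : R) := 1 + `|u| ^+ N./2.
have A0 u : 0 < A u by rewrite ltr_pwDl// exprn_ge0.
have cA : continuous A.
  move=> u; apply: cvgD; first exact: cvg_cst.
  exact: (continuous_comp (@norm_continuous _ _ u) (@exprn_continuous _ _ _)).
have mA : msb A by exact: msb_cont.
have mAV : msb (fun u => (A u)^-1).
  by apply: msb_cont => u; apply: cvgV; [rewrite gt_eqF|exact: cA].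
have NE : N = (N./2).*2 by rewrite even_halfK.
have aN (u : R) : (`|u| ^+ N./2) ^+ 2 = u ^+ N.
  by rewrite -exprM muln2 -NE -normrX ger0_norm// even_pow_ge0.
have A2 u : A u ^+ 2 <= 2 * (1 + u ^+ N).
  rewrite -aN /A; have := sqr_ge0 (1 - `|u| ^+ N./2); rewrite sqrrB sqrrD; lra.
have iA : itg (fun u => (A u)^-1 ^+ 2) /\ Int (fun u => (A u)^-1 ^+ 2) <= 2 * pi.
  have h u : (A u)^-1 ^+ 2 <= 2 * w1 u.
    rewrite exprVn -[leRHS]invrK lef_pV2 ?posrE ?exprn_gt0 ?invr_gt0 ?mulr_gt0 ?w1_gt0//.
    rewrite invfM w1V; have := even_pow_ge N_even N_gt0 u; have := even_pow_ge0 N_even u.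
    have : 1 + u ^+ N <= A u ^+ 2.
      rewrite -aN /A sqrrD expr1n lerD2r lerDl mulrn_wge0// mul1r exprn_ge0//.
    lra.
  have i1 : itg (fun u => (A u)^-1 ^+ 2).
    apply: (itg_le _ (itgZ 2 (@w1_itg R))) => [|u]; last by rewrite ger0_norm ?sqr_ge0.
    exact: msbX.
  split => //; rewrite -Int_w1 -IntZ; last exact: w1_itg.
  by apply: le_Int => //; apply: itgZ; exact: w1_itg.
have np0 := npi_gt0 R.
pose e s (u : R) := expR (- (s * u ^+ N)).
(* G will be [fcos f] or [fsin f], and t the cosine or sine that goes with it in [conv_fcos]. *)
have half (G t : R -> R) s f : 0 < s -> dec f -> msb G -> msb t -> (forall u, `|t u| <= 1) ->
    (forall u, G u ^+ 2 <= fsq f u) -> itg (fun u => wt s u * (t u * G u)) ->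
    Int (fun u => wt s u * (t u * G u)) ^+ 2 <= 2 * (nrm f + s^-1 * en s f).
  move=> s0 df mG mt t1 Gf iI; have [ifs Bf] := Bessel df.
  have sV : 0 < s^-1 by rewrite invr_gt0.
  have i1e : itg (fun u => (1 - e s u) * fsq f u).
    under eq_fun do rewrite mulrBl mul1r.
    by apply: itgB => //; exact: expw_fsq_itg.
  pose B u := 2 * (fsq f u + s^-1 * ((1 - e s u) * fsq f u)).
  have iB : itg B by apply: itgZ; apply: itgD => //; exact: itgZ.
  have IB : Int B <= 4 * pi * (nrm f + s^-1 * en s f).
    rewrite /B IntZ; last by apply: itgD => //; exact: itgZ.
    rewrite IntD//; last exact: itgZ.
    rewrite IntZ//.
    have h := en_ge s0 df; rewrite -/(e s _) /npi ler_pdivrMl in h; last by rewrite mulr_gt0// pi_gt0.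
    have h2 : s^-1 * Int (fun u => (1 - e s u) * fsq f u) <= s^-1 * (2 * pi * en s f).
      by rewrite ler_wpM2l// ltW.
    by rewrite /nrm; lra.
  have f1B u : (A u * e s u * G u) ^+ 2 <= B u.
    have e0 : 0 < e s u by exact: expR_gt0.
    have e1 : e s u <= 1 by exact: expw_le1.
    have uN := even_pow_ge0 N_even u.
    have key : (1 + u ^+ N) * e s u <= 1 + s^-1 * (1 - e s u).
      have : u ^+ N * e s u <= s^-1 * (1 - e s u).
        rewrite ler_pdivlMl// mulrA.
        have := expR_ge1Dx (s * u ^+ N).
        have E : expR (s * u ^+ N) * e s u = 1 by rewrite /e expRxMexpNx_1.
        move=> /(ler_wpM2r (ltW e0)); rewrite E; lra.
      lra.
    rewrite !exprMn /B.
    apply: (@le_trans _ _ ((2 * (1 + u ^+ N)) * (e s u * 1) * fsq f u)).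
      apply: ler_pM => //; [by rewrite mulr_ge0 ?sqr_ge0|exact: sqr_ge0|].
      apply: ler_pM => //; [exact: sqr_ge0|exact: sqr_ge0|].
      by rewrite expr2 ler_pM// ltW.
    rewrite mulr1 (_ : _ * _ = 2 * ((1 + u ^+ N) * e s u * fsq f u)); last by ring.
    rewrite ler_pM2l// -[X in _ <= X + _]mul1r mulrA -mulrDl.
    by rewrite ler_wpM2r ?fsq_ge0.
  (* The split for Cauchy-Schwarz: the square of the first factor is dominated by B, that of the
     second by a multiple of 1 / A^2. *)
  have E : (fun u => wt s u * (t u * G u)) = (fun u => (A u * e s u * G u) * (npi R * t u * (A u)^-1)).
    by apply/funext => u; rewrite wtE -/(e s u); field; rewrite gt_eqF.
  have mf1 : msb (fun u => (A u * e s u * G u) ^+ 2).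
    by apply: msbX; apply: msbM => //; apply: msbM => //; exact: expw_msb.
  have i2 : itg (fun u => (A u * e s u * G u) ^+ 2).
    by apply: (itg_le mf1 iB) => u; rewrite ger0_norm ?sqr_ge0.
  have g1B u : (npi R * t u * (A u)^-1) ^+ 2 <= npi R ^+ 2 * (A u)^-1 ^+ 2.
    rewrite !exprMn ler_wpM2r ?sqr_ge0// ler_piMr ?sqr_ge0//.
    by rewrite -real_normK ?num_real// exprn_ile1.
  have i3 : itg (fun u => (npi R * t u * (A u)^-1) ^+ 2).
    apply: (itg_le _ (itgZ (npi R ^+ 2) iA.1)) => [|u]; last by rewrite ger0_norm ?sqr_ge0.
    by apply: msbX; apply: msbM => //; apply: msbM => //; exact: msb_cst.
  have := iI; rewrite E => iI'.
  apply: le_trans (CS_Int i2 i3 iI') _.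
  have pi0 : (0 : R) < pi by exact: pi_gt0.
  have Y0 : 0 <= nrm f + s^-1 * en s f.
    by rewrite addr_ge0 ?nrm_ge0// mulr_ge0 ?en_ge0// ltW.
  apply: (@le_trans _ _ ((4 * pi * (nrm f + s^-1 * en s f)) * (npi R ^+ 2 * (2 * pi)))); last first.
    rewrite /npi le_eqVlt; apply/orP; left; apply/eqP; move: (pi : R) pi0 => p p0.
    by field; rewrite !gt_eqF.
  apply: ler_pM; [by apply: Int_ge0 => u; exact: sqr_ge0|by apply: Int_ge0 => u; exact: sqr_ge0| |].
    apply: le_trans IB; exact: le_Int.
  apply: le_trans (_ : _ <= npi R ^+ 2 * Int (fun u => (A u)^-1 ^+ 2)) _.
    rewrite -IntZ; last exact: iA.1.
    by apply: le_Int => //; apply: itgZ; exact: iA.1.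
  by rewrite ler_wpM2l ?sqr_ge0// iA.2.
(* The cosine and sine parts a and b each have a square at most 2 (nrm f + en s f / s), and (a +
   b)^2 <= 2 a^2 + 2 b^2. *)
exists 8 => // s f x s0 df; have fi := dec_itg df.
have [mC mS] : msb (fun u => cos (u * x)) /\ msb (fun u => sin (u * x)).
  by split; under eq_fun do rewrite mulrC; [exact: msb_cosM|exact: msb_sinM].
have iC : itg (fun u => wt s u * (cos (u * x) * fcos f u)).
  apply: (itgM (wt_itg s0) (msbM mC (msb_fcos fi)) (C := Int (fun x => `|f x|))) => u.
  by rewrite normrM -[leRHS]mul1r ler_pM// ?cos_max// fcos_le.
have iS : itg (fun u => wt s u * (sin (u * x) * fsin f u)).
  apply: (itgM (wt_itg s0) (msbM mS (msb_fsin fi)) (C := Int (fun x => `|f x|))) => u.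
  by rewrite normrM -[leRHS]mul1r ler_pM// ?sin_max// fsin_le.
have -> : P s f x = Int (fun u => wt s u * (cos (u * x) * fcos f u)) +
                    Int (fun u => wt s u * (sin (u * x) * fsin f u)).
  rewrite -IntD// /P (conv_fcos x (wt_itg s0) fi); apply: eq_Int => u.
  by rewrite mulrDr.
have fle u : fcos f u ^+ 2 <= fsq f u by rewrite /fsq lerDl sqr_ge0.
have sle u : fsin f u ^+ 2 <= fsq f u by rewrite /fsq lerDr sqr_ge0.
have := half (fcos f) (fun u => cos (u * x)) s f s0 df (msb_fcos fi) mC (fun u => cos_max _) fle iC.
have := half (fsin f) (fun u => sin (u * x)) s f s0 df (msb_fsin fi) mS (fun u => sin_max _) sle iS.
set b := Int _; set a := Int _ => h2 h1.
have := sqr_ge0 (a - b); rewrite sqrrB sqrrD; lra.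
Qed.

(** As 1 - exp (- y) <= y, a function with N/2 derivatives in L^2 has energy O(s), with a constant
    independent of s. *)
Lemma en_smooth s d : 0 < s -> dec d -> continuous d -> itg (fun u => u ^+ N * fsq d u) ->
  en s d <= npi R * s * Int (fun u => u ^+ N * fsq d u).
Proof.
move=> s0 dd cd iu; apply: le_trans (en_le s0 dd cd) _.
rewrite -mulrA ler_wpM2l ?(ltW (npi_gt0 _))// -IntZ//; apply: le_Int.
- under eq_fun do rewrite mulrC.
  apply: (itgM (Bessel dd).1 _ (C := 1)); first by apply: msbB; [exact: msb_cst|exact: expw_msb].
  move=> u; have h0 := expR_ge0 (- (s * u ^+ N)); have h1 := expw_le1 u s0.
  by rewrite ger0_norm; lra.
- exact: itgZ.
- move=> u; rewrite mulrA ler_wpM2r ?fsq_ge0//.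
  by have := expR_ge1Dx (- (s * u ^+ N)); lra.
Qed.

End heat_operator.

Transparent fcos fsin.

(** * Complex exponentials and Lagrange weights *)

Local Open Scope complex_scope.
Local Notation Re := complex.Re.
Local Notation Im := complex.Im.

Section complex_numbers.
Variable R : realType.
Local Notation C := R[i].
Implicit Types z w : C.

Lemma ReD z w : Re (z + w) = Re z + Re w. Proof. by case: z; case: w. Qed.
Lemma ImD z w : Im (z + w) = Im z + Im w. Proof. by case: z; case: w. Qed.
Lemma ReN z : Re (- z) = - Re z. Proof. by case: z. Qed.
Lemma ImN z : Im (- z) = - Im z. Proof. by case: z. Qed.
Lemma ReB z w : Re (z - w) = Re z - Re w. Proof. by rewrite ReD ReN. Qed.
Lemma ImB z w : Im (z - w) = Im z - Im w. Proof. by rewrite ImD ImN. Qed.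
Lemma ReM z w : Re (z * w) = Re z * Re w - Im z * Im w. Proof. by case: z; case: w. Qed.
Lemma ImM z w : Im (z * w) = Re z * Im w + Im z * Re w. Proof. by case: z; case: w. Qed.
Lemma ReCM (r : R) z : Re (r%:C * z) = r * Re z.
Proof. by rewrite ReM /= mul0r subr0. Qed.
Lemma ImCM (r : R) z : Im (r%:C * z) = r * Im z.
Proof. by rewrite ImM /= mul0r addr0. Qed.

Lemma Re_sum (I : Type) (s : seq I) (Q : pred I) (F : I -> C) :
  Re (\sum_(i <- s | Q i) F i) = \sum_(i <- s | Q i) Re (F i).
Proof. exact: (big_morph (@complex.Re R) ReD (erefl _)). Qed.

Lemma Im_sum (I : Type) (s : seq I) (Q : pred I) (F : I -> C) :
  Im (\sum_(i <- s | Q i) F i) = \sum_(i <- s | Q i) Im (F i).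
Proof. exact: (big_morph (@complex.Im R) ImD (erefl _)). Qed.

Lemma complex_ext z w : Re z = Re w -> Im z = Im w -> z = w.
Proof. by case: z; case: w => a b c d /= -> ->. Qed.

Lemma cmod_norm z : `|z| = (cmod z)%:C.
Proof. by rewrite normc_def; case: z. Qed.

Lemma cmodM z w : cmod (z * w) = cmod z * cmod w.
Proof. exact: ComplexField.Normc.normcM. Qed.

Lemma cmodD z w : cmod (z + w) <= cmod z + cmod w.
Proof. exact: le_normcD. Qed.

Lemma cmodN z : cmod (- z) = cmod z.
Proof. exact: normcN. Qed.

Lemma cmodV z : cmod z^-1 = (cmod z)^-1.
Proof. exact: ComplexField.Normc.normcV. Qed.

Lemma cmod_ge0 z : 0 <= cmod z.
Proof. by case: z => a b; exact: sqrtr_ge0. Qed.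

Lemma cmod0 : cmod (0 : C) = 0.
Proof. exact: ComplexField.Normc.normc0. Qed.

Lemma cmod1 : cmod (1 : C) = 1.
Proof. exact: ComplexField.Normc.normc1. Qed.

Lemma cmodX z n : cmod (z ^+ n) = cmod z ^+ n.
Proof. by elim: n => [|n IH]; rewrite ?expr0 ?cmod1// !exprS cmodM IH. Qed.

Lemma cmodR (r : R) : cmod r%:C = `|r|.
Proof. by rewrite /cmod /= expr0n addr0 sqrtr_sqr. Qed.

Lemma cmod_sqr z : cmod z ^+ 2 = Re z ^+ 2 + Im z ^+ 2.
Proof. by case: z => a b; rewrite /cmod /= sqr_sqrtr// addr_ge0// sqr_ge0. Qed.

Lemma Re_cmod z : `|Re z| <= cmod z.
Proof.
case: z => a b; rewrite /cmod /= -sqrtr_sqr ler_wsqrtr// lerDl sqr_ge0//.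
Qed.

Lemma Im_cmod z : `|Im z| <= cmod z.
Proof.
case: z => a b; rewrite /cmod /= -sqrtr_sqr ler_wsqrtr// lerDr sqr_ge0//.
Qed.

Lemma cmod_le z : cmod z <= `|Re z| + `|Im z|.
Proof.
rewrite -(@ler_pXn2r _ 2)// ?nnegrE ?cmod_ge0 ?addr_ge0// cmod_sqr sqrrD !real_normK ?num_real//.
by rewrite lerD2r lerDl mulrn_wge0// mulr_ge0.
Qed.

Lemma cmod_eq0 z : (cmod z == 0) = (z == 0).
Proof.
by apply/eqP/eqP => [|->]; [exact: ComplexField.Normc.eq0_normc|exact: cmod0].
Qed.

Lemma cmod_sum (I : Type) (s : seq I) (Q : pred I) (F : I -> C) :
  cmod (\sum_(i <- s | Q i) F i) <= \sum_(i <- s | Q i) cmod (F i).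
Proof.
elim/big_rec2: _ => [|i x y _ h]; first by rewrite cmod0.
by apply: le_trans (cmodD _ _) _; rewrite lerD2l.
Qed.

Lemma Re_cexp z : Re (cexp z) = expR (Re z) * cos (Im z).
Proof. by rewrite /cexp ReCM. Qed.

Lemma Im_cexp z : Im (cexp z) = expR (Re z) * sin (Im z).
Proof. by rewrite /cexp ImCM. Qed.

Lemma cexpD z w : cexp (z + w) = cexp z * cexp w.
Proof.
apply: complex_ext.
  by rewrite [LHS]Re_cexp ReM !Re_cexp !Im_cexp ReD ImD expRD cosD; ring.
by rewrite [LHS]Im_cexp ImM !Re_cexp !Im_cexp ReD ImD expRD sinD; ring.
Qed.

Lemma cexp0 : cexp (0 : C) = 1.
Proof. by apply: complex_ext; rewrite ?Re_cexp ?Im_cexp /= expR0 ?cos0 ?sin0 mul1r. Qed.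

Lemma cexpN z : cexp (- z) * cexp z = 1.
Proof. by rewrite -cexpD addNr cexp0. Qed.

Lemma cexp_neq0 z : cexp z != 0.
Proof.
by apply/eqP => h; have := cexpN z; rewrite h mulr0 => /eqP; rewrite eq_sym oner_eq0.
Qed.

Lemma cexpNV z : cexp (- z) = (cexp z)^-1.
Proof. by apply: (mulIf (cexp_neq0 z)); rewrite cexpN mulVf ?cexp_neq0. Qed.

Lemma cexpX z n : cexp z ^+ n = cexp (n%:R * z).
Proof.
elim: n => [|n IH]; first by rewrite mul0r cexp0.
by rewrite exprS IH -cexpD -[X in cexp (X + _)]mul1r -mulrDl -natr1 addrC.
Qed.

Lemma cmod_cexp z : cmod (cexp z) = expR (Re z).
Proof.
rewrite /cexp cmodM cmodR (ger0_norm (expR_ge0 _)) -[RHS]mulr1; congr (_ * _).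
by rewrite /cmod /= cos2Dsin2 sqrtr1.
Qed.

Lemma iM_real (r : R) : 'i%C * r%:C = 0 +i* r.
Proof. by apply: complex_ext; rewrite ?ReM ?ImM /=; ring. Qed.

Definition cder (F G : R -> C) := forall x : R,
  is_derive x (1 : R) (fun t => Re (F t)) (Re (G x)) /\
  is_derive x (1 : R) (fun t => Im (F t)) (Im (G x)).

Lemma cder_ext F G G' : cder F G -> G =1 G' -> cder F G'.
Proof. by move=> h /funext <-. Qed.

Lemma cder_cst z : cder (fun=> z) (fun=> 0).
Proof. by move=> x; split => /=; exact: is_derive_cst. Qed.

Lemma cderD F G F' G' : cder F F' -> cder G G' -> cder (fun x => F x + G x) (fun x => F' x + G' x).
Proof.
move=> hF hG x; have [h1 h2] := hF x; have [h3 h4] := hG x; split.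
  rewrite ReD (_ : (fun t => _) = (fun t => Re (F t) + Re (G t))); first exact: is_deriveD.
  by apply/funext => t; rewrite ReD.
rewrite ImD (_ : (fun t => _) = (fun t => Im (F t) + Im (G t))); first exact: is_deriveD.
by apply/funext => t; rewrite ImD.
Qed.

Lemma cderM F G F' G' : cder F F' -> cder G G' ->
  cder (fun x => F x * G x) (fun x => F' x * G x + F x * G' x).
Proof.
move=> hF hG x; have [h1 h2] := hF x; have [h3 h4] := hG x; split.
  rewrite (_ : (fun t => _) = (fun t => Re (F t) * Re (G t) - Im (F t) * Im (G t))); last first.
    by apply/funext => t; rewrite ReM.
  apply: (is_derive_eq (is_deriveB (is_deriveM h1 h3) (is_deriveM h2 h4))).
  by rewrite /GRing.scale /= ReD !ReM; ring.
rewrite (_ : (fun t => _) = (fun t => Re (F t) * Im (G t) + Im (F t) * Re (G t))); last first.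
  by apply/funext => t; rewrite ImM.
apply: (is_derive_eq (is_deriveD (is_deriveM h1 h4) (is_deriveM h2 h3))).
by rewrite /GRing.scale /= ImD !ImM; ring.
Qed.

Lemma cderZ z F F' : cder F F' -> cder (fun x => z * F x) (fun x => z * F' x).
Proof.
by move=> hF; apply: cder_ext (cderM (cder_cst z) hF) _ => x; rewrite mul0r add0r.
Qed.

Lemma cder_sum (I : finType) (Q : pred I) (F F' : I -> R -> C) :
  (forall i, Q i -> cder (F i) (F' i)) ->
  cder (fun x => \sum_(i | Q i) F i x) (fun x => \sum_(i | Q i) F' i x).
Proof.
move=> h; have : forall s : seq I, cder (fun x => \sum_(i <- s | Q i) F i x) (fun x => \sum_(i <- s | Q i) F' i x).
  elim=> [|i s IH].
    have -> : (fun x : R => \sum_(i <- [::] | Q i) F i x) = (fun=> 0).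
      by apply/funext => x; rewrite big_nil.
    have -> : (fun x : R => \sum_(i <- [::] | Q i) F' i x) = (fun=> 0).
      by apply/funext => x; rewrite big_nil.
    exact: cder_cst.
  have -> : (fun x : R => \sum_(i <- i :: s | Q i) F i x) =
      (fun x => (if Q i then F i x else 0) + \sum_(i <- s | Q i) F i x).
    by apply/funext => x; rewrite big_cons; case: ifP => // _; rewrite add0r.
  have -> : (fun x : R => \sum_(i <- i :: s | Q i) F' i x) =
      (fun x => (if Q i then F' i x else 0) + \sum_(i <- s | Q i) F' i x).
    by apply/funext => x; rewrite big_cons; case: ifP => // _; rewrite add0r.
  by apply: cderD => //; case E : (Q i); [exact: h|exact: cder_cst].
exact.
Qed.

Lemma cder_id : cder (fun x => x%:C) (fun=> 1).
Proof. by move=> x; split => /=; [exact: is_derive_id|exact: is_derive_cst]. Qed.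

Lemma cder_cexp z : cder (fun x => cexp (z * x%:C)) (fun x => z * cexp (z * x%:C)).
Proof.
have Rz (t : R) : Re (z * t%:C) = Re z * t by rewrite mulrC ReCM mulrC.
have Iz (t : R) : Im (z * t%:C) = Im z * t by rewrite mulrC ImCM mulrC.
move=> x; split.
  rewrite (_ : (fun t => _) = (fun t => expR (Re z * t) * cos (Im z * t))); last first.
    by apply/funext => t; rewrite Re_cexp Rz Iz.
  apply: is_derive_eq; rewrite /GRing.scale /= ReM Re_cexp Im_cexp Rz Iz; ring.
rewrite (_ : (fun t => _) = (fun t => expR (Re z * t) * sin (Im z * t))); last first.
  by apply/funext => t; rewrite Im_cexp Rz Iz.
apply: is_derive_eq; rewrite /GRing.scale /= ImM Re_cexp Im_cexp Rz Iz; ring.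
Qed.

Lemma cderX z n : cder (fun x => (z * x%:C) ^+ n) (fun x => n%:R * z * (z * x%:C) ^+ n.-1).
Proof.
have dz : cder (fun x => z * x%:C) (fun=> z).
  by apply: cder_ext (cderZ z cder_id) _ => x; rewrite mulr1.
elim: n => [|n IH].
  by apply: cder_ext (cder_cst _) _ => x; rewrite !mul0r.
have -> : (fun x : R => (z * x%:C) ^+ n.+1) = (fun x => (z * x%:C) * (z * x%:C) ^+ n).
  by apply/funext => x; rewrite exprS.
apply: cder_ext (cderM dz IH) _ => x /=.
case: n {IH} => [|n] /=; first by rewrite !(mul0r,mulr0) expr0; ring.
by rewrite !exprS -[n.+2%:R]natr1; ring.
Qed.

Lemma cder_cont F G : cder F G -> continuous (fun x => Re (F x)) /\ continuous (fun x => Im (F x)).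
Proof.
move=> h; split => x; have [h1 h2] := h x.
  by apply: differentiable_continuous; apply/derivable1_diffP.
by apply: differentiable_continuous; apply/derivable1_diffP.
Qed.

(* The factor 2 comes from treating the two components separately. *)
Lemma cder_mvt F G M : cder F G -> (forall t, 0 <= t <= 1 -> cmod (G t) <= M) ->
  forall t, 0 <= t <= 1 -> cmod (F t - F 0) <= 2 * M.
Proof.
move=> h GM t /andP[t0 t1].
have [cR cI] := cder_cont h.
have part (f g : R -> R) : (forall x : R, is_derive x (1 : R) f (g x)) -> continuous f ->
    (forall t, 0 <= t <= 1 -> `|g t| <= M) -> `|f t - f 0| <= M.
  move=> fg cf gM; have [|c cI' ->] := @MVT_segment R f g 0 t t0 (fun x _ => fg x).
    exact: continuous_subspaceT.
  move: cI'; rewrite in_itv/= => /andP[c0 ct].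
  rewrite subr0 normrM (ger0_norm t0); apply: le_trans (ler_piMr _ t1) _ => //.
  by apply: gM; rewrite c0 (le_trans ct).
apply: le_trans (cmod_le _) _; rewrite ReB ImB mulr2n mulrDl mul1r.
apply: lerD.
  apply: (part (fun x => Re (F x)) (fun x => Re (G x))) => // [x|s s01]; first by have [] := h x.
  exact: le_trans (Re_cmod _) (GM s s01).
apply: (part (fun x => Im (F x)) (fun x => Im (G x))) => // [x|s s01]; first by have [] := h x.
exact: le_trans (Im_cmod _) (GM s s01).
Qed.

Definition texp n w := \sum_(i < n) w ^+ i / i`!%:R.

Lemma texp_der n z : cder (fun x => texp n.+1 (z * x%:C)) (fun x => z * texp n (z * x%:C)).
Proof.
elim: n => [|n IH].
  have -> : (fun x : R => texp 1 (z * x%:C)) = (fun=> 1).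
    by apply/funext => x; rewrite /texp big_ord1 expr0 fact0 divr1.
  by apply: cder_ext (cder_cst _) _ => x; rewrite /texp big_ord0 mulr0.
have -> : (fun x : R => texp n.+2 (z * x%:C)) =
    (fun x => texp n.+1 (z * x%:C) + (n.+1`!%:R)^-1 * (z * x%:C) ^+ n.+1).
  by apply/funext => x; rewrite /texp [LHS]big_ord_recr/= [X in _ + X]mulrC.
apply: cder_ext (cderD IH (cderZ _ (cderX z n.+1))) _ => x /=.
rewrite /texp [in RHS]big_ord_recr /= mulrDr; congr (_ + _).
rewrite factS natrM invfM.
have n0 : (n.+1%:R : C) != 0 by rewrite pnatr_eq0.
have f0 : (n`!%:R : C) != 0 by rewrite pnatr_eq0 -lt0n fact_gt0.
move: (n.+1%:R : C) n0 (n`!%:R : C) f0 => p p0 q q0.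
by field; rewrite p0 q0.
Qed.

Lemma texp0 n : texp n.+1 0 = 1.
Proof.
rewrite /texp big_ord_recl expr0 fact0 divr1 big1 ?addr0// => i _.
by rewrite expr0n mul0r.
Qed.

(** Along the ray t w, the remainder of order n + 1 has derivative w times that of order n, and
    [cder_mvt] costs a factor 2 each time. The last factor bounds |exp (t w)| for t in [0, 1]. *)
Lemma cexp_taylor n w : cmod (cexp w - texp n w) <= 2 ^+ n * cmod w ^+ n * expR (Num.max (Re w) 0).
Proof.
set M := expR _.
suff h t : 0 <= t <= 1 -> cmod (cexp (w * t%:C) - texp n (w * t%:C)) <= 2 ^+ n * cmod w ^+ n * M.
  by have := h 1; rewrite mulr1; apply; rewrite ler01 lexx.
elim: n t => [|n IH] t t01.
  rewrite /texp big_ord0 subr0 !mul1r cmod_cexp ler_expR.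
  move: t01 => /andP[t0 t1]; rewrite mulrC ReCM le_max.
  have [h|h] := leP 0 (Re w); first by rewrite ler_piMl.
  by rewrite (mulr_ge0_le0 t0 (ltW h)) orbT.
have d : cder (fun x => cexp (w * x%:C) - texp n.+1 (w * x%:C))
    (fun x => w * (cexp (w * x%:C) - texp n (w * x%:C))).
  have -> : (fun x : R => cexp (w * x%:C) - texp n.+1 (w * x%:C)) =
      (fun x => cexp (w * x%:C) + (-1) * texp n.+1 (w * x%:C)).
    by apply/funext => x; rewrite mulN1r.
  apply: cder_ext (cderD (cder_cexp w) (cderZ _ (texp_der n w))) _ => x; ring.
have := @cder_mvt _ _ (cmod w * (2 ^+ n * cmod w ^+ n * M)) d _ t t01.
rewrite mulr0 cexp0 texp0 subrr subr0.
rewrite [leRHS](_ : _ = 2 ^+ n.+1 * cmod w ^+ n.+1 * M); last by rewrite !exprS; ring.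
apply=> s s01; rewrite cmodM ler_wpM2l ?cmod_ge0//; exact: IH.
Qed.

End complex_numbers.

(** * Lagrange interpolation of powers *)

Section lagrange.
Variables (F : fieldType) (I : finType) (A : {set I}) (c : I -> F) (w : F).
Hypothesis c_inj : {in A &, injective c}.

Definition lag (j : I) := \prod_(l in A :\ j) ((c l - w) / (c l - c j)).

(** Interpolation of X^i at the nodes c_j is exact: the difference has degree below the number of
    nodes and vanishes at all of them. *)
Lemma lagrange_pow i : (i < #|A|)%N -> \sum_(j in A) lag j * c j ^+ i = w ^+ i.
Proof.
move=> iA.
pose Lp j : {poly F} := \prod_(l in A :\ j) ((c l - c j)^-1 *: ((c l)%:P - 'X)).
have LpE j x : (Lp j).[x] = \prod_(l in A :\ j) ((c l - x) / (c l - c j)).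
  rewrite horner_prod; apply: eq_bigr => l _.
  by rewrite hornerZ hornerD hornerN hornerC hornerX mulrC.
pose D : {poly F} := \sum_(j in A) (c j ^+ i) *: Lp j - 'X^i.
have Lsize j : j \in A -> (size (Lp j) <= #|A|)%N.
  move=> jA; rewrite (cardsD1 j A) jA add1n.
  apply: leq_trans (size_prod_leq _ _) _ => /=.
  rewrite leq_subLR addnS ltnS -sum1_card [leqRHS](_ : _ = \sum_(l in A :\ j) 2)%N; last first.
    by rewrite -big_split.
  apply: leq_sum => l _; apply: leq_trans (size_scale_leq _ _) _.
  by rewrite -opprB size_polyN size_XsubC.
have Dsize : (size D <= #|A|)%N.
  apply: leq_trans (size_polyD _ _) _; rewrite geq_max size_polyN size_polyXn iA andbT.
  apply: leq_trans (size_sum _ _ _) _; apply/bigmax_leqP => j jA.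
  exact: leq_trans (size_scale_leq _ _) (Lsize j jA).
have D0 : D = 0.
  apply: (@roots_geq_poly_eq0 _ D [seq c j | j <- enum A]).
  - apply/allP => y /mapP[k]; rewrite mem_enum => kA ->.
    rewrite /root hornerD hornerN hornerXn horner_sum (bigD1 k)//= big1 ?addr0.
      rewrite hornerZ LpE big1 ?mulr1 ?subrr// => l; rewrite !inE => /andP[lk lA].
      by rewrite divff// subr_eq0; apply: contra lk => /eqP/c_inj ->.
    move=> j /andP[jA jk]; rewrite hornerZ LpE (bigD1 k)/=; last by rewrite !inE eq_sym jk.
    by rewrite subrr !mul0r mulr0.
  - rewrite map_inj_in_uniq ?enum_uniq// => x y; rewrite !mem_enum; exact: c_inj.
  - by rewrite size_map -cardE.
have : D.[w] = 0 by rewrite D0 horner0.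
rewrite hornerD hornerN hornerXn horner_sum => /eqP; rewrite subr_eq0 => /eqP <-.
by apply: eq_bigr => j _; rewrite hornerZ LpE mulrC.
Qed.

End lagrange.

Section more_integrals.
Variable R : realType.
Implicit Types f g : R -> R.

Lemma Int_sum n (F : 'I_n -> R -> R) : (forall i, itg (F i)) ->
  itg (fun x => \sum_(i < n) F i x) /\ Int (fun x => \sum_(i < n) F i x) = \sum_(i < n) Int (F i).
Proof.
elim: n F => [|n IH] F iF.
  have E : (fun x => \sum_(i < 0) F i x) = (fun=> 0) by apply/funext => x; rewrite big_ord0.
  by rewrite E big_ord0 Int0; split => //; exact: itg0.
have [i1 e1] := IH (fun i => F (widen_ord (leqnSn n) i)) (fun i => iF _).
have E : (fun x => \sum_(i < n.+1) F i x) =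
    (fun x => \sum_(i < n) F (widen_ord (leqnSn n) i) x + F ord_max x).
  by apply/funext => x; rewrite big_ord_recr.
by rewrite E big_ord_recr /= IntD// e1; split => //; exact: itgD.
Qed.

Lemma Int_point (a r : R) : itg (fun x => if x == a then r else 0) /\
  Int (fun x => if x == a then r else 0) = 0.
Proof.
have [i1 e1] := @ftc_itv R (fun=> r) (fun x => r * x) a a (lexx _) (fun x => cvg_cst _)
  (fun x => is_derive_eq (is_deriveZ r (is_derive_id x 1)) (mulr1 r)).
have E : (fun x => if x == a then r else 0) = (fun x => if (a <= x) && (x <= a) then r else 0).
  by apply/funext => x; rewrite -eq_le eq_sym.
by rewrite E e1 subrr.
Qed.

Lemma Int_ae1 f g (a : R) : itg g -> (forall x, x != a -> f x = g x) -> itg f /\ Int f = Int g.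
Proof.
move=> gi fg; have [i1 e1] := Int_point a (f a - g a).
have -> : f = (fun x => g x + (if x == a then f a - g a else 0)).
  apply/funext => x; case: eqVneq => [->|xa]; first by ring.
  by rewrite addr0 fg.
by split; [exact: itgD|rewrite IntD// e1 addr0].
Qed.

Lemma w1_abs_tri (x y : R) : w1 (x + y) <= 2 * w1 x * (1 + y ^+ 2).
Proof.
have := w1_tri x (- y); rewrite opprK.
have -> : w1 (- y) = w1 y by rewrite /w1 sqrrN.
by rewrite -w1V -ler_pdivlMr ?w1_gt0.
Qed.

End more_integrals.

(** * Exponential sums and the Taylor expansion of the convolution *)

Section exponential_sums.
Variables (R : realType) (I : finType) (A : {set I}) (c : I -> R[i]).
Hypothesis c_gt0 : forall j, j \in A -> 0 < Re (c j).
Local Notation C := R[i].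

Definition Vexp (D : I -> C) (x : R) := \sum_(j in A) D j * cexp (c j * x%:C).

Lemma Vexp_der D : cder (Vexp D) (Vexp (fun j => D j * c j)).
Proof.
apply: cder_sum => j jA; apply: cder_ext (cderZ (D j) (cder_cexp (c j))) _ => x; ring.
Qed.

Lemma cexp_dec z : 0 < Re z -> exists2 K, 0 <= K & forall x : R, x <= 0 ->
  cmod (cexp (z * x%:C)) <= K * w1 x ^+ 2.
Proof.
move=> z0; set a := Re z in z0.
have a4 : 0 < a ^+ 4 by exact: exprn_gt0.
(* From exp y >= 1 + y^4 / 24 the exponential E satisfies E x^4 <= 24 / a^4; combine with (1 +
   x^2)^2 <= 2 + 2 x^4. *)
exists (2 + 48 / a ^+ 4); first by rewrite addr_ge0// divr_ge0// ltW.
move=> x x0; rewrite cmod_cexp mulrC ReCM -/a.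
rewrite -ler_pdivrMr ?exprn_gt0 ?w1_gt0// -exprVn w1V.
have y0 : 0 <= - (x * a) by rewrite -mulNr mulr_ge0 ?oppr_ge0// ltW.
have := @expR_ge1Dxn R _ 3 y0.
have -> : (- (x * a)) ^+ 4 = x ^+ 4 * a ^+ 4 by ring.
have -> : 4`!%:R = 24 :> R by [].
rewrite expRN; set E := expR _; have E0 : 0 < E by exact: expR_gt0.
move=> h; have {}h : E * (1 + x ^+ 4 * a ^+ 4 / 24) <= 1.
  by rewrite mulrC -ler_pdivlMr// mul1r.
have x4 : 0 <= x ^+ 4 by rewrite exprn_even_ge0.
have p : (1 + x ^+ 2) ^+ 2 <= 2 + 2 * x ^+ 4.
  by have := sqr_ge0 (1 - x ^+ 2); rewrite sqrrB sqrrD -exprM; lra.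
apply: le_trans (ler_wpM2l (ltW E0) p) _.
rewrite -(ler_pM2r a4) [leRHS](_ : _ = 2 * a ^+ 4 + 48); last by field; rewrite gt_eqF.
have E1 : E <= 1.
  by have := mulr_ge0 (ltW E0) (mulr_ge0 x4 (ltW a4)); lra.
have : E * a ^+ 4 <= a ^+ 4 by rewrite ler_piMl// ltW.
lra.
Qed.

Lemma Vexp_dec D : exists2 K, 0 <= K & forall x : R, x <= 0 -> cmod (Vexp D x) <= K * w1 x ^+ 2.
Proof.
have h j : exists K, 0 <= K /\ (j \in A -> forall x : R, x <= 0 -> cmod (cexp (c j * x%:C)) <= K * w1 x ^+ 2).
  have [jA|jA] := boolP (j \in A); last by exists 0.
  by have [K K0 hK] := cexp_dec (c_gt0 jA); exists K.
have [K hK] := choice h.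
exists (\sum_(j in A) cmod (D j) * K j).
  by apply: sumr_ge0 => j _; rewrite mulr_ge0 ?cmod_ge0//; have [] := hK j.
move=> x x0; apply: le_trans (cmod_sum _ _ _) _.
rewrite mulr_suml; apply: ler_sum => j jA; rewrite cmodM -mulrA ler_wpM2l ?cmod_ge0//.
by have [_ ->] := hK j.
Qed.

Section taylor.
Variable N : nat.
Hypothesis N_even : ~~ odd N.
Hypothesis N_gt0 : (0 < N)%N.
Local Notation ker := (ker N).
Local Notation P := (P N).

Let absRe (D : I -> C) (x : R) (F : I -> C) (G : I -> R) :
  (forall j, j \in A -> cmod (F j) <= G j) ->
  `|Re (\sum_(j in A) D j * cexp (c j * x%:C) * F j)| <=
  \sum_(j in A) cmod (D j) * cmod (cexp (c j * x%:C)) * G j.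
Proof.
move=> FG; apply: le_trans (Re_cmod _) _; apply: le_trans (cmod_sum _ _ _) _.
by apply: ler_sum => j jA; rewrite !cmodM ler_wpM2l ?mulr_ge0 ?cmod_ge0 ?FG.
Qed.

Lemma texp_bnd n (w : C) (y : R) : 1 <= y -> cmod w <= y -> cmod (texp n.+1 w) <= n.+1%:R * y ^+ n.
Proof.
move=> y1 wy; apply: le_trans (cmod_sum _ _ _) _.
apply: (@le_trans _ _ (\sum_(i < n.+1) y ^+ n)); last first.
  by rewrite sumr_const card_ord mulr_natl.
apply: ler_sum => i _; rewrite cmodM cmodV cmodX.
have -> : cmod (i`!%:R : C) = i`!%:R.
  by have := cmodR (i`!%:R : R); rewrite rmorph_nat normr_nat.
apply: (@le_trans _ _ (cmod w ^+ i)).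
  by rewrite ler_piMr ?exprn_ge0 ?cmod_ge0// invf_le1 ?ler1n ?ltr0n fact_gt0.
apply: (@le_trans _ _ (y ^+ i)); first by rewrite lerXn2r ?nnegrE ?cmod_ge0// (le_trans _ y1).
by rewrite ler_weXn2l// -ltnS.
Qed.

(** Taylor's formula is available only where g is the exponential sum, which xi <= e guarantees. For
    xi > e both terms are bounded crudely, and (xi / e)^(N + 1) >= 1 restores the order in xi at the
    price of a negative power of e. *)
Let remainder (D : I -> C) (g : R -> R) (e B : R) : 0 < e <= 1 ->
  (forall y, y <= e -> g y = Re (Vexp D y)) -> (forall y, `|g y| <= B) ->
  exists2 K, 0 <= K & forall x xi, x <= 0 ->
  `|g (x + xi) - Re (\sum_(j in A) D j * cexp (c j * x%:C) * texp N.+1 (c j * xi%:C))|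
  <= K * w1 x ^+ 2 * (`|xi| ^+ N.+1 * (1 + xi ^+ 2) ^+ 2).
Proof.
move=> /andP[e0 e1] gV gB.
have B0 : 0 <= B by apply: le_trans (gB 0).
have [K1 K10 hK1] := Vexp_dec D.
pose S x := \sum_(j in A) cmod (D j) * cmod (cexp (c j * x%:C)).
have [K2 K20 hK2] : exists2 K, 0 <= K & forall x, x <= 0 -> S x <= K * w1 x ^+ 2.
  have h j : exists K, 0 <= K /\ (j \in A -> forall x : R, x <= 0 -> cmod (cexp (c j * x%:C)) <= K * w1 x ^+ 2).
    have [jA|jA] := boolP (j \in A); last by exists 0.
    by have [K K0 hK] := cexp_dec (c_gt0 jA); exists K.
  have [K hK] := choice h.
  exists (\sum_(j in A) cmod (D j) * K j).
    by apply: sumr_ge0 => j _; rewrite mulr_ge0 ?cmod_ge0//; have [] := hK j.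
  move=> x x0; rewrite mulr_suml; apply: ler_sum => j jA.
  by rewrite -mulrA ler_wpM2l ?cmod_ge0//; have [_ ->] := hK j.
have S0 x : 0 <= S x by apply: sumr_ge0 => j _; rewrite mulr_ge0 ?cmod_ge0.
pose M := 1 + \sum_(j in A) cmod (c j).
have M1 : 1 <= M by rewrite lerDl; apply: sumr_ge0 => j _; exact: cmod_ge0.
have cM j : j \in A -> cmod (c j) <= M.
  move=> jA; rewrite /M (bigD1 j)//= addrCA lerDl addr_ge0//.
  by apply: sumr_ge0 => k _; exact: cmod_ge0.
have M0 : 0 <= M by exact: le_trans M1.
(* The first summand serves for xi <= e, the second for xi > e. *)
pose K := 2 ^+ N.+1 * M ^+ N.+1 * expR M * K2 + (B + 4 * K1 + N.+2%:R * M ^+ N.+1 * K2) / e ^+ N.+1.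
have T1 : 0 <= 2 ^+ N.+1 * M ^+ N.+1 * expR M * K2 by rewrite !mulr_ge0 ?exprn_ge0 ?expR_ge0.
have T2 : 0 <= (B + 4 * K1 + N.+2%:R * M ^+ N.+1 * K2) / e ^+ N.+1.
  by rewrite divr_ge0 ?exprn_ge0 ?(ltW e0)// !addr_ge0 ?mulr_ge0 ?exprn_ge0.
have K0 : 0 <= K by exact: addr_ge0.
exists K => // x xi x0.
have w0 : 0 <= w1 x ^+ 2 by rewrite exprn_ge0 ?w1_ge0.
have q1 : 1 <= (1 + xi ^+ 2) ^+ 2 by rewrite exprn_ege1// lerDl sqr_ge0.
have q0 : 0 <= (1 + xi ^+ 2) ^+ 2 by exact: le_trans q1.
have [xe|ex] := leP xi e.
  have y_e : x + xi <= e by rewrite -[leRHS]add0r lerD.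
  rewrite gV// /Vexp -ReB -sumrB.
  rewrite (eq_bigr (fun j => D j * cexp (c j * x%:C) * (cexp (c j * xi%:C) - texp N.+1 (c j * xi%:C)))); last first.
    by move=> j _; rewrite rmorphD/= mulrDr cexpD; ring.
  apply: le_trans (absRe _ _ (G := fun j => 2 ^+ N.+1 * (M * `|xi|) ^+ N.+1 * expR M) _) _.
    move=> j jA; apply: le_trans (cexp_taylor _ _) _.
    rewrite cmodM cmodR; apply: ler_pM => //.
    - by rewrite mulr_ge0 ?exprn_ge0 ?mulr_ge0 ?cmod_ge0.
    - rewrite ler_wpM2l ?exprn_ge0// lerXn2r ?nnegrE ?mulr_ge0 ?cmod_ge0//.
      by rewrite ler_wpM2r// cM.
    rewrite ler_expR ge_max M0 andbT mulrC ReCM.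
    have := cM _ jA; have := Re_cmod (c j); rewrite (ger0_norm (ltW (c_gt0 jA))).
    have := c_gt0 jA => h1 h2 h3; apply: (@le_trans _ _ (1 * Re (c j))).
      by apply: ler_wpM2r; [exact: ltW|exact: le_trans xe e1].
    by rewrite mul1r (le_trans h2).
  rewrite -mulr_suml -/(S x).
  apply: (@le_trans _ _ ((K2 * w1 x ^+ 2) * (2 ^+ N.+1 * (M * `|xi|) ^+ N.+1 * expR M))).
    by rewrite ler_wpM2r ?hK2// mulr_ge0 ?expR_ge0 ?mulr_ge0 ?exprn_ge0 ?mulr_ge0.
  rewrite exprMn [leLHS](_ : _ = (2 ^+ N.+1 * M ^+ N.+1 * expR M * K2) * w1 x ^+ 2 * (`|xi| ^+ N.+1 * 1)); last by ring.
  apply: ler_pM; [by rewrite mulr_ge0|by rewrite mulr1 exprn_ge0| |by rewrite ler_wpM2l ?exprn_ge0].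
  by rewrite ler_wpM2r// /K lerDl.
have q2 : 0 <= 1 + xi ^+ 2 by rewrite addr_ge0// sqr_ge0.
have xi0 : 0 < xi by exact: lt_trans ex.
have xie : 1 <= xi / e by rewrite ler_pdivlMr// mul1r ltW.
rewrite (gtr0_norm xi0).
have gb : `|g (x + xi)| <= (B + 4 * K1) * w1 x ^+ 2 * (1 + xi ^+ 2) ^+ 2.
  have [h|h] := leP (x + xi) 0.
    rewrite gV; last by rewrite (le_trans h)// ltW.
    apply: le_trans (Re_cmod _) _; apply: le_trans (hK1 _ h) _.
    have := w1_abs_tri x xi => h2.
    apply: (@le_trans _ _ (K1 * (2 * w1 x * (1 + xi ^+ 2)) ^+ 2)).
      by rewrite ler_wpM2l// lerXn2r ?nnegrE ?w1_ge0// !mulr_ge0 ?w1_ge0.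
    rewrite [leLHS](_ : _ = (4 * K1) * w1 x ^+ 2 * (1 + xi ^+ 2) ^+ 2); last by ring.
    by rewrite ler_wpM2r// ler_wpM2r// lerDr.
  (* Here - xi < x <= 0, so x^2 <= xi^2 and w1 x (1 + xi^2) >= 1: a constant bound on g suffices. *)
  apply: le_trans (gB _) _; rewrite -mulrA.
  apply: (@le_trans _ _ ((B + 4 * K1) * 1)); first by rewrite mulr1 lerDl mulr_ge0.
  rewrite ler_wpM2l ?addr_ge0 ?mulr_ge0// -exprMn exprn_ege1// mulrC ler_pdivlMr ?mul1r; last first.
    by rewrite ltr_pwDl// sqr_ge0.
  rewrite lerD2l -[x ^+ 2]sqrrN lerXn2r ?nnegrE ?oppr_ge0 ?(ltW xi0)//.
  by move: h; lra.
have tb : `|Re (\sum_(j in A) D j * cexp (c j * x%:C) * texp N.+1 (c j * xi%:C))| <=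
    (N.+2%:R * M ^+ N.+1 * K2) * w1 x ^+ 2 * (xi / e) ^+ N.+1.
  apply: le_trans (absRe _ _ (G := fun j => N.+1%:R * (M * (xi / e)) ^+ N) _) _.
    move=> j jA; apply: texp_bnd; first by rewrite -[leLHS]mul1r ler_pM.
    rewrite cmodM cmodR (gtr0_norm xi0) ler_pM ?cmod_ge0 ?cM ?(ltW xi0)//.
    by rewrite ler_pdivlMr// ler_piMr// ltW.
  rewrite -mulr_suml -/(S x).
  apply: (@le_trans _ _ ((K2 * w1 x ^+ 2) * (N.+2%:R * (M * (xi / e)) ^+ N.+1))); last first.
    by rewrite exprMn le_eqVlt; apply/orP; left; apply/eqP; ring.
  have z1 : 1 <= M * (xi / e) by rewrite -[leLHS]mul1r ler_pM.
  apply: ler_pM => //; [by rewrite mulr_ge0 ?exprn_ge0 ?(le_trans _ z1)|exact: hK2|].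
  apply: ler_pM => //; [by rewrite exprn_ge0 ?(le_trans _ z1)|by rewrite ler_nat|].
  by rewrite ler_weXn2l.
have xn1 : 1 <= (xi / e) ^+ N.+1 by exact: exprn_ege1.
apply: le_trans (ler_normB _ _) _; apply: le_trans (lerD gb tb) _.
apply: (@le_trans _ _ ((B + 4 * K1 + N.+2%:R * M ^+ N.+1 * K2) * w1 x ^+ 2 * ((xi / e) ^+ N.+1 * (1 + xi ^+ 2) ^+ 2))); last first.
  rewrite expr_div_n [leLHS](_ : _ = ((B + 4 * K1 + N.+2%:R * M ^+ N.+1 * K2) / e ^+ N.+1) * w1 x ^+ 2 *
    (xi ^+ N.+1 * (1 + xi ^+ 2) ^+ 2)); last by ring.
  rewrite ler_wpM2r ?mulr_ge0 ?exprn_ge0 ?(ltW xi0)//.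
  by rewrite ler_wpM2r// /K lerDr.
have p0 : 0 <= B + 4 * K1 by rewrite addr_ge0 ?mulr_ge0.
have p1 : 0 <= N.+2%:R * M ^+ N.+1 * K2 by rewrite !mulr_ge0 ?exprn_ge0.
move: (B + 4 * K1) p0 (N.+2%:R * M ^+ N.+1 * K2) p1 => p p0 q p1.
rewrite [leRHS](_ : _ = (p * w1 x ^+ 2 * (1 + xi ^+ 2) ^+ 2) * (xi / e) ^+ N.+1 +
  (q * w1 x ^+ 2 * (xi / e) ^+ N.+1) * (1 + xi ^+ 2) ^+ 2); last by ring.
have xn0 := le_trans ler01 xn1.
by apply: lerD; rewrite ler_peMr//; do ?[apply: mulr_ge0 => //].
Qed.

(** [kappa] as a real number. *)
Definition kapR : R := - (-1) ^+ N./2.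

(** Integrated against the kernel, the Taylor polynomial at x keeps only its terms of orders 0 and N
    ([ker_moment]); the remainder contributes O(r^(N + 1)) by [ker_abs_moment]. *)
Lemma taylor_P (D : I -> C) (g : R -> R) (e B : R) : 0 < e <= 1 -> msb g ->
  (forall y, y <= e -> g y = Re (Vexp D y)) -> (forall y, `|g y| <= B) ->
  exists2 K, 0 <= K & forall r x, 0 < r <= 1 -> x <= 0 ->
  `|P (r ^+ N) g x - (Re (Vexp D x) + kapR * r ^+ N * Re (Vexp (fun j => D j * c j ^+ N) x))|
  <= K * r ^+ N.+1 * w1 x ^+ 2.
Proof.
move=> e01 mg gV gB; have [K K0 hK] := remainder e01 gV gB.
have [Cm Cm0 hC] := ker_abs_moment R N_even N_gt0 N.+1.
exists (K * Cm); first exact: mulr_ge0.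
move=> r x r01 x0; have /andP[r0 r1] := r01.
have s0 : 0 < r ^+ N by exact: exprn_gt0.
set s := r ^+ N in s0 *.
pose a i := Re (\sum_(j in A) D j * cexp (c j * x%:C) * (c j ^+ i / i`!%:R)).
have tE xi : Re (\sum_(j in A) D j * cexp (c j * x%:C) * texp N.+1 (c j * xi%:C)) =
    \sum_(i < N.+1) a i * xi ^+ i.
  transitivity (\sum_(i < N.+1) Re (\sum_(j in A) (xi ^+ i)%:C * (D j * cexp (c j * x%:C) * (c j ^+ i / i`!%:R)))).
    rewrite -Re_sum exchange_big /=; congr Re; apply: eq_bigr => j _.
    rewrite /texp mulr_sumr; apply: eq_bigr => i _.
    by rewrite exprMn rmorphXn/=; ring.
  by apply: eq_bigr => i _; rewrite -mulr_sumr ReCM mulrC.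
have i1 := P_itg_bnd N_even N_gt0 x s0 mg gB.
have [i2 e2] := Int_affine x ltr01 i1.
have E2 : (fun xi => ker s (x - (1 * xi + x)) * g (1 * xi + x)) = (fun xi => ker s xi * g (x + xi)).
  by apply/funext => xi; rewrite mul1r opprD addrCA subrr addr0 ker_even addrC.
move: i2 e2; rewrite E2 invr1 mul1r => i2 e2.
have im i : itg (fun xi => a i * (xi ^+ i * ker s xi)) by apply: itgZ; exact: ker_pow_itg.
have [i3 e3] := Int_sum (fun i : 'I_N.+1 => im i).
have -> : Re (Vexp D x) + kapR * s * Re (Vexp (fun j => D j * c j ^+ N) x) =
    Int (fun xi => \sum_(i < N.+1) a i * (xi ^+ i * ker s xi)).
  have eI i : (i < N.+1)%N -> Int (fun xi => a i * (xi ^+ i * ker s xi)) =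
      a i * (if i == 0%N then 1 else if i == N then - (-1) ^+ N./2 * s * N`!%:R else 0).
    by move=> iN; rewrite IntZ ?ker_moment//; exact: ker_pow_itg.
  rewrite e3 (bigD1 ord0)//= (bigD1 (@ord_max N))/=; last by rewrite -val_eqE /= -lt0n.
  rewrite big1 ?addr0; last first.
    move=> i /andP[]; rewrite -!val_eqE /= => i0 iN.
    by rewrite eI// (negbTE i0) (negbTE iN) mulr0.
  rewrite !eI// eqxx (gtn_eqF N_gt0) mulr1; congr (_ + _).
    rewrite /a; congr Re; apply: eq_bigr => j _.
    by rewrite expr0 fact0 divr1 mulr1.
  have -> : a N = (N`!%:R)^-1 * Re (Vexp (fun j => D j * c j ^+ N) x).
    rewrite -ReCM /a /Vexp mulr_sumr; congr Re; apply: eq_bigr => j _.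
    by rewrite fmorphV rmorph_nat; ring.
  have f0 : (N`!%:R : R) != 0 by rewrite pnatr_eq0 -lt0n fact_gt0.
  by rewrite eqxx /kapR; field.
rewrite /P -e2 -IntB//.
have hb xi : `|ker s xi * g (x + xi) - \sum_(i < N.+1) a i * (xi ^+ i * ker s xi)| <=
    (K * w1 x ^+ 2) * (`|xi| ^+ N.+1 * (1 + xi ^+ 2) ^+ 2 * `|ker s xi|).
  have -> : \sum_(i < N.+1) a i * (xi ^+ i * ker s xi) = ker s xi * \sum_(i < N.+1) a i * xi ^+ i.
    by rewrite mulr_sumr; apply: eq_bigr => i _; ring.
  rewrite -mulrBr -tE normrM mulrC mulrA ler_wpM2r//; exact: hK.
have i4 : itg (fun xi => `|xi| ^+ N.+1 * (1 + xi ^+ 2) ^+ 2 * `|ker s xi|).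
  exact: ker_abs_itg.
apply: le_trans (abs_Int_le _ (itgZ _ i4) hb) _; first by apply: itg_msb; exact: itgB.
rewrite IntZ//; apply: le_trans (ler_wpM2l _ (hC r r01)) _; first by rewrite mulr_ge0// exprn_ge0// w1_ge0.
by rewrite le_eqVlt; apply/orP; left; apply/eqP; ring.
Qed.

End taylor.
End exponential_sums.

(** * The limit function and its shift *)

Section piecewise.
Variable R : realType.
Implicit Types f g : R -> R.

Lemma pw_cont f g (a : R) : continuous f -> continuous g -> f a = g a ->
  continuous (fun x => if x <= a then f x else g x).
Proof.
move=> cf cg fg.
have -> : (fun x => if x <= a then f x else g x) = (fun x => f (Num.min x a) + g (Num.max x a) - f a).
  apply/funext => x; case: ifPn => [xa|]; first by rewrite min_l// max_r// -fg addrK.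
  by rewrite -ltNge => /ltW ax; rewrite min_r// max_l// addrAC subrr add0r.
move=> x; apply: cvgB; last exact: cvg_cst.
apply: cvgD.
  apply: (@continuous_comp _ _ _ (fun x => Num.min x a) f); last exact: cf.
  exact: (continuous_min (@cvg_id _ _) (@cvg_cst _ _ _ _ _)).
apply: (@continuous_comp _ _ _ (fun x => Num.max x a) g); last exact: cg.
exact: (continuous_max (@cvg_id _ _) (@cvg_cst _ _ _ _ _)).
Qed.

Definition pw (e : R) f g (x : R) := if x <= 0 then f x else if x <= e then g x else 0.

Section ibp.
Variables (e : R) (f f' g g' : R -> R).
Hypothesis e0 : 0 < e.
Hypothesis ff' : forall x : R, is_derive x (1 : R) f (f' x).
Hypothesis gg' : forall x : R, is_derive x (1 : R) g (g' x).
Hypothesis cf' : continuous f'.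
Hypothesis cg' : continuous g'.
Hypothesis dD : dec (pw e f g).
Hypothesis dD' : dec (pw e f' g').
Hypothesis fg0 : f 0 = g 0.
Hypothesis ge : g e = 0.

(** Integration by parts on each piece: the boundary terms cancel because the pieces agree at 0 and
    the second vanishes at e. The derivative itself may jump at both points. *)
Let pw_ibp (k k' : R -> R) (M : R) : (forall x : R, is_derive x (1 : R) k (k' x)) -> continuous k' ->
  (forall x, `|k x| <= 1) -> (forall x, `|k' x| <= M) ->
  Int (fun x => pw e f' g' x * k x) = - Int (fun x => pw e f g x * k' x).
Proof.
move=> kk' ck' k1 k'M.
have dc (h h' : R -> R) : (forall x : R, is_derive x (1 : R) h (h' x)) -> continuous h.
  by move=> hh' x; apply: differentiable_continuous; apply/derivable1_diffP.
have [cf [cg ck]] := (dc _ _ ff', (dc _ _ gg', dc _ _ kk')).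
have i1 : itg (fun x => pw e f' g' x * k x) by apply: (itgM (dec_itg dD') (msb_cont ck) k1).
have i2 : itg (fun x => pw e f g x * k' x) by apply: (itgM (dec_itg dD) (msb_cont ck') k'M).
apply/eqP; rewrite -addr_eq0 -IntD//; apply/eqP.
have ih := itgD i1 i2.
pose hl x := if x <= 0 then f' x * k x + f x * k' x else 0.
pose hm x := if (0 <= x) && (x <= e) then g' x * k x + g x * k' x else 0.
have chl : continuous (fun x => f' x * k x + f x * k' x).
  by move=> x; apply: cvgD; apply: cvgM; [exact: cf'|exact: ck|exact: cf|exact: ck'].
have ihl : itg hl.
  apply: (itg_le _ (itg_abs ih)); first by apply: msb_if; [exact: mle|exact: msb_cont|exact: msb_cst].
  by move=> x; rewrite /hl /pw; case: ifP => // _; rewrite normr0.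
have [ihm ehm] : itg hm /\ Int hm = (fun x => k x * g x) e - (fun x => k x * g x) 0.
  have ch : continuous (fun x => g' x * k x + g x * k' x).
    by move=> x; apply: cvgD; apply: cvgM; [exact: cg'|exact: ck|exact: cg|exact: ck'].
  have dh (x : R) : is_derive x (1 : R) (fun x => k x * g x) (g' x * k x + g x * k' x).
    by apply: (is_derive_eq (is_deriveM (kk' x) (gg' x))); rewrite /GRing.scale /=; ring.
  exact: (ftc_itv (ltW e0) ch dh).
have ehl : Int hl = (fun x => k x * f x) 0.
  have dh (x : R) : is_derive x (1 : R) (fun x => k x * f x) (f' x * k x + f x * k' x).
    by apply: (is_derive_eq (is_deriveM (kk' x) (ff' x))); rewrite /GRing.scale /=; ring.
  apply: (ftc_left chl dh ihl).
  have [_] := dec_cvg0 (decM dD (msb_cont ck) k1).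
  rewrite (_ : (fun n => _) = (fun n : nat => k (- n%:R) * f (- n%:R)))//.
  by apply/funext => n; rewrite /pw oppr_le0 ler0n.
have [|_ ->] := Int_ae1 (f := fun x => pw e f' g' x * k x + pw e f g x * k' x) (a := 0) (itgD ihl ihm).
  move=> x x0; rewrite /hl /hm /pw; case: (ltgtP x 0) x0 => // [xl|xl] _ /=; rewrite ?addr0 ?add0r//.
  by case: ifP => // _; rewrite !mul0r addr0.
by rewrite IntD// ehl ehm /= ge fg0; ring.
Qed.

Lemma pw_fsq u : u ^+ 2 * fsq (pw e f g) u = fsq (pw e f' g') u.
Proof.
have dl (x : R) : is_derive x (1 : R) (fun x => u * x) u.
  by apply: is_derive_eq; rewrite /GRing.scale /= mulr1.
have dcos (x : R) : is_derive x (1 : R) (fun x => cos (u * x)) (- (u * sin (u * x))).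
  by apply: (is_derive_eq (is_derive1_comp (is_derive_cos _) (dl x))); ring.
have dsin (x : R) : is_derive x (1 : R) (fun x => sin (u * x)) (u * cos (u * x)).
  by apply: (is_derive_eq (is_derive1_comp (is_derive_sin _) (dl x))); ring.
have csin : continuous (fun x : R => sin (u * x)).
  by move=> x; apply: differentiable_continuous; apply/derivable1_diffP.
have ccos : continuous (fun x : R => cos (u * x)).
  by move=> x; apply: differentiable_continuous; apply/derivable1_diffP.
have [i1 i2] := (itg_cos u (dec_itg dD), itg_sin u (dec_itg dD)).
have -> : fsq (pw e f' g') u = (u * fsin (pw e f g) u) ^+ 2 + (- (u * fcos (pw e f g) u)) ^+ 2.
  rewrite /fsq; congr (_ ^+ 2 + _ ^+ 2).
    rewrite /fcos (pw_ibp dcos (M := `|u|)).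
    - rewrite /fsin -IntZ// -IntN; first by apply: eq_Int => x; ring.
      by under eq_fun do rewrite mulrN mulrCA; apply: itgN; exact: itgZ.
    - by move=> x; apply: cvgN; apply: cvgM; [exact: cvg_cst|exact: csin].
    - by move=> x; exact: cos_max.
    - by move=> x; rewrite normrN normrM ler_piMr// sin_max.
  rewrite /fsin (pw_ibp dsin (M := `|u|)).
  - by rewrite /fcos -IntZ//; congr (- _); apply: eq_Int => x; ring.
  - by move=> x; apply: cvgM; [exact: cvg_cst|exact: ccos].
  - by move=> x; exact: sin_max.
  - by move=> x; rewrite normrM ler_piMr// cos_max.
by rewrite /fsq; ring.
Qed.

End ibp.
End piecewise.

(** * The difference between the limit function and its shift *)

Section comparison.
Variables (R : realType) (N : nat) (I : finType) (A : {set I}) (c : I -> R[i]) (mu : R).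
Hypothesis N_even : ~~ odd N.
Hypothesis N_gt2 : (2 < N)%N.
Hypothesis c_gt0 : forall j, j \in A -> 0 < Re (c j).
Hypothesis c_inj : {in A &, injective c}.
Hypothesis A_card : (N./2 <= #|A|)%N.
Local Notation C := R[i].

Let N_gt0 : (0 < N)%N. Proof. exact: ltn_trans N_gt2. Qed.
Let h_gt0 : (0 < N./2)%N.
Proof. by rewrite half_gt0 ltnW. Qed.

Definition nu : C := 'i%C * mu%:C.
Definition L (j : I) : C := lag A c nu j.
Definition vlim (x : R) : C := if x <= 0 then Vexp A c L x else cexp (nu * x%:C).
(* [veps e x = exp (nu e) vlim (x - e)]: the corner of [vlim] at 0 is moved to [e]. *)
Definition Esh (e : R) (j : I) : C := cexp ((nu - c j) * e%:C) * L j.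
Definition veps (e x : R) : C := if x <= e then Vexp A c (Esh e) x else cexp (nu * x%:C).

(* [dd e i] is the [i]-th derivative of [vlim - veps e]; it is continuous for
   [i < N / 2] because the Lagrange weights match these derivatives at 0. *)
Definition dL e i (x : R) : C := Vexp A c (fun j => (L j - Esh e j) * c j ^+ i) x.
Definition dM e i (x : R) : C := nu ^+ i * cexp (nu * x%:C) - Vexp A c (fun j => Esh e j * c j ^+ i) x.
Definition dd e i (x : R) : C := if x <= 0 then dL e i x else if x <= e then dM e i x else 0.

Lemma dd0 e x : 0 < e -> dd e 0 x = vlim x - veps e x.
Proof.
move=> e0; have VE D : Vexp A c (fun j => D j * c j ^+ 0) x = Vexp A c D x.
  by apply: eq_bigr => j _; rewrite expr0 mulr1.
rewrite /dd /vlim /veps /dL /dM expr0 mul1r !VE.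
case: ifPn => x0; first rewrite (le_trans x0 (ltW e0)).
  by rewrite /Vexp -sumrB; apply: eq_bigr => j _; rewrite mulrBl.
by case: ifP => // _; rewrite subrr.
Qed.

Let Re_nu (x : R) : Re (nu * x%:C) = 0.
Proof. by rewrite /nu -mulrA !ReM !ImM /=; ring. Qed.

Let cmod_enu (x : R) : cmod (cexp (nu * x%:C)) = 1.
Proof. by rewrite cmod_cexp Re_nu expR0. Qed.

(** Up to a factor of modulus 1 the shifted exponential is L_j exp (c_j (x - e)), so the bound does
    not depend on e. *)
Let cmod_Esh e x j : j \in A -> x <= e -> cmod (Esh e j) * cmod (cexp (c j * x%:C)) <= cmod (L j).
Proof.
move=> jA xe; rewrite /Esh cmodM mulrAC mulrBl cexpD cmodM cmod_enu mul1r.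
rewrite !cmod_cexp -expRD ler_piMl ?cmod_ge0// expR_le1 ReN ![c j * _]mulrC !ReCM -mulNr -mulrDl.
by rewrite mulr_le0_ge0 ?(ltW (c_gt0 jA))//; lra.
Qed.

Lemma cmod_Esh_sum e i x : x <= e ->
  cmod (Vexp A c (fun j => Esh e j * c j ^+ i) x) <= \sum_(j in A) cmod (L j) * cmod (c j) ^+ i.
Proof.
move=> xe; apply: le_trans (cmod_sum _ _ _) _; apply: ler_sum => j jA.
rewrite (cmodM (Esh e j * c j ^+ i)) (cmodM (Esh e j)) cmodX mulrAC.
by rewrite ler_wpM2r ?exprn_ge0 ?cmod_ge0// cmod_Esh.
Qed.

(** To the left of 0 the coefficients differ by O(e); on the interval of length e the bound is
    constant. Either way the contribution to the squared L^2 norm is O(e). *)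
Lemma dd_bound i : exists2 K, 0 <= K & forall e x, 0 < e <= 1 ->
  cmod (dd e i x) <= K * (if x <= 0 then e * w1 x ^+ 2 else if x <= e then 1 else 0).
Proof.
have h j : exists K, 0 <= K /\ (j \in A -> forall x : R, x <= 0 -> cmod (cexp (c j * x%:C)) <= K * w1 x ^+ 2).
  have [jA|jA] := boolP (j \in A); last by exists 0.
  by have [K K0 hK] := cexp_dec (c_gt0 jA); exists K.
have [k hk] := choice h.
pose K1 := \sum_(j in A) cmod (L j) * (2 * cmod (nu - c j)) * cmod (c j) ^+ i * k j.
pose K2 := cmod nu ^+ i + \sum_(j in A) cmod (L j) * cmod (c j) ^+ i.
have K10 : 0 <= K1.
  by apply: sumr_ge0 => j _; rewrite !mulr_ge0 ?exprn_ge0 ?cmod_ge0//; have [] := hk j.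
have K20 : 0 <= K2.
  by rewrite addr_ge0 ?exprn_ge0 ?cmod_ge0//; apply: sumr_ge0 => j _; rewrite mulr_ge0 ?exprn_ge0 ?cmod_ge0.
exists (K1 + K2) => [|e x /andP[e0 e1]]; first exact: addr_ge0.
rewrite /dd; case: ifPn => x0; last first.
  case: ifPn => xe; last by rewrite cmod0 mulr0.
  rewrite mulr1; apply: le_trans (_ : K2 <= _); last by rewrite lerDr.
  apply: le_trans (cmodD _ _) _; rewrite cmodN cmodM cmodX cmod_enu mulr1.
  by rewrite lerD2l; exact: cmod_Esh_sum.
apply: (@le_trans _ _ (K1 * (e * w1 x ^+ 2))); last first.
  by rewrite ler_wpM2r ?lerDl// mulr_ge0 ?exprn_ge0 ?w1_ge0// ltW.
rewrite /dL; apply: le_trans (cmod_sum _ _ _) _; rewrite /K1 mulr_suml; apply: ler_sum => j jA.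
have [kj0 /(_ jA _ x0) hkj] := hk j.
rewrite (cmodM ((L j - Esh e j) * c j ^+ i)) (cmodM (L j - Esh e j)) cmodX.
have hE : cmod (L j - Esh e j) <= cmod (L j) * (2 * cmod (nu - c j)) * e.
  have -> : L j - Esh e j = - (L j * (cexp ((nu - c j) * e%:C) - texp 1 ((nu - c j) * e%:C))).
    by rewrite /Esh /texp big_ord1 expr0 fact0 divr1; ring.
  rewrite cmodN cmodM -!mulrA ler_wpM2l ?cmod_ge0//.
  apply: le_trans (cexp_taylor _ _) _; rewrite !expr1 cmodM cmodR (gtr0_norm e0).
  have -> : Num.max (Re ((nu - c j) * e%:C)) 0 = 0.
    apply: max_r; rewrite mulrBl ReB Re_nu sub0r mulrC ReCM oppr_le0 mulr_ge0 ?(ltW e0)//.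
    by rewrite ltW// c_gt0.
  by rewrite expR0 mulr1.
apply: (@le_trans _ _ (cmod (L j) * (2 * cmod (nu - c j)) * e * cmod (c j) ^+ i * (k j * w1 x ^+ 2))).
  apply: ler_pM => //; [by rewrite mulr_ge0 ?exprn_ge0 ?cmod_ge0|exact: cmod_ge0|].
  by rewrite ler_wpM2r ?exprn_ge0 ?cmod_ge0.
by rewrite le_eqVlt; apply/orP; left; apply/eqP; ring.
Qed.

Let dL_der e i : cder (dL e i) (dL e i.+1).
Proof.
apply: cder_ext (Vexp_der A c _) _ => x; apply: eq_bigr => j _; rewrite exprSr; ring.
Qed.

Let dM_der e i : cder (dM e i) (dM e i.+1).
Proof.
have -> : dM e i = (fun x => nu ^+ i * cexp (nu * x%:C) + (-1) * Vexp A c (fun j => Esh e j * c j ^+ i) x).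
  by apply/funext => x; rewrite mulN1r.
apply: cder_ext (cderD (cderZ _ (cder_cexp nu)) (cderZ (-1) (Vexp_der A c _))) _ => x.
rewrite /dM mulN1r exprSr; congr (_ - _); first by ring.
by apply: eq_bigr => j _; rewrite exprSr; ring.
Qed.

(** [veps] is smooth at 0, and the jump there of the i-th derivative of [vlim] is nu^i minus the sum
    of the L_j c_j^i, which [lagrange_pow] makes 0 since there are at least N/2 nodes. *)
Let dL_dM0 e i : (i < N./2)%N -> dL e i 0 = dM e i 0.
Proof.
move=> iN; have V0 D : Vexp A c D 0 = \sum_(j in A) D j.
  by apply: eq_bigr => j _; rewrite mulr0 cexp0 mulr1.
rewrite /dL /dM !V0 mulr0 cexp0 mulr1 -(@lagrange_pow _ _ A c nu c_inj i) ?(leq_trans iN)//.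
by rewrite -sumrB; apply: eq_bigr => j _; rewrite mulrBl.
Qed.

(** The same interpolation identity at the shifted corner, multiplied by exp (nu e). *)
Let dMe e i : (i < N./2)%N -> dM e i e = 0.
Proof.
move=> iN; rewrite /dM -(@lagrange_pow _ _ A c nu c_inj i) ?(leq_trans iN)//.
apply/eqP; rewrite subr_eq0 mulr_suml; apply/eqP; apply: eq_bigr => j _.
rewrite /Esh mulrBl cexpD cexpNV -/(L j).
by have := cexp_neq0 (c j * e%:C); move=> ?; field.
Qed.

Section component.
Variable om : C.
Hypothesis om1 : cmod om <= 1.

(** [om] will be 1 or - i, which selects the real or the imaginary part and brings the real-valued
    results to bear. *)
Let pw_dd e i : (fun x => Re (om * dd e i x)) =
  pw e (fun x => Re (om * dL e i x)) (fun x => Re (om * dM e i x)).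
Proof.
by apply/funext => x; rewrite /dd /pw; case: ifP => // _; case: ifP => // _; rewrite mulr0.
Qed.

Let comp_le z : `|Re (om * z)| <= cmod z.
Proof. by apply: le_trans (Re_cmod _) _; rewrite cmodM ler_piMl ?cmod_ge0. Qed.

Let comp_der F G : cder F G -> forall x : R, is_derive x (1 : R) (fun t => Re (om * F t)) (Re (om * G x)).
Proof. by move=> h x; have [] := cderZ om h x. Qed.

Let comp_cont F G : cder F G -> continuous (fun t => Re (om * F t)).
Proof. by move=> h; have [] := cder_cont (cderZ om h). Qed.

Lemma dd_dec e i : 0 < e <= 1 -> dec (fun x => Re (om * dd e i x)).
Proof.
move=> e01; have /andP[e0 e1] := e01; split.
  rewrite pw_dd; apply: msb_if; [exact: mle|by apply: msb_cont; exact: (comp_cont (dL_der e i))|].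
  by apply: msb_if; [exact: mle|by apply: msb_cont; exact: (comp_cont (dM_der e i))|exact: msb_cst].
have [K K0 hK] := dd_bound i; exists (4 * K) => x.
apply: le_trans (comp_le _) _; apply: le_trans (hK _ _ e01) _.
rewrite [4 * K]mulrC -mulrA ler_wpM2l//.
have w0 : 0 <= w1 x ^+ 2 by rewrite exprn_ge0 ?w1_ge0.
case: ifPn => x0; first by rewrite ler_wpM2r//; lra.
case: ifPn => xe; last by rewrite mulr_ge0.
rewrite -ltNge in x0; rewrite (_ : 4 = 2 ^+ 2 :> R); last by ring.
rewrite -exprMn exprn_ege1// ler_pdivlMr ?mul1r; last by rewrite ltr_pwDl// sqr_ge0.
have : x ^+ 2 <= 1 by rewrite exprn_ile1 ?(ltW x0)// (le_trans xe).
lra.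
Qed.

Lemma dd_nrm i : exists2 K, 0 <= K & forall e, 0 < e <= 1 -> nrm (fun x => Re (om * dd e i x)) <= K * e.
Proof.
(* pi is the integral of [w1], used on the left; the 1 accounts for the interval of length e. *)
have [K K0 hK] := dd_bound i; exists (K ^+ 2 * (pi + 1)).
  by rewrite mulr_ge0 ?sqr_ge0// addr_ge0 ?pi_ge0.
move=> e e01; have /andP[e0 e1] := e01; have df := dd_dec i e01.
have [i1 e1'] := @ftc_itv R (fun=> 1) (fun x => x) 0 e (ltW e0) (fun x => cvg_cst _) (fun x => is_derive_id x 1).
have i2 := itgZ e (@w1_itg R).
apply: (@le_trans _ _ (Int (fun x => K ^+ 2 * (e * w1 x + (if (0 <= x) && (x <= e) then 1 else 0))))).
  apply: le_Int; [exact: dec_sq_itg|by apply: itgZ; exact: itgD|] => x.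
  rewrite -real_normK ?num_real//.
  apply: (@le_trans _ _ ((K * (if x <= 0 then e * w1 x ^+ 2 else if x <= e then 1 else 0)) ^+ 2)).
    rewrite lerXn2r ?nnegrE//; last exact: le_trans (comp_le _) (hK _ _ e01).
    rewrite mulr_ge0//; case: ifP => _; first by rewrite mulr_ge0 ?(ltW e0) ?exprn_ge0 ?w1_ge0.
    by case: ifP.
  rewrite exprMn ler_wpM2l ?sqr_ge0//.
  have ew : 0 <= e * w1 x by rewrite mulr_ge0 ?w1_ge0// ltW.
  case: ifPn => x0.
    apply: (@le_trans _ _ (e * w1 x)); last by rewrite lerDl; case: ifP.
    have h1 : e * w1 x <= 1 by rewrite -[leRHS]mulr1 ler_pM ?w1_ge0 ?w1_le1// ltW.
    have h2 : e * w1 x ^+ 2 <= e * w1 x.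
      by rewrite expr2 mulrA ler_piMr// w1_le1.
    have h3 : 0 <= e * w1 x ^+ 2 by rewrite mulr_ge0 ?exprn_ge0 ?w1_ge0// ltW.
    rewrite expr2; apply: le_trans (ler_pM h3 h3 h2 (le_trans h2 h1)) _.
    by rewrite mulr1.
  rewrite -ltNge in x0; rewrite (ltW x0) /=.
  by case: ifP => _; rewrite ?expr1n ?expr0n ?lerDr ?addr0.
rewrite IntZ; last exact: itgD.
rewrite IntD// IntZ; last exact: w1_itg.
by rewrite Int_w1 e1'; lra.
Qed.

Lemma dd_fsq e i u : 0 < e <= 1 -> (i < N./2)%N ->
  u ^+ 2 * fsq (fun x => Re (om * dd e i x)) u = fsq (fun x => Re (om * dd e i.+1 x)) u.
Proof.
move=> e01 iN; have /andP[e0 _] := e01; have d1 := dd_dec i e01; have d2 := dd_dec i.+1 e01.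
rewrite !pw_dd in d1 d2 *; apply: pw_fsq => //.
- exact: comp_der (dL_der e i).
- exact: comp_der (dM_der e i).
- exact: comp_cont (dL_der e i.+1).
- exact: comp_cont (dM_der e i.+1).
- by rewrite dL_dM0.
- by rewrite dMe// mulr0.
Qed.

(** After N/2 uses of [dd_fsq], u^N times the spectrum is that of the derivative of order N/2, which
    may be discontinuous but has squared norm O(e). Then [en_smooth] gives a bound that depends on s
    through the factor s alone. *)
Lemma dd_energy : exists2 K, 0 <= K & forall e s, 0 < e <= 1 -> 0 < s ->
  nrm (fun x => Re (om * dd e 0 x)) <= K * e /\ en N s (fun x => Re (om * dd e 0 x)) <= s * (K * e).
Proof.
have [K0 K00 hK0] := dd_nrm 0; have [K1 K10 hK1] := dd_nrm N./2.
exists (K0 + K1) => [|e s e01 s0]; first exact: addr_ge0.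
have /andP[e0 _] := e01.
split; first by apply: le_trans (hK0 _ e01) _; rewrite ler_wpM2r ?lerDl// ltW.
have pow m u : (m <= N./2)%N -> u ^+ m.*2 * fsq (fun x => Re (om * dd e 0 x)) u = fsq (fun x => Re (om * dd e m x)) u.
  elim: m => [|m IH] mN; first by rewrite mul1r.
  rewrite doubleS !exprS mulrA -expr2 -mulrA IH ?(ltnW mN)// dd_fsq//.
have {}pow u : u ^+ N * fsq (fun x => Re (om * dd e 0 x)) u = fsq (fun x => Re (om * dd e N./2 x)) u.
  by rewrite -(pow N./2)// even_halfK.
have dh := dd_dec N./2 e01; have [ih Bh] := Bessel dh.
have d0 := dd_dec 0 e01.
have c0 : continuous (fun x => Re (om * dd e 0 x)).
  rewrite pw_dd; apply: pw_cont; [exact: comp_cont (dL_der e 0)| |].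
    apply: pw_cont; [exact: comp_cont (dM_der e 0)|by move=> x; exact: cvg_cst|].
    by rewrite dMe// mulr0.
  by rewrite (ltW e0) dL_dM0.
apply: le_trans (en_smooth N_even N_gt0 s0 d0 c0 _) _.
  by rewrite (_ : (fun u => _) = fsq (fun x => Re (om * dd e N./2 x)))//; exact/funext.
rewrite (eq_Int pow) mulrAC mulrC ler_wpM2l ?(ltW s0)//.
apply: (@le_trans _ _ (nrm (fun x => Re (om * dd e N./2 x)))).
  by rewrite /npi mulrC ler_pdivrMr ?mulr_gt0 ?pi_gt0// mulrC.
by apply: le_trans (hK1 _ e01) _; rewrite ler_wpM2r ?lerDr// ltW.
Qed.

End component.
End comparison.

(** * Convolution of complex-valued functions, by components *)

Section complex_operator.
Variables (R : realType) (N : nat).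
Hypothesis N_even : ~~ odd N.
Hypothesis N_gt0 : (0 < N)%N.
Local Notation C := R[i].
Implicit Types (F G : R -> C) (s : R).

Definition cdec F := dec (fun x => Re (F x)) /\ dec (fun x => Im (F x)).
(** The wave exp (i mu x) does not decay, so convolution has to act on bounded functions as well. *)
Definition cbd F := [/\ msb (fun x => Re (F x)), msb (fun x => Im (F x)) & exists B, forall x, cmod (F x) <= B].

Definition Pc s F (x : R) : C := P N s (fun y => Re (F y)) x +i* P N s (fun y => Im (F y)) x.

Lemma cdec_cbd F : cdec F -> cbd F.
Proof.
move=> [d1 d2]; have [B1 _ h1] := dec_bnd d1; have [B2 _ h2] := dec_bnd d2.
split; [by case: d1|by case: d2|exists (B1 + B2) => x].
by apply: le_trans (cmod_le _) _; apply: lerD.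
Qed.

Lemma cdecD F G : cdec F -> cdec G -> cdec (fun x => F x + G x).
Proof.
move=> [d1 d2] [d3 d4]; split.
  by under eq_fun do rewrite ReD; exact: decD.
by under eq_fun do rewrite ImD; exact: decD.
Qed.

Lemma cdecZ z F : cdec F -> cdec (fun x => z * F x).
Proof.
move=> [d1 d2]; split.
  by under eq_fun do rewrite ReM; apply: decB; exact: decZ.
by under eq_fun do rewrite ImM; apply: decD; exact: decZ.
Qed.

Lemma cdecB F G : cdec F -> cdec G -> cdec (fun x => F x - G x).
Proof.
move=> d1 d2; under eq_fun do rewrite -[- G _]mulN1r.
by apply: cdecD => //; exact: cdecZ.
Qed.

Lemma cdec0 : cdec (fun=> 0).
Proof. by split; exact: dec0. Qed.

Lemma cdec_cut F : cdec F -> cdec (fun x => if x <= 0 then F x else 0).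
Proof.
move=> [d1 d2]; split.
  have -> : (fun x : R => Re (if x <= 0 then F x else 0)) = (fun x => if x <= 0 then Re (F x) else 0).
    by apply/funext => x; case: ifP.
  by apply: dec_if => //; [exact: mle|exact: dec0].
have -> : (fun x : R => Im (if x <= 0 then F x else 0)) = (fun x => if x <= 0 then Im (F x) else 0).
  by apply/funext => x; case: ifP.
by apply: dec_if => //; [exact: mle|exact: dec0].
Qed.

Lemma cdec_sum n (F : 'I_n -> R -> C) : (forall i, cdec (F i)) -> cdec (fun x => \sum_(i < n) F i x).
Proof.
elim: n F => [|n IH] F h.
  have -> : (fun x => \sum_(i < 0) F i x) = (fun=> 0) by apply/funext => x; rewrite big_ord0.
  exact: cdec0.
have -> : (fun x => \sum_(i < n.+1) F i x) = (fun x => \sum_(i < n) F (widen_ord (leqnSn n) i) x + F ord_max x).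
  by apply/funext => x; rewrite big_ord_recr.
by apply: cdecD => //; exact: IH.
Qed.

Lemma Pc_cdec s F : 0 < s -> cdec F -> cdec (Pc s F).
Proof. by move=> s0 [d1 d2]; split; exact: P_dec. Qed.

Let cbd_itg s F x : 0 < s -> cbd F ->
  itg (fun y => ker N s (x - y) * Re (F y)) /\ itg (fun y => ker N s (x - y) * Im (F y)).
Proof.
move=> s0 [m1 m2 [B FB]]; split.
  exact: (P_itg_bnd N_even N_gt0 x s0 m1 (fun y => le_trans (Re_cmod _) (FB y))).
exact: (P_itg_bnd N_even N_gt0 x s0 m2 (fun y => le_trans (Im_cmod _) (FB y))).
Qed.

Lemma PcD s F G x : 0 < s -> cbd F -> cbd G -> Pc s (fun y => F y + G y) x = Pc s F x + Pc s G x.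
Proof.
move=> s0 bF bG; have [i1 i2] := cbd_itg x s0 bF; have [i3 i4] := cbd_itg x s0 bG.
apply: complex_ext; rewrite ?ReD ?ImD /= /P -IntD//; apply: eq_Int => y.
  by rewrite ReD mulrDr.
by rewrite ImD mulrDr.
Qed.

Lemma PcZ s z F x : 0 < s -> cbd F -> Pc s (fun y => z * F y) x = z * Pc s F x.
Proof.
move=> s0 bF; have [i1 i2] := cbd_itg x s0 bF.
apply: complex_ext.
  rewrite (ReM z) /= /P -!IntZ// -IntB; [|exact: itgZ..].
  by apply: eq_Int => y; rewrite (ReM z); ring.
rewrite (ImM z) /= /P -!IntZ// -IntD; [|exact: itgZ..].
by apply: eq_Int => y; rewrite (ImM z); ring.
Qed.

Lemma PcB s F G x : 0 < s -> cbd F -> cbd G -> Pc s (fun y => F y - G y) x = Pc s F x - Pc s G x.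
Proof.
move=> s0 bF [m1 m2 [B GB]].
have bG : cbd (fun y => (-1) * G y).
  split.
  - by under eq_fun do rewrite mulN1r ReN; exact: msbN.
  - by under eq_fun do rewrite mulN1r ImN; exact: msbN.
  - by exists B => x0; rewrite mulN1r cmodN.
have -> : (fun y => F y - G y) = (fun y => F y + (-1) * G y) by apply/funext => y; rewrite mulN1r.
by rewrite PcD// PcZ//; [rewrite mulN1r|split => //; exists B].
Qed.

Lemma Pc_sum s n (F : 'I_n -> R -> C) x : 0 < s -> (forall i, cdec (F i)) ->
  Pc s (fun y => \sum_(i < n) F i y) x = \sum_(i < n) Pc s (F i) x.
Proof.
move=> s0; elim: n F => [|n IH] F h.
  rewrite big_ord0 /Pc /P.
  by apply: complex_ext; rewrite /= -[RHS]Int0; apply: eq_Int => y; rewrite big_ord0 mulr0.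
have -> : (fun x => \sum_(i < n.+1) F i x) = (fun x => \sum_(i < n) F (widen_ord (leqnSn n) i) x + F ord_max x).
  by apply/funext => y; rewrite big_ord_recr.
rewrite PcD//; [by rewrite IH// big_ord_recr|apply: cdec_cbd; exact: cdec_sum|exact: cdec_cbd].
Qed.

(** For x <= 0 < y the distance |x - y| is at least |x| and at least |y|, so the decay of the kernel
    passes to x although F need not decay. *)
Lemma Pc_right_dec s F : 0 < s -> cbd F -> (forall x, x <= 0 -> F x = 0) ->
  cdec (fun x => if x <= 0 then Pc s F x else 0).
Proof.
move=> s0 [m1 m2 [B FB]] F0; have [mk hk] := ker_rapid N_even N_gt0 s0; have [K hK] := hk 3%N.
have B0 : 0 <= B by apply: le_trans (FB 0); exact: cmod_ge0.
have K0 : 0 <= K.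
  have := hK 0; rewrite /w1 expr0n addr0 invr1 expr1n mulr1; exact: le_trans.
have part (f : R -> R) : msb f -> (forall x, `|f x| <= B) -> (forall x, x <= 0 -> f x = 0) ->
    dec (fun x => if x <= 0 then P N s f x else 0).
  move=> mf fB f0.
  have wx (x y : R) : x <= 0 -> 0 < y -> w1 (x - y) <= w1 x /\ w1 (x - y) <= w1 y.
    move=> x0 y0; have p (t : R) : 0 < 1 + t ^+ 2 by rewrite ltr_pwDl// sqr_ge0.
    have xy : 0 <= - (x * y) by rewrite -mulNr mulr_ge0 ?oppr_ge0// ltW.
    by split; rewrite /w1 lef_pV2 ?posrE// lerD2l sqrrB; have := sqr_ge0 x; have := sqr_ge0 y; lra.
  have w0 (x : R) := w1_ge0 x.
  have kf (x y : R) : x <= 0 -> `|ker N s (x - y) * f y| <= K * B * w1 x ^+ 2 * w1 (x - y).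
    move=> x0; have [y0|y0] := leP y 0.
      by rewrite f0// mulr0 normr0 !mulr_ge0 ?exprn_ge0.
    have [h1 h2] := wx x y x0 y0.
    rewrite normrM; apply: le_trans (ler_pM (normr_ge0 _) (normr_ge0 _) (hK _) (fB _)) _.
    rewrite [leLHS](_ : _ = K * B * w1 (x - y) ^+ 2 * w1 (x - y)); last by ring.
    by rewrite ler_wpM2r// ler_wpM2l ?mulr_ge0// lerXn2r ?nnegrE.
  have E : (fun x => if x <= 0 then P N s f x else 0) =
      (fun x => Int (fun y => (if x <= 0 then 1 else 0) * (ker N s (x - y) * f y))).
    apply/funext => x; case: ifP => x0; first by apply: eq_Int => y; rewrite mul1r.
    by rewrite -[LHS]Int0; apply: eq_Int => y; rewrite mul0r.
  have iw (x : R) : itg (fun y => w1 (x - y)) /\ Int (fun y => w1 (x - y)) = pi.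
    have [i1 e1] := Int_affine (- x) (ltr01 : 0 < 1 :> R) (@w1_itg R).
    have E' : (fun y => w1 (x - y)) = (fun y => w1 (1 * y + - x)).
      by apply/funext => y; rewrite mul1r /w1 -sqrrN opprB.
    by rewrite E'; split => //; rewrite e1 invr1 mul1r Int_w1.
  split.
    rewrite E; apply: (itg_msb (f := fun x => _)).
    apply: (@itg_Fubini1 R (fun z => (if z.1 <= 0 then 1 else 0) * (ker N s (z.1 - z.2) * f z.2))
      (fun x => K * B * w1 x) (@w1 R)).
    - apply: measurable_funM.
        apply: (msb2_comp (f := fun x => if x <= 0 then 1 else 0)); last exact: measurable_fst.
        by apply: msb_if; [exact: mle|exact: msb_cst|exact: msb_cst].
      apply: measurable_funM; last by apply: (msb2_comp mf); exact: measurable_snd.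
      by apply: (msb2_comp mk); apply: measurable_funB.
    - by apply: itgZ; exact: w1_itg.
    - exact: w1_itg.
    - move=> x y /=; case: ifPn => x0; last by rewrite mul0r normr0 !mulr_ge0.
      rewrite mul1r; have [y0|y0] := leP y 0; first by rewrite f0// mulr0 normr0 !mulr_ge0.
      have [h1 h2] := wx x y x0 y0.
      rewrite normrM; apply: le_trans (ler_pM (normr_ge0 _) (normr_ge0 _) (hK _) (fB _)) _.
      rewrite [leLHS](_ : _ = K * B * (w1 (x - y) * 1 * w1 (x - y) ^+ 2)); last by ring.
      rewrite -[leRHS]mulrA ler_wpM2l ?mulr_ge0// mulr1.
      rewrite ler_pM ?exprn_ge0//; apply: le_trans h2.
      by rewrite expr2 ler_piMl// w1_le1.
  exists (K * B * pi) => x; case: ifP => x0; last by rewrite normr0 !mulr_ge0 ?exprn_ge0 ?pi_ge0.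
  have [i1 e1] := iw x.
  apply: le_trans (abs_Int_le _ (itgZ _ i1) (fun y => kf x y x0)) _.
    by apply: itg_msb; exact: (P_itg_bnd N_even N_gt0 x s0 mf fB).
  by rewrite IntZ// e1 mulrAC.
split.
  rewrite (_ : (fun x => _) = (fun x => if x <= 0 then P N s (fun y => Re (F y)) x else 0)); last first.
    by apply/funext => x; case: ifP.
  by apply: part => // x; [exact: le_trans (Re_cmod _) (FB x)|move=> x0; rewrite F0].
rewrite (_ : (fun x => _) = (fun x => if x <= 0 then P N s (fun y => Im (F y)) x else 0)); last first.
  by apply/funext => x; case: ifP.
by apply: part => // x; [exact: le_trans (Im_cmod _) (FB x)|move=> x0; rewrite F0].
Qed.

End complex_operator.

(** * The residual of the shifted function *)

Section residual.
Variables (R : realType) (N : nat) (I : finType) (A : {set I}) (c : I -> R[i]) (mu : R).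
Hypothesis N_even : ~~ odd N.
Hypothesis N_gt0 : (0 < N)%N.
Hypothesis c_gt0 : forall j, j \in A -> 0 < Re (c j).
Local Notation C := R[i].
Variable lam : C.
Hypothesis lam_gt0 : 0 < Re lam.
Hypothesis c_root : forall j, j \in A -> (kapR R N)%:C * c j ^+ N = lam.
Local Notation veps := (veps A c mu).
Local Notation vlim := (vlim A c mu).
Local Notation Esh := (Esh A c mu).

Lemma veps_cbd e : cbd (veps e).
Proof.
have [cR cI] := cder_cont (Vexp_der A c (Esh e)); have [cR' cI'] := cder_cont (cder_cexp (nu mu)).
split.
- rewrite (_ : (fun x => _) = (fun x => if x <= e then Re (Vexp A c (Esh e) x) else Re (cexp (nu mu * x%:C)))); last first.
    by apply/funext => x; rewrite /veps; case: ifP.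
  by apply: msb_if; [exact: mle|exact: msb_cont|exact: msb_cont].
- rewrite (_ : (fun x => _) = (fun x => if x <= e then Im (Vexp A c (Esh e) x) else Im (cexp (nu mu * x%:C)))); last first.
    by apply/funext => x; rewrite /veps; case: ifP.
  by apply: msb_if; [exact: mle|exact: msb_cont|exact: msb_cont].
exists (\sum_(j in A) cmod (L A c mu j) * cmod (c j) ^+ 0 + 1) => x; rewrite /veps; case: ifP => xe.
  apply: le_trans (_ : _ <= cmod (Vexp A c (fun j => Esh e j * c j ^+ 0) x)) _.
    by rewrite le_eqVlt; apply/orP; left; apply/eqP; congr cmod; apply: eq_bigr => j _; rewrite expr0 mulr1.
  by apply: le_trans (cmod_Esh_sum mu c_gt0 0 xe) _; rewrite lerDl.
rewrite cmod_cexp /nu (_ : Re _ = 0) ?expR0; last by rewrite -mulrA !ReM !ImM /=; ring.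
by rewrite lerDr; apply: sumr_ge0 => j _; rewrite mulr_ge0 ?exprn_ge0 ?cmod_ge0.
Qed.

Definition zz (s : R) : C := cexp (- lam * s%:C).

Lemma cmod_zz s : cmod (zz s) = expR (- (Re lam * s)).
Proof. by rewrite /zz cmod_cexp mulrC ReCM ReN mulrN mulrC. Qed.

Lemma zz_taylor1 s : 0 <= s -> cmod (1 - zz s) <= 2 * cmod lam * s.
Proof.
move=> s0; rewrite -[1 - _]opprB cmodN (_ : 1 = texp 1 (- lam * s%:C)); last first.
  by rewrite /texp big_ord1 expr0 fact0 divr1.
apply: le_trans (cexp_taylor _ _) _; rewrite !expr1 cmodM cmodN cmodR (ger0_norm s0).
rewrite max_r ?expR0 ?mulr1 ?mulrA// mulrC ReCM ReN mulrN oppr_le0 mulr_ge0// ltW//.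
Qed.

Lemma zz_taylor2 s : 0 <= s -> cmod (1 - zz s * (1 + lam * s%:C)) <= 4 * cmod lam ^+ 2 * s ^+ 2.
Proof.
move=> s0; have E : 1 - zz s * (1 + lam * s%:C) = zz s * (cexp (lam * s%:C) - texp 2 (lam * s%:C)).
  rewrite /texp !big_ord_recr big_ord0 /= expr0 expr1 add0r !divr1 mulrBr.
  by rewrite /zz mulNr cexpN.
rewrite E (cmodM (zz s)) cmod_zz.
apply: le_trans (ler_wpM2l (expR_ge0 _) (cexp_taylor _ _)) _.
have -> : Re (lam * s%:C) = Re lam * s by rewrite mulrC ReCM mulrC.
rewrite max_l; last by rewrite mulr_ge0// ltW.
rewrite cmodM cmodR (ger0_norm s0) mulrCA -expRD addNr expR0 mulr1 exprMn mulrA.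
by rewrite (_ : 2 ^+ 2 = 4 :> R)//; ring.
Qed.

(** On exponentials with kappa c^N = lam, [taylor_P] makes P act as 1 + lam s up to O(r^(N + 1)),
    where s = r^N, and z (1 + lam s) = 1 + O(s^2). *)
Lemma r_eps e : 0 < e <= 1 -> exists2 K, 0 <= K & forall r x, 0 < r <= 1 -> x <= 0 ->
  cmod (veps e x - zz (r ^+ N) * Pc N (r ^+ N) (veps e) x) <= K * r ^+ N.+1 * w1 x ^+ 2.
Proof.
move=> e01; have /andP[e0 e1] := e01.
have [m1 m2 [B hB]] := veps_cbd e.
(* Im V = Re (- i V) reduces the imaginary part to [taylor_P]. *)
have Vi D y : Im (Vexp A c D y) = Re (Vexp A c (fun j => - 'i%C * D j) y).
  have -> : Vexp A c (fun j => - 'i%C * D j) y = - 'i%C * Vexp A c D y.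
    by rewrite /Vexp mulr_sumr; apply: eq_bigr => j _; ring.
  by rewrite (ReM (- 'i%C)) /=; ring.
have g1 y : y <= e -> Re (veps e y) = Re (Vexp A c (Esh e) y) by rewrite /veps => ->.
have g2 y : y <= e -> Im (veps e y) = Re (Vexp A c (fun j => - 'i%C * Esh e j) y) by rewrite -Vi /veps => ->.
have [K1 K10 h1] := taylor_P c_gt0 N_even N_gt0 e01 m1 g1 (fun y => le_trans (Re_cmod _) (hB y)).
have [K2 K20 h2] := taylor_P c_gt0 N_even N_gt0 e01 m2 g2 (fun y => le_trans (Im_cmod _) (hB y)).
have [K3 K30 h3] := Vexp_dec c_gt0 (Esh e).
exists (K1 + K2 + 4 * cmod lam ^+ 2 * K3).
  by rewrite !addr_ge0// mulr_ge0// mulr_ge0// sqr_ge0.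
move=> r x r01 x0; have /andP[r0 r1] := r01.
have s0 : 0 < r ^+ N by exact: exprn_gt0.
have VN (k : C) D y : Vexp A c (fun j => k * D j * c j ^+ N) y = k * Vexp A c (fun j => D j * c j ^+ N) y.
  by rewrite /Vexp mulr_sumr; apply: eq_bigr => j _; ring.
pose V := Vexp A c (Esh e) x.
have VL : (kapR R N)%:C * Vexp A c (fun j => Esh e j * c j ^+ N) x = lam * V.
  rewrite /V /Vexp !mulr_sumr; apply: eq_bigr => j jA; rewrite -(c_root jA); ring.
pose er := Pc N (r ^+ N) (veps e) x - (1 + lam * (r ^+ N)%:C) * V.
have erE : er = Pc N (r ^+ N) (veps e) x - (V + (kapR R N * r ^+ N)%:C * Vexp A c (fun j => Esh e j * c j ^+ N) x).
  rewrite /er mulrDl mul1r; congr (_ - (_ + _)).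
  by rewrite mulrAC -VL rmorphM /=; ring.
have herr : cmod er <= (K1 + K2) * r ^+ N.+1 * w1 x ^+ 2.
  apply: le_trans (cmod_le _) _; rewrite !mulrDl erE; apply: lerD.
    by move: (h1 r x r01 x0); rewrite ReB ReD ReCM.
  move: (h2 r x r01 x0); rewrite ImB ImD ImCM VN -Vi /= (ReM (- 'i%C)).
  by rewrite /= oppr0 mul0r sub0r mulN1r opprK.
have vV : veps e x = V by rewrite /veps (le_trans x0 (ltW e0)).
rewrite vV (_ : V - _ = (1 - zz (r ^+ N) * (1 + lam * (r ^+ N)%:C)) * V - zz (r ^+ N) * er); last by rewrite /er; ring.
apply: le_trans (cmodD _ _) _; rewrite cmodN (cmodM (1 - _)) (cmodM (zz _)).
have z1 : cmod (zz (r ^+ N)) <= 1.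
  by rewrite cmod_zz expR_le1 oppr_le0 mulr_ge0// ltW.
rewrite [leRHS](_ : _ = 4 * cmod lam ^+ 2 * K3 * (r ^+ N.+1 * w1 x ^+ 2) + (K1 + K2) * r ^+ N.+1 * w1 x ^+ 2); last by ring.
apply: lerD; last by apply: le_trans herr; rewrite ler_piMl ?cmod_ge0.
apply: le_trans (ler_pM (cmod_ge0 _) (cmod_ge0 _) (zz_taylor2 (ltW s0)) (h3 x x0)) _.
rewrite [leLHS](_ : _ = 4 * cmod lam ^+ 2 * K3 * ((r ^+ N) ^+ 2 * w1 x ^+ 2)); last by ring.
apply: ler_wpM2l; first by rewrite mulr_ge0// mulr_ge0// sqr_ge0.
rewrite ler_wpM2r ?exprn_ge0 ?w1_ge0//.
(* s^2 = r^(2 N) <= r^(N + 1), as r <= 1 and N >= 1. *)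
rewrite -exprM; apply: ler_wiXn2l => //; [exact: ltW|].
by rewrite muln2 -addnn -addn1 leq_add2l.
Qed.

End residual.

(** * The energy estimate *)

Section forms.
Variables (R : realType) (N : nat).
Hypothesis N_even : ~~ odd N.
Hypothesis N_gt0 : (0 < N)%N.
Local Notation C := R[i].
Implicit Types (F G : R -> C) (s : R) (z : C).

Lemma CS_le (X a b al be s : R) : 0 <= s -> 0 <= al -> 0 <= be -> 0 <= b ->
  X ^+ 2 <= a * b -> a <= s * al ^+ 2 -> b <= s * be ^+ 2 -> `|X| <= s * al * be.
Proof.
move=> s0 al0 be0 b0 X2 ha hb.
rewrite -(@ler_pXn2r _ 2)// ?nnegrE ?mulr_ge0// real_normK ?num_real//.
apply: le_trans X2 _; rewrite [leRHS](_ : _ = s * al ^+ 2 * (s * be ^+ 2)); last by ring.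
apply: le_trans (ler_wpM2r b0 ha) _.
by apply: ler_wpM2l => //; rewrite mulr_ge0// sqr_ge0.
Qed.

Definition br F G : R := Int (fun x => Re (F x) * Re (G x) + Im (F x) * Im (G x)).
Definition nrmc F : R := nrm (fun x => Re (F x)) + nrm (fun x => Im (F x)).
Definition enc s F : R := en N s (fun x => Re (F x)) + en N s (fun x => Im (F x)).

Lemma dec_mul_itg (f g : R -> R) : dec f -> dec g -> itg (fun x => f x * g x).
Proof. by move=> df dg; apply: dec_itg; exact: dec_mul. Qed.

Lemma br_itg F G : cdec F -> cdec G -> itg (fun x => Re (F x) * Re (G x) + Im (F x) * Im (G x)).
Proof. by move=> [d1 d2] [d3 d4]; apply: itgD; exact: dec_mul_itg. Qed.

Lemma brD F G H : cdec F -> cdec G -> cdec H -> br F (fun x => G x + H x) = br F G + br F H.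
Proof.
move=> dF dG dH; rewrite /br -IntD; [|exact: br_itg..].
by apply: eq_Int => x; rewrite ReD ImD; ring.
Qed.

Lemma brZ_le z F G b : cdec F -> cdec G -> 0 <= b ->
  (forall f g : R -> R, (f = (fun x => Re (F x)) \/ f = (fun x => Im (F x))) ->
     (g = (fun x => Re (G x)) \/ g = (fun x => Im (G x))) ->
   `|Int (fun x => f x * g x)| <= b) ->
  `|br F (fun x => z * G x)| <= 4 * cmod z * b.
Proof.
move=> [d1 d2] [d3 d4] b0 h.
have [i1 i2] := (dec_mul_itg d1 d3, dec_mul_itg d2 d4).
have [i3 i4] := (dec_mul_itg d2 d3, dec_mul_itg d1 d4).
have -> : br F (fun x => z * G x) = Re z * Int (fun x => Re (F x) * Re (G x)) + Re z * Int (fun x => Im (F x) * Im (G x))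
   + (Im z * Int (fun x => Im (F x) * Re (G x)) - Im z * Int (fun x => Re (F x) * Im (G x))).
  rewrite -!IntZ// -IntD ?itgD//; [|exact: itgZ..].
  rewrite -IntB; [|exact: itgZ..].
  rewrite -IntD; [|by apply: itgD; exact: itgZ|by apply: itgB; exact: itgZ].
  by apply: eq_Int => x; rewrite (ReM z) (ImM z); ring.
have q (t : R) f g : `|t| <= cmod z -> (f = (fun x => Re (F x)) \/ f = (fun x => Im (F x))) ->
     (g = (fun x => Re (G x)) \/ g = (fun x => Im (G x))) -> `|t * Int (fun x => f x * g x)| <= cmod z * b.
  by move=> tz hf hg; rewrite normrM ler_pM// h.
have [zr zi] := (Re_cmod z, Im_cmod z).
have q1 := q _ _ _ zr (or_introl erefl) (or_introl erefl).
have q2 := q _ _ _ zr (or_intror erefl) (or_intror erefl).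
have q3 := q _ _ _ zi (or_intror erefl) (or_introl erefl).
have q4 := q _ _ _ zi (or_introl erefl) (or_intror erefl).
apply: le_trans (ler_normD _ _) _.
rewrite [leRHS](_ : _ = (cmod z * b + cmod z * b) + (cmod z * b + cmod z * b)); last by ring.
apply: lerD; first by apply: le_trans (ler_normD _ _) _; exact: lerD.
by apply: le_trans (ler_normB _ _) _; exact: lerD.
Qed.

(** P is symmetric and positive, so with q = <F, P F> >= 0 the right-hand side is |F|^2 - q Re z >=
    |F|^2 - |z| q = (1 - |z|) |F|^2 + |z| (|F|^2 - q). *)
Lemma coercive s F z : 0 < s -> cdec F ->
  (1 - cmod z) * nrmc F + cmod z * enc s F <= br F (fun x => F x - z * Pc N s F x).
Proof.
move=> s0 dF; have [d1 d2] := dF; have [d3 d4] := Pc_cdec N_even N_gt0 s0 dF.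
have [i1 i2] := (dec_mul_itg d1 d3, dec_mul_itg d2 d4).
have [i3 i4] := (dec_mul_itg d2 d3, dec_mul_itg d1 d4).
have [i5 i6] := (dec_sq_itg d1, dec_sq_itg d2).
have -> : br F (fun x => F x - z * Pc N s F x) = nrmc F
   - (Re z * (Int (fun x => Re (F x) * Re (Pc N s F x)) + Int (fun x => Im (F x) * Im (Pc N s F x)))
   + (Im z * (Int (fun x => Im (F x) * Re (Pc N s F x)) - Int (fun x => Re (F x) * Im (Pc N s F x))))).
  rewrite /nrmc /nrm -IntD// -IntD// -IntZ; last exact: itgD.
  rewrite -IntB// -IntZ; last exact: itgB.
  rewrite -IntD; [|by apply: itgZ; exact: itgD|by apply: itgZ; exact: itgB].
  rewrite -IntB; [|exact: itgD|by apply: itgD; apply: itgZ; [exact: itgD|exact: itgB]].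
  by apply: eq_Int => x; rewrite ReB ImB (ReM z) (ImM z); ring.
(* The two cross terms multiplied by Im z cancel by symmetry of P. *)
rewrite [X in Im z * X](_ : _ = 0) ?mulr0 ?addr0; last first.
  by apply/eqP; rewrite subr_eq0; apply/eqP; exact: P_sym.
have p1 := P_pos N_even N_gt0 s0 d1; have p2 := P_pos N_even N_gt0 s0 d2.
rewrite /enc /en /nrmc /=.
set q1 := Int _ in p1 *; set q2 := Int _ in p2 *.
have : Re z * (q1 + q2) <= cmod z * (q1 + q2).
  by rewrite ler_wpM2r ?addr_ge0//; apply: le_trans (ler_norm _) (Re_cmod z).
lra.
Qed.

End forms.

(** * First-passage expectations *)

Section first_passage.
Variables (R : realType) (N : nat) (mu : R).
Hypothesis N_even : ~~ odd N.
Hypothesis N_gt0 : (0 < N)%N.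
Local Notation C := R[i].
Implicit Types s : R.

Definition cstart (y : R) : C := if y <= 0 then 0 else cexp (nu mu * y%:C).

(* [cseq s k x] is the expectation of exp(i mu X) at the step k + 1 when the
   walk of time step s first enters the right half-line at that step. *)
Fixpoint cseq s k (x : R) : C :=
  if x <= 0 then Pc N s (if k is k'.+1 then cseq s k' else cstart) x else 0.

Lemma Re_nu (x : R) : Re (nu mu * x%:C) = 0.
Proof. by rewrite /nu -mulrA !ReM !ImM /=; ring. Qed.

Lemma cmod_enu (x : R) : cmod (cexp (nu mu * x%:C)) = 1.
Proof. by rewrite cmod_cexp Re_nu expR0. Qed.

Lemma cstart_cbd : cbd cstart.
Proof.
have [cR cI] := cder_cont (cder_cexp (nu mu)); split.
- rewrite (_ : (fun x => _) = (fun x => if x <= 0 then 0 else Re (cexp (nu mu * x%:C)))); last first.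
    by apply/funext => x; rewrite /cstart; case: ifP.
  by apply: msb_if; [exact: mle|exact: msb_cst|exact: msb_cont].
- rewrite (_ : (fun x => _) = (fun x => if x <= 0 then 0 else Im (cexp (nu mu * x%:C)))); last first.
    by apply/funext => x; rewrite /cstart; case: ifP.
  by apply: msb_if; [exact: mle|exact: msb_cst|exact: msb_cont].
by exists 1 => x; rewrite /cstart; case: ifP => _; rewrite ?cmod0// cmod_enu.
Qed.

Lemma cseq_cdec s k : 0 < s -> cdec (cseq s k).
Proof.
move=> s0; elim: k => [|k IH].
  apply: (Pc_right_dec N_even N_gt0 s0 cstart_cbd) => x x0.
  by rewrite /cstart x0.
by apply: cdec_cut; exact: Pc_cdec.
Qed.

Lemma cseqS_comp s k :
  (fun x => Re (cseq s k.+1 x)) = cutP N s (fun x => Re (cseq s k x)) /\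
  (fun x => Im (cseq s k.+1 x)) = cutP N s (fun x => Im (cseq s k x)).
Proof. by split; apply/funext => x; rewrite /= /cutP; case: ifP. Qed.

Lemma cseq_nrm s k : 0 < s -> nrm (fun x => Re (cseq s k x)) <= nrm (fun x => Re (cseq s 0 x)) /\
  nrm (fun x => Im (cseq s k x)) <= nrm (fun x => Im (cseq s 0 x)).
Proof.
move=> s0; elim: k => [//|k [h1 h2]]; have [d1 d2] := cseq_cdec k s0.
have [-> ->] := cseqS_comp s k.
by split; [apply: le_trans h1|apply: le_trans h2]; exact: cutP_nrm.
Qed.

Lemma abs_le_sqr1 (a b : R) : a ^+ 2 <= b -> `|a| <= 1 + b.
Proof.
have := sqr_ge0 (`|a| - 1); rewrite sqrrB expr1n mulr1 real_normK ?num_real//.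
have := normr_ge0 a; lra.
Qed.

(** Contraction bounds all the L^2 norms by the first one, and one more application of P turns this
    into a sup bound. The term k = 0 is bounded directly, because [cstart] is not in L^2. *)
Lemma cseq_bnd s : 0 < s -> exists2 M, 0 <= M & forall k x, cmod (cseq s k x) <= M.
Proof.
move=> s0; have [CP CP0 hP] := P_bnd N_even N_gt0 s0.
have [_ _ [B hB]] := cdec_cbd (cseq_cdec 0 s0).
have B0 : 0 <= B := le_trans (cmod_ge0 _) (hB 0).
pose n1 := nrm (fun x => Re (cseq s 0 x)); pose n2 := nrm (fun x => Im (cseq s 0 x)).
have [n10 n20] : 0 <= n1 /\ 0 <= n2 by split; exact: nrm_ge0.
exists (B + ((1 + CP * n1) + (1 + CP * n2))) => [|[|k] x].
- by rewrite !addr_ge0// mulr_ge0.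
- by apply: le_trans (hB x) _; rewrite lerDl !addr_ge0// mulr_ge0.
have [h1 h2] := cseq_nrm k s0; have [d1 d2] := cseq_cdec k s0.
rewrite /=; case: ifP => _; last by rewrite cmod0 !addr_ge0// mulr_ge0.
apply: (@le_trans _ _ ((1 + CP * n1) + (1 + CP * n2))); last by rewrite lerDr.
apply: le_trans (cmod_le _) _; apply: lerD; apply: abs_le_sqr1.
  by apply: le_trans (hP _ x d1) _; exact: ler_wpM2l.
by apply: le_trans (hP _ x d2) _; exact: ler_wpM2l.
Qed.

End first_passage.

Opaque nrm en Int.
Section energy.
Variables (R : realType) (N : nat).
Hypothesis N_even : ~~ odd N.
Hypothesis N_gt0 : (0 < N)%N.
Local Notation C := R[i].
Implicit Types (F G : R -> C) (s a b : R).

Definition nrmc_le F b := nrm (fun x => Re (F x)) <= b ^+ 2 /\ nrm (fun x => Im (F x)) <= b ^+ 2.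
Definition enc_le s F b := en N s (fun x => Re (F x)) <= s * b ^+ 2 /\ en N s (fun x => Im (F x)) <= s * b ^+ 2.
Definition ynorm s F := Num.sqrt (nrmc F + s^-1 * enc N s F).

(** Replaces a constant y by the square of 1 + y, so that squared bounds can be stated without
    square roots. *)
Lemma le_sqr1D (x y : R) : 0 <= x -> x <= y -> x <= (1 + y) ^+ 2.
Proof.
move=> x0 xy; apply: le_trans (_ : 1 + y <= _); first by lra.
by rewrite expr2; apply: ler_peMr; lra.
Qed.

Lemma le_sum4 (p q t u : R) : 0 <= p -> 0 <= q -> 0 <= t -> 0 <= u ->
  [/\ p <= p + q + (t + u), q <= p + q + (t + u), t <= p + q + (t + u),
      u <= p + q + (t + u) & p + t <= p + q + (t + u) /\ q + u <= p + q + (t + u)].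
Proof. by move=> *; split; [lra..|split; lra]. Qed.

Lemma ynorm_ge0 s F : 0 <= ynorm s F.
Proof. exact: sqrtr_ge0. Qed.

Lemma nrmc_ge0 F : 0 <= nrmc F.
Proof. by rewrite /nrmc addr_ge0// nrm_ge0. Qed.

Lemma enc_ge0 s F : 0 < s -> cdec F -> 0 <= enc N s F.
Proof. by move=> s0 [d1 d2]; rewrite /enc addr_ge0// en_ge0. Qed.

Lemma ynorm_sqr s F : 0 < s -> cdec F -> ynorm s F ^+ 2 = nrmc F + s^-1 * enc N s F.
Proof.
move=> s0 dF; have h1 := nrmc_ge0 F; have h2 := enc_ge0 s0 dF.
by rewrite sqr_sqrtr// addr_ge0// mulr_ge0// invr_ge0 ltW.
Qed.

Lemma ynormP s F : 0 < s -> cdec F -> [/\ nrmc_le F (ynorm s F), enc_le s F (ynorm s F),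
  nrm (fun x => Re (F x)) + s^-1 * en N s (fun x => Re (F x)) <= ynorm s F ^+ 2 &
  nrm (fun x => Im (F x)) + s^-1 * en N s (fun x => Im (F x)) <= ynorm s F ^+ 2].
Proof.
move=> s0 dF; rewrite /nrmc_le /enc_le ynorm_sqr// /nrmc /enc mulrDr.
have [d1 d2] := dF; have sV0 : 0 < s^-1 by rewrite invr_gt0.
have e1 := mulr_ge0 (ltW sV0) (en_ge0 N_even N_gt0 s0 d1).
have e2 := mulr_ge0 (ltW sV0) (en_ge0 N_even N_gt0 s0 d2).
have [p1 p2 p3 p4 [p5 p6]] := le_sum4 (nrm_ge0 (fun x => Re (F x))) (nrm_ge0 (fun x => Im (F x))) e1 e2.
by split => //; split; rewrite -ler_pdivrMl.
Qed.

Lemma brZ_nrm z F G a b : cdec F -> cdec G -> 0 <= a -> 0 <= b -> nrmc_le F a -> nrmc_le G b ->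
  `|br F (fun x => z * G x)| <= 4 * cmod z * (a * b).
Proof.
move=> dF dG a0 b0 [n1 n2] [n3 n4]; apply: brZ_le => //; first exact: mulr_ge0.
have [d1 d2] := dF; have [d3 d4] := dG.
have cs (f g : R -> R) : dec f -> dec g -> nrm f <= a ^+ 2 -> nrm g <= b ^+ 2 -> `|Int (fun x => f x * g x)| <= a * b.
  move=> df dg nf ng; have := nrm_CS dg df; rewrite [nrm g * _]mulrC => h.
  by have := CS_le ler01 a0 b0 (nrm_ge0 g) h; rewrite !mul1r; apply.
by move=> f g [] -> [] ->; exact: cs.
Qed.

Lemma brZ_en s z F G a b : 0 < s -> cdec F -> cdec G -> 0 <= a -> 0 <= b -> enc_le s F a -> enc_le s G b ->
  `|br F (fun x => z * (G x - Pc N s G x))| <= 4 * cmod z * (s * a * b).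
Proof.
move=> s0 dF dG a0 b0 [n1 n2] [n3 n4].
have dGP : cdec (fun x => G x - Pc N s G x) by apply: cdecB => //; exact: Pc_cdec.
apply: brZ_le => //; first by rewrite !mulr_ge0// ltW.
have [d1 d2] := dF; have [d3 d4] := dG.
have cs (f g : R -> R) : dec f -> dec g -> en N s f <= s * a ^+ 2 -> en N s g <= s * b ^+ 2 ->
    `|Int (fun x => f x * (g x - P N s g x))| <= s * a * b.
  move=> df dg nf ng.
  have := en_CS N_even N_gt0 s0 dg df; rewrite [en N s g * _]mulrC => h.
  exact: (CS_le (ltW s0) a0 b0 (en_ge0 N_even N_gt0 s0 dg) h nf ng).
have E1 (f : R -> R) : (fun x => f x * Re (G x - Pc N s G x)) = (fun x => f x * (Re (G x) - P N s (fun y => Re (G y)) x)).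
  by apply/funext => x; rewrite ReB.
have E2 (f : R -> R) : (fun x => f x * Im (G x - Pc N s G x)) = (fun x => f x * (Im (G x) - P N s (fun y => Im (G y)) x)).
  by apply/funext => x; rewrite ImB.
by move=> f g [] -> [] ->; rewrite ?E1 ?E2; exact: cs.
Qed.

(** The equation is tested with F itself. Every term on the right is at most a constant times the
    norm of F, which cancels against one factor on the left; d - P d is paired through the energy
    form and so brings s b2 instead of b2. *)
Lemma energy_bound s z w c0 q b1 b2 m F S G d : 0 < s -> 0 <= c0 ->
  cdec F -> cdec S -> cdec G -> cdec d -> 0 <= b1 -> 0 <= b2 -> 0 <= m ->
  (forall y, 0 < y -> F y = 0) ->
  (forall y, y <= 0 -> F y - z * Pc N s F y = - (S y + (w * G y + (z * (d y - Pc N s d y) + (1 - z) * d y)))) ->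
  nrmc_le S b1 -> nrmc_le G m -> nrmc_le d b2 -> enc_le s d b2 ->
  c0 * s <= 1 - cmod z -> c0 <= cmod z <= 1 -> cmod (1 - z) <= q ->
  c0 * s * ynorm s F <= 4 * b1 + 4 * cmod w * m + 4 * (s * b2) + 4 * q * b2.
Proof.
move=> s0 c00 dF dS dG dd b10 b20 m0 F0 eqF nS nG nd ed cz1 /andP[cz2 z1] hq.
have q0 : 0 <= q := le_trans (cmod_ge0 _) hq.
have [nF eF _ _] := ynormP s0 dF; have al0 := ynorm_ge0 s F.
have n0 := nrmc_ge0 F; have e0 := enc_ge0 s0 dF.
have alE := ynorm_sqr s0 dF.
have dPd : cdec (fun x => d x - Pc N s d x) by apply: cdecB => //; exact: Pc_cdec.
have low := coercive N_even N_gt0 z s0 dF.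
have bS := brZ_nrm 1 dF dS al0 b10 nF nS.
have bG := brZ_nrm w dF dG al0 m0 nF nG.
have bd := brZ_nrm (1 - z) dF dd al0 b20 nF nd.
have be := brZ_en z s0 dF dd al0 b20 eF ed.
have E : br F (fun x => F x - z * Pc N s F x) = - (br F (fun x => 1 * S x) + (br F (fun x => w * G x) +
   (br F (fun x => z * (d x - Pc N s d x)) + br F (fun x => (1 - z) * d x)))).
  rewrite -(brD dF (cdecZ z dPd) (cdecZ (1 - z) dd)).
  rewrite -(brD dF (cdecZ w dG)); last by apply: cdecD; exact: cdecZ.
  rewrite -(brD dF (cdecZ 1 dS)); last by apply: cdecD; [exact: cdecZ|by apply: cdecD; exact: cdecZ].
  rewrite /br -IntN; last by apply: (br_itg dF); do ![apply: cdecD; first exact: cdecZ]; exact: cdecZ.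
  (* The equation is known on the left only; on the right F = 0 annihilates both integrands. *)
  apply: eq_Int => y; have [y0|y0] := leP y 0; last by rewrite F0//= !mul0r addr0 oppr0.
  by rewrite eqF// ReN ImN mul1r !mulrN opprD.
move: al0 alE low bS bG bd be; rewrite E cmod1.
set al := ynorm s F; set B1 := br F _; set B2 := br F _; set B3 := br F _; set B4 := br F _.
move=> al0 alE low bS bG bd be.
have {}low : c0 * s * al ^+ 2 <= - (B1 + (B2 + (B3 + B4))).
  apply: le_trans low; rewrite alE mulrDr mulrA (mulfK (lt0r_neq0 s0)).
  by apply: lerD; rewrite ler_wpM2r.
have {}be : `|B3| <= 4 * (s * al * b2).
  apply: le_trans be _; rewrite ler_wpM2r ?mulr_ge0 ?(ltW s0)// ler_piMr//.
have {}bd : `|B4| <= 4 * q * (al * b2).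
  by apply: le_trans bd _; rewrite ler_wpM2r ?mulr_ge0// ler_wpM2l.
(* Without a positive norm there is nothing to divide by, but then the left-hand side is at most
   0. *)
have [al1|al1] := leP al 0.
  apply: (@le_trans _ _ 0); first by rewrite mulr_ge0_le0// mulr_ge0// ltW.
  by rewrite !addr_ge0// !mulr_ge0// ?cmod_ge0// ltW.
rewrite -(ler_pM2r al1) [leLHS](_ : _ = c0 * s * al ^+ 2); last by ring.
apply: le_trans low _.
move: bS bG bd be; rewrite !ler_norml => /andP[+ _] /andP[+ _] /andP[+ _] /andP[+ _].
by clear; lra.
Qed.

Lemma Pc_sup : exists2 cP, 0 <= cP & forall s F x, 0 < s -> cdec F -> cmod (Pc N s F x) <= cP * ynorm s F.
Proof.
have [CP CP0 hCP] := P_sup R N_even N_gt0.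
exists (2 * (1 + CP)); first by rewrite mulr_ge0// addr_ge0.
move=> s F x s0 dF; have [_ _ h1 h2] := ynormP s0 dF; have y0 := ynorm_ge0 s F.
have CC : CP <= (1 + CP) ^+ 2 by exact: le_sqr1D.
have h (f : R -> R) : dec f -> nrm f + s^-1 * en N s f <= ynorm s F ^+ 2 -> `|P N s f x| <= (1 + CP) * ynorm s F.
  move=> df hf; have c1 : 0 <= 1 + CP by rewrite addr_ge0.
  rewrite -(@ler_pXn2r _ 2)// ?nnegrE ?mulr_ge0// real_normK ?num_real//.
  apply: le_trans (hCP _ _ x s0 df) _; rewrite exprMn.
  by apply: le_trans (ler_wpM2l CP0 hf) _; rewrite ler_wpM2r ?sqr_ge0.
have [d1 d2] := dF.
apply: le_trans (cmod_le _) _.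
by rewrite -mulrA mulrDl mul1r; apply: lerD; exact: h.
Qed.

Lemma ynorm_le s F b : 0 < s -> cdec F -> 0 <= b -> nrmc_le F b -> enc_le s F b -> ynorm s F <= 2 * b.
Proof.
move=> s0 dF b0 [n1 n2] [e1 e2].
have h (p q t u B : R) : p <= B -> q <= B -> t <= B -> u <= B -> p + q + (t + u) <= 2 ^+ 2 * B.
  by clear; lra.
rewrite -[2 * b](ger0_norm (mulr_ge0 (ler0n _ 2) b0)) -sqrtr_sqr /ynorm /nrmc /enc mulrDr.
apply: ler_wsqrtr; rewrite exprMn; apply: h => //; rewrite ler_pdivrMl//.
Qed.

Lemma nrm_le_w1 F b : cdec F -> 0 <= b -> (forall y, cmod (F y) <= b * w1 y ^+ 2) -> nrmc_le F (2 * b).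
Proof.
move=> [d1 d2] b0 hF.
have h (f : R -> R) : dec f -> (forall y, `|f y| <= b * w1 y ^+ 2) -> nrm f <= (2 * b) ^+ 2.
  move=> df hf; apply: (@le_trans _ _ (Int (fun y => b ^+ 2 * w1 y))).
    apply: le_Int; [exact: dec_sq_itg|by apply: itgZ; exact: w1_itg|move=> y].
    rewrite -real_normK ?num_real//; apply: (@le_trans _ _ ((b * w1 y ^+ 2) ^+ 2)).
      by rewrite lerXn2r ?nnegrE// mulr_ge0 ?exprn_ge0 ?w1_ge0.
    rewrite exprMn ler_wpM2l ?sqr_ge0// -exprM -[leRHS]expr1.
    by rewrite ler_wiXn2l ?w1_ge0 ?w1_le1.
  rewrite IntZ; last exact: w1_itg.
  rewrite Int_w1 [leRHS](_ : _ = b ^+ 2 * 4); last by ring.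
  (* pi <= 4 accounts for the factor 2 in the bound 2 b. *)
  have [_ /ltW p2] := andP (pihalf_02 R).
  by rewrite ler_wpM2l ?sqr_ge0//; move: p2; rewrite ler_pdivrMr//; lra.
split; apply: h => // y; first exact: le_trans (Re_cmod _) (hF y).
exact: le_trans (Im_cmod _) (hF y).
Qed.

End energy.

(** * Convergence of the first-passage series as the time step vanishes *)

Section core.
Variables (R : realType) (N : nat) (I : finType) (A : {set I}) (c : I -> R[i]) (mu : R) (lam : R[i]).
Hypothesis N_even : ~~ odd N.
Hypothesis N_gt2 : (2 < N)%N.
Hypothesis c_gt0 : forall j, j \in A -> 0 < Re (c j).
Hypothesis c_inj : {in A &, injective c}.
Hypothesis A_card : (N./2 <= #|A|)%N.
Hypothesis lam_gt0 : 0 < Re lam.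
Hypothesis c_root : forall j, j \in A -> (kapR R N)%:C * c j ^+ N = lam.
Local Notation C := R[i].
Local Notation veps := (veps A c mu).
Local Notation limv := (vlim A c mu).
Local Notation dd := (dd A c mu).
Local Notation cseq := (cseq N mu).
Local Notation z := (zz lam).
Local Notation Pc := (Pc N).

Let N_gt0 : (0 < N)%N. Proof. exact: ltn_trans N_gt2. Qed.

Lemma dd_cdec e : 0 < e <= 1 -> cdec (dd e 0).
Proof.
move=> e01; have o1 : cmod (1 : C) <= 1 by rewrite cmod1.
have oi : cmod (- 'i%C : C) <= 1 by rewrite cmodN /cmod /= expr0n expr1n add0r sqrtr1.
split.
  have := dd_dec mu c_gt0 o1 0 e01.
  by congr dec; apply/funext => x; rewrite mul1r.
have := dd_dec mu c_gt0 oi 0 e01.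
by congr dec; apply/funext => x; rewrite (ReM (- 'i%C)) /=; ring.
Qed.

(** Squared norms are linear in the shift, so a shift by e^2 makes the norms themselves O(e). The
    two components come from [om] equal to 1 and to - i. *)
Lemma dd_small : exists2 kap, 0 <= kap & forall e s, 0 < e <= 1 -> 0 < s ->
  nrmc_le (dd (e ^+ 2) 0) (kap * e) /\ enc_le N s (dd (e ^+ 2) 0) (kap * e).
Proof.
have o1 : cmod (1 : C) <= 1 by rewrite cmod1.
have oi : cmod (- 'i%C : C) <= 1 by rewrite cmodN /cmod /= expr0n expr1n add0r sqrtr1.
have [K1 K10 h1] := dd_energy mu N_even N_gt2 c_gt0 c_inj A_card o1.
have [K2 K20 h2] := dd_energy mu N_even N_gt2 c_gt0 c_inj A_card oi.
exists (1 + K1 + K2); first by rewrite !addr_ge0.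
move=> e s /andP[e0 e1] s0.
have e01 : 0 < e ^+ 2 <= 1 by rewrite exprn_gt0//= exprn_ile1// ltW.
have E1 : (fun x => Re (1 * dd (e ^+ 2) 0 x)) = (fun x => Re (dd (e ^+ 2) 0 x)).
  by apply/funext => x; rewrite mul1r.
have E2 : (fun x => Re (- 'i%C * dd (e ^+ 2) 0 x)) = (fun x => Im (dd (e ^+ 2) 0 x)).
  by apply/funext => x; rewrite (ReM (- 'i%C)) /=; ring.
have [a1 a2] := h1 _ _ e01 s0; have [a3 a4] := h2 _ _ e01 s0.
rewrite E1 in a1 a2; rewrite E2 in a3 a4.
have b1 : K1 * e ^+ 2 <= ((1 + K1 + K2) * e) ^+ 2.
  by rewrite -addrA exprMn ler_wpM2r ?sqr_ge0// le_sqr1D// lerDl.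
have b2 : K2 * e ^+ 2 <= ((1 + K1 + K2) * e) ^+ 2.
  by rewrite -addrA exprMn ler_wpM2r ?sqr_ge0// le_sqr1D// lerDr.
split; split; [exact: le_trans b1|exact: le_trans b2| |].
  by apply: le_trans a2 _; rewrite ler_wpM2l// ltW.
by apply: le_trans a4 _; rewrite ler_wpM2l// ltW.
Qed.

Lemma one_sub_expRN (u : R) : 0 <= u -> u * expR (- u) <= 1 - expR (- u).
Proof.
move=> u0; have := expR_ge1Dx u; have e0 := expR_gt0 (- u).
rewrite -(ler_pM2r e0) -expRD subrr expR0 mulrDl mul1r; lra.
Qed.

Definition vcut (x : R) : C := if x <= 0 then limv x else 0.

Lemma vcut_cdec : cdec vcut.
Proof.
have [cR cI] := cder_cont (Vexp_der A c (L A c mu)).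
have [K K0 hK] := Vexp_dec c_gt0 (L A c mu).
split; split.
- rewrite (_ : (fun x => _) = (fun x => if x <= 0 then Re (Vexp A c (L A c mu) x) else 0)); last first.
    by apply/funext => x; rewrite /vcut /vlim; case: (x <= 0).
  by apply: msb_if; [exact: mle|exact: msb_cont|exact: msb_cst].
- exists K => x; rewrite /vcut; case: ifP => x0; last by rewrite normr0 mulr_ge0 ?exprn_ge0 ?w1_ge0.
  by apply: le_trans (Re_cmod _) _; rewrite /vlim x0; exact: hK.
- rewrite (_ : (fun x => _) = (fun x => if x <= 0 then Im (Vexp A c (L A c mu) x) else 0)); last first.
    by apply/funext => x; rewrite /vcut /vlim; case: (x <= 0).
  by apply: msb_if; [exact: mle|exact: msb_cont|exact: msb_cst].
- exists K => x; rewrite /vcut; case: ifP => x0; last by rewrite normr0 mulr_ge0 ?exprn_ge0 ?w1_ge0.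
  by apply: le_trans (Im_cmod _) _; rewrite /vlim x0; exact: hK.
Qed.

Lemma vlimE : limv = (fun x => vcut x + cstart mu x).
Proof.
apply/funext => x; rewrite /vcut /cstart /vlim.
by case: ifP => _; rewrite ?addr0 ?add0r.
Qed.

Definition psum s K (x : R) : C := \sum_(k < K) z s ^+ k.+1 * cseq s k x.
(** Finitely many terms keep the error in [cdec]; the truncation shows up as the last term of
    [err_left]. *)
Definition err s K (x : R) : C := psum s K x - vcut x.

Lemma psum_cdec s K : 0 < s -> cdec (psum s K).
Proof. by move=> s0; apply: cdec_sum => i; apply: cdecZ; exact: cseq_cdec. Qed.

Lemma err_cdec s K : 0 < s -> cdec (err s K).
Proof. by move=> s0; apply: cdecB; [exact: psum_cdec|exact: vcut_cdec]. Qed.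

Lemma err_right s K x : 0 < x -> err s K x = 0.
Proof.
move=> x0; rewrite /err /psum /vcut leNgt x0 /= subr0 big1// => i _.
by case: (nat_of_ord i) => [|k] /=; rewrite leNgt x0 mulr0.
Qed.

(** On the left half-line z P maps each term of the sum to the next one, and maps [cstart] to the
    first one: in psum - z P psum everything cancels except z P [cstart] and the last image. *)
Lemma err_left s K x : 0 < s -> x <= 0 ->
  err s K x - z s * Pc s (err s K) x = - (limv x - z s * Pc s limv x) - z s ^+ K.+1 * cseq s K x.
Proof.
move=> s0 x0.
have bp := cdec_cbd (psum_cdec K s0); have bv := cdec_cbd vcut_cdec.
rewrite [Pc s (err s K) x](PcB N_even N_gt0 x s0 bp bv).
have -> : Pc s limv x = Pc s vcut x + Pc s (cstart mu) x.
  by rewrite vlimE (PcD N_even N_gt0 x s0 bv (cstart_cbd mu)).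
have -> : z s * (Pc s (psum s K) x - Pc s vcut x) = z s * Pc s (psum s K) x - z s * Pc s vcut x by rewrite mulrBr.
have -> : z s * Pc s (psum s K) x = psum s K.+1 x - z s * Pc s (cstart mu) x.
  rewrite [Pc s (psum s K) x](Pc_sum N_even N_gt0 x s0); last by move=> i; apply: cdecZ; exact: cseq_cdec.
  rewrite /psum big_ord_recl /= x0 expr1 addrAC subrr add0r mulr_sumr; apply: eq_bigr => i _.
  rewrite (PcZ N_even N_gt0 _ x s0 (cdec_cbd (cseq_cdec mu N_even N_gt0 i s0))) mulrA -exprS.
  by [].
rewrite /psum big_ord_recr /= /err /vcut x0 /psum.
by rewrite mulrDr; ring.
Qed.

Lemma cseq_nrm_le s : 0 < s -> exists2 m, 0 <= m & forall k, nrmc_le (cseq s k) m.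
Proof.
move=> s0; have n1 := nrm_ge0 (fun x => Re (cseq s 0 x)); have n2 := nrm_ge0 (fun x => Im (cseq s 0 x)).
pose m2 := nrm (fun x => Re (cseq s 0 x)) + nrm (fun x => Im (cseq s 0 x)).
have m20 : 0 <= m2 by rewrite addr_ge0.
exists (1 + m2) => [|k]; first by rewrite addr_ge0.
have mm : m2 <= (1 + m2) ^+ 2 by exact: le_sqr1D.
have [h1 h2] := cseq_nrm mu N_even N_gt0 k s0.
split; apply: le_trans mm; [apply: le_trans h1 _|apply: le_trans h2 _].
  by rewrite /m2 lerDl.
by rewrite /m2 lerDr.
Qed.

(** [veps] does not decay on the right, so its residual is not formed inside [cdec] directly. S is
    defined by solving the equation for it and cutting at 0, and then recognised on the left as that
    residual. *)
Lemma residual s K e : 0 < s -> 0 < e <= 1 -> exists S : R -> C, [/\ cdec S,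
  forall y, y <= 0 -> err s K y - z s * Pc s (err s K) y =
    - (S y + (z s ^+ K.+1 * cseq s K y + (z s * (dd e 0 y - Pc s (dd e 0) y) + (1 - z s) * dd e 0 y))),
  forall y, y <= 0 -> S y = veps e y - z s * Pc s (veps e) y &
  forall y, 0 < y -> S y = 0].
Proof.
move=> s0 e01; have /andP[e0 _] := e01.
pose E := err s K; have dE : cdec E := err_cdec K s0.
pose d := dd e 0; have ddc : cdec d := dd_cdec e01.
have dPd : cdec (Pc s d) := Pc_cdec N_even N_gt0 s0 ddc.
have dPE : cdec (Pc s E) := Pc_cdec N_even N_gt0 s0 dE.
have dc : cdec (cseq s K) := cseq_cdec mu N_even N_gt0 K s0.
have ddP : cdec (fun x => d x - Pc s d x) by exact: cdecB.
pose W y := E y - z s * Pc s E y.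
have dW : cdec W by apply: cdecB => //; exact: cdecZ.
pose T y := z s ^+ K.+1 * cseq s K y + (z s * (d y - Pc s d y) + (1 - z s) * d y).
have dT : cdec T by apply: cdecD; [exact: cdecZ|by apply: cdecD; exact: cdecZ].
pose S y := if y <= 0 then (-1) * W y - T y else 0.
have S0 y : y <= 0 -> S y = - W y - T y by rewrite /S => ->; rewrite mulN1r.
exists S; split.
- by apply: cdec_cut; apply: cdecB => //; exact: cdecZ.
- by move=> y y0; rewrite S0// -/E -/(W y) -/d -/(T y) subrK opprK.
- move=> y y0; rewrite S0// /W /E err_left//.
  have dv : veps e = (fun t => limv t - d t).
    by apply/funext => t; rewrite /d dd0// opprB addrC subrK.
  have bv : cbd limv.
    have [a1 a2 [B1 hB1]] := cdec_cbd vcut_cdec; have [a3 a4 [B2 hB2]] := cstart_cbd mu.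
    rewrite vlimE; split; [by under eq_fun do rewrite ReD; exact: msbD|by under eq_fun do rewrite ImD; exact: msbD|].
    by exists (B1 + B2) => t; apply: le_trans (cmodD _ _) _; exact: lerD.
  by rewrite dv (PcB N_even N_gt0 y s0 bv (cdec_cbd ddc)) /T; ring.
- by move=> y y0; rewrite /S leNgt y0.
Qed.

(** The order of the quantifiers is the point: C0 depends on neither e nor r, C1 does not depend on
    r, and M depends on neither K nor x. So K, then r, then e can be sent to their limits. *)
Lemma first_passage_limit : exists2 C0, 0 <= C0 & forall e, 0 < e <= 1 -> exists C1, forall r, 0 < r <= 1 ->
  exists M, forall K x, x <= 0 ->
  cmod (psum (r ^+ N) K x - limv x) <= C0 * e + C1 * r + M * expR (- (Re lam * r ^+ N)) ^+ K.+1.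
Proof.
have [kap kap0 hkap] := dd_small.
have [Kd Kd0 hKd] := dd_bound mu c_gt0 0.
have [cP cP0 Psup] := Pc_sup R N_even N_gt0.
(* For s <= 1 this is at most (1 - |z|) / s and at most |z|, where |z| = exp (- Re lam s). *)
pose c0 := Num.min (Re lam) 1 * expR (- Re lam).
have c00 : 0 < c0 by rewrite mulr_gt0 ?expR_gt0// lt_min lam_gt0 ltr01.
pose cl := cmod lam.
have cl0 : 0 <= cl := cmod_ge0 _.
pose C0 := cP * c0^-1 * ((4 + 8 * cl) * kap) + Kd + cP * (2 * kap).
exists C0; first by rewrite !addr_ge0// !mulr_ge0// ?invr_ge0 ?(ltW c00)// addr_ge0// mulr_ge0.
move=> e e01; have /andP[e0 e1] := e01.
have e201 : 0 < e ^+ 2 <= 1 by rewrite exprn_gt0//= exprn_ile1// ltW.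
have [Kr Kr0 hr] := r_eps mu N_even N_gt0 c_gt0 lam_gt0 c_root e201.
exists (cP * c0^-1 * (8 * Kr) + Kr) => r r01; have /andP[r0 r1] := r01.
pose s := r ^+ N; have s0 : 0 < s by exact: exprn_gt0.
have s1 : s <= 1 by rewrite exprn_ile1// ltW.
have [M0 M00 hM] := cseq_bnd mu N_even N_gt0 s0.
have [m m0 hm] := cseq_nrm_le s0.
exists (cP * c0^-1 * (4 * m * s^-1) + M0) => K x x0.
set ze := expR _; have zE : cmod (z s) = ze by rewrite cmod_zz.
have ze0 : 0 < ze by exact: expR_gt0.
have ls0 : 0 <= Re lam * s by rewrite mulr_ge0// ltW.
have ze1 : ze <= 1 by rewrite expR_le1 oppr_le0.
have [nd ed] := hkap e s e01 s0.
have [S [dS SE SV S0]] := residual K s0 e201.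
have dE := err_cdec K s0; have ddc := dd_cdec e201.
have dc := cseq_cdec mu N_even N_gt0 K s0.
have ke0 : 0 <= kap * e by rewrite mulr_ge0// ltW.
have Sle y : cmod (S y) <= Kr * s * r * w1 y ^+ 2.
  have [y0|y0] := leP y 0.
    by rewrite SV//; apply: le_trans (hr _ _ r01 y0) _; rewrite exprSr mulrA.
  by rewrite S0// cmod0 !mulr_ge0 ?exprn_ge0 ?w1_ge0 ?(ltW s0) ?(ltW r0).
have b0 : 0 <= Kr * s * r by rewrite !mulr_ge0 ?(ltW s0) ?(ltW r0).
have nS := nrm_le_w1 dS b0 Sle.
have slam : Re lam * s <= Re lam by rewrite ler_piMr// ltW.
have z1 : c0 * s <= 1 - cmod (z s).
  rewrite zE; apply: le_trans (one_sub_expRN ls0).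
  rewrite /c0 mulrAC; apply: ler_pM; rewrite ?expR_ge0//.
  - by rewrite mulr_ge0 ?(ltW s0)// le_min ler01 ltW.
  - by rewrite ler_wpM2r ?(ltW s0)// ge_min lexx.
  - by rewrite ler_expR lerN2.
have z2 : c0 <= cmod (z s) <= 1.
  rewrite zE ze1 andbT; apply: (@le_trans _ _ (expR (- Re lam))).
    by rewrite /c0 ler_piMl ?expR_ge0// ge_min lexx orbT.
  by rewrite ler_expR lerN2.
have b20 : 0 <= 2 * (Kr * s * r) by rewrite mulr_ge0.
have En := energy_bound N_even N_gt0 s0 (ltW c00) dE dS dc ddc b20 ke0 m0 (@err_right s K) SE nS (hm K) nd ed z1 z2
  (zz_taylor1 lam_gt0 (ltW s0)).
have En1 : ynorm N s (err s K) <= c0^-1 * (8 * Kr * r + 4 * m * s^-1 * ze ^+ K.+1 + (4 + 8 * cl) * (kap * e)).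
  move: En; rewrite cmodX zE; clear -c00 s0; move=> En.
  rewrite ler_pdivlMl// -(ler_pM2r s0) mulrAC; apply: le_trans En _.
  by rewrite le_eqVlt; apply/orP; left; apply/eqP; rewrite /cl; have ? := lt0r_neq0 s0; field.
have Ex : psum s K x - limv x = err s K x by rewrite /err /vcut x0.
(* The energy norm controls P err pointwise, not err; the equation expresses err through P err and
   terms that have pointwise bounds of their own. *)
have Ed : psum s K x - limv x = z s * Pc s (err s K) x - (S x + (z s ^+ K.+1 * cseq s K x +
   (z s * (dd (e ^+ 2) 0 x - Pc s (dd (e ^+ 2) 0) x) + (1 - z s) * dd (e ^+ 2) 0 x))).
  by rewrite Ex -(SE x x0) addrC subrK.
have {Ed} -> : psum s K x - limv x = z s * Pc s (err s K) x - S x - z s ^+ K.+1 * cseq s K x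
   - (dd (e ^+ 2) 0 x - z s * Pc s (dd (e ^+ 2) 0) x).
  by rewrite Ed; ring.
have PE := Psup s (err s K) x s0 dE.
have Pd : cmod (Pc s (dd (e ^+ 2) 0) x) <= cP * (2 * (kap * e)).
  by apply: le_trans (Psup s _ x s0 ddc) _; rewrite ler_wpM2l// ynorm_le.
have Dx : cmod (dd (e ^+ 2) 0 x) <= Kd * e.
  apply: le_trans (hKd _ x e201) _; rewrite x0 ler_wpM2l// expr2 -mulrA ler_piMr ?(ltW e0)//.
  by rewrite mulr_ile1 ?(ltW e0)// ?exprn_ge0 ?exprn_ile1 ?w1_ge0 ?w1_le1.
have Sx : cmod (S x) <= Kr * r.
  apply: le_trans (Sle x) _; rewrite -!mulrA ler_wpM2l// mulrCA ler_piMr ?(ltW r0)//.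
  by apply: mulr_ile1; [exact: ltW|rewrite exprn_ge0 ?w1_ge0|exact: s1|rewrite exprn_ile1 ?w1_ge0 ?w1_le1].
have zle F : cmod (z s * F) <= cmod F by rewrite (cmodM (z s)) zE ler_piMl ?cmod_ge0.
have cx : cmod (z s ^+ K.+1 * cseq s K x) <= M0 * ze ^+ K.+1.
  by rewrite (cmodM (_ ^+ _)) cmodX zE mulrC ler_wpM2r ?exprn_ge0 ?(ltW ze0).
have t4 (p q t u v : C) : cmod (p - q - t - (u - v)) <= cmod p + cmod q + cmod t + (cmod u + cmod v).
  apply: le_trans (cmodD _ _) _; rewrite cmodN; apply: lerD.
    apply: le_trans (cmodD _ _) _; rewrite cmodN lerD2r.
    by apply: le_trans (cmodD _ _) _; rewrite cmodN.
  by apply: le_trans (cmodD _ _) _; rewrite cmodN.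
apply: le_trans (t4 _ _ _ _ _) _.
apply: le_trans (lerD (lerD (lerD (le_trans (zle _) (le_trans PE (ler_wpM2l cP0 En1))) Sx) cx) (lerD Dx (le_trans (zle _) Pd))) _.
by rewrite le_eqVlt; apply/orP; left; apply/eqP; rewrite /C0; ring.
Qed.

End core.

Transparent nrm en Int.

(** * Expectations of the sampled walk *)

Section tuple_integral.
Variable R : realType.
Local Notation RB := (measurableTypeR R).
Local Notation lt k := (lebesgue_tuple R k).

Definition tmsb k (f : k.-tuple R -> R) : Prop :=
  measurable_fun [set: k.-tuple RB] (f : k.-tuple RB -> RB).

Lemma tmsb_nth k j : tmsb (fun w : k.-tuple R => nth 0 w j).
Proof.
have [jk|jk] := ltnP j k; last first.
  rewrite (_ : (fun w => _) = (fun=> 0)); first exact: measurable_cst.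
  by apply/funext => w; rewrite nth_default// size_tuple.
rewrite (_ : (fun w => _) = (fun w => tnth w (Ordinal jk))); first exact: (@measurable_tnth _ RB).
by apply/funext => w; rewrite (tnth_nth 0).
Qed.

Lemma tmsb_nth_cons k x j : tmsb (fun w : k.-tuple R => nth 0 (x :: w) j).
Proof. by case: j => [|j]; [exact: measurable_cst|exact: tmsb_nth]. Qed.

Variable q : R -> R.
Hypothesis iq : itg q.
Let mq : msb q := itg_msb iq.
Let rho : R := Int (fun x => `|q x|).

Definition wt k (x : R) (w : seq R) : R := \prod_(i < k) q (nth 0 (x :: w) i - nth 0 (x :: w) i.+1).

Lemma wtS k x y w : wt k.+1 x (y :: w) = q (x - y) * wt k y w.
Proof. by rewrite /wt big_ord_recl. Qed.

Lemma tmsb_wt k x : tmsb (fun w : k.-tuple R => wt k x w).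
Proof.
apply: (measurable_prod (s := index_enum _)) => i _; apply: (measurableT_comp mq).
by apply: measurable_funB; exact: tmsb_nth_cons.
Qed.

Lemma itg_shift x : itg (fun y => q (x - y)) /\ Int (fun y => `|q (x - y)|) = rho.
Proof.
have [i1 e1] := Int_opp iq; have [i2 e2] := Int_affine (- x) (ltr01 : 0 < 1 :> R) i1.
split.
  by move: i2; congr itg; apply/funext => y; congr q; ring.
have [i3 e3] := Int_opp (itg_abs iq); have [i4 e4] := Int_affine (- x) (ltr01 : 0 < 1 :> R) i3.
rewrite /rho -e3 -[RHS]mul1r -invr1 -e4; apply: eq_Int => y; congr (`|q _|); ring.
Qed.

Lemma itgE (f : R -> R) : itg f -> (\int[@lebesgue_measure R]_x (f x)%:E)%E = (Int f)%:E.
Proof. by move=> h; rewrite /Int /Rintegral fineK//; exact: integrable_fin_num. Qed.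

(** By translation invariance each step contributes a factor [rho]. Since the total variation is
    finite, bounded measurable functionals of the walk are integrable. *)
Lemma wt_int k x : (\int[lt k]_w `|wt k x w|%:E = (rho ^+ k)%:E)%E.
Proof.
elim: k x => [|k IH] x.
  rewrite (_ : (\int[lt 0]_w _)%E = (\int[\d_([tuple] : 0.-tuple RB)]_w `|wt 0 x w|%:E)%E)//.
  rewrite integral_dirac//; last first.
    by apply/measurable_EFinP; apply: measurableT_comp => //; exact: tmsb_wt.
  by rewrite diracT mul1e /wt big_ord0 normr1.
have m1 := @tmsb_wt k.+1 x.
(* By definition the measure on k + 1 coordinates is the image of a product measure, so Tonelli's
   theorem splits off the first coordinate. *)
rewrite (_ : (\int[lt k.+1]_w _)%E =
  (\int[pushforward (lebesgue_measure \x lt k)%E (@tcons R k)]_w `|wt k.+1 x w|%:E)%E)//.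
rewrite ge0_integral_pushforward//; last 2 first.
- exact: measurable_tcons.
- by apply/measurable_EFinP; apply: measurableT_comp.
rewrite preimage_setT fubini_tonelli1; last 2 first.
- apply/measurable_EFinP; apply: measurableT_comp => //.
  exact: (measurableT_comp m1 (@measurable_tcons R k)).
- by move=> z /=; rewrite lee_fin.
transitivity (\int[@lebesgue_measure R]_y (`|q (x - y)| * rho ^+ k)%:E)%E.
  apply: eq_integral => y _; rewrite /fubini_F /=.
  under eq_integral do rewrite wtS normrM EFinM.
  rewrite ge0_integralZl_EFin//; last first.
    by apply/measurable_EFinP; apply: measurableT_comp => //; exact: tmsb_wt.
  by rewrite IH -EFinM.
have [i1 e1] := itg_shift x.
rewrite itgE; last first.
  by under eq_fun do rewrite mulrC; apply: itgZ; exact: itg_abs.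
by rewrite IntZr ?e1 ?exprS//; exact: itg_abs.
Qed.

Lemma wt_itg k x (f : k.-tuple R -> R) B : tmsb f -> (forall w, `|f w| <= B) ->
  (lt k).-integrable setT (fun w => (f w * wt k x w)%:E).
Proof.
move=> mf fB.
have B0 : 0 <= B by exact: le_trans (fB (nseq_tuple k 0)).
have iw : (lt k).-integrable setT (fun w => (B%:E * `|wt k x w|%:E)%E).
  apply: integrableZl => //; apply/integrableP; split.
    by apply/measurable_EFinP; apply: measurableT_comp => //; exact: tmsb_wt.
  under eq_integral do rewrite abse_EFin normr_id.
  by rewrite wt_int ltry.
apply: (le_integrable measurableT _ _ iw).
  by apply/measurable_EFinP; apply: measurable_funM => //; exact: tmsb_wt.
move=> w _; rewrite -EFinM !abse_EFin lee_fin !normrM normr_id.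
by rewrite ler_wpM2r// (le_trans (fB w))// ler_norm.
Qed.

Definition Jr k x (f : k.-tuple R -> R) : R := Rintegral (lt k) setT (fun w : k.-tuple RB => f w * wt k x w).

Lemma Jr0 x (f : 0.-tuple R -> R) : tmsb f -> Jr x f = f [tuple].
Proof.
move=> mf; rewrite /Jr /Rintegral.
rewrite (_ : (\int[lt 0]_w _)%E = (\int[\d_([tuple] : 0.-tuple RB)]_w (f w * wt 0 x w)%:E)%E)//.
rewrite integral_dirac//; last first.
  by apply/measurable_EFinP; apply: measurable_funM => //; exact: tmsb_wt.
by rewrite diracT mul1e /wt big_ord0 mulr1.
Qed.

(** Fubini's theorem in the first coordinate, the analogue of the Markov property at the first
    step. *)
Lemma JrS k x (f : k.+1.-tuple R -> R) B : tmsb f -> (forall w, `|f w| <= B) ->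
  Jr x f = Int (fun y => q (x - y) * Jr y (fun w : k.-tuple R => f [the k.+1.-tuple R of y :: w])).
Proof.
move=> mf fB; have mw := @tmsb_wt k.+1 x; have B0 : 0 <= B by exact: le_trans (fB (nseq_tuple k.+1 0)).
pose g (w : k.+1.-tuple RB) := (f w * wt k.+1 x w)%:E.
have mg : measurable_fun setT g by apply/measurable_EFinP; exact: measurable_funM.
have ig : (lebesgue_measure \x lt k)%E.-integrable setT (g \o @tcons R k).
  apply/integrableP; split; first exact: (measurableT_comp mg (@measurable_tcons R k)).
  have := wt_itg x mf fB; move=> /integrableP[_].
  rewrite (_ : (\int[lt k.+1]_w _)%E =
    (\int[pushforward (lebesgue_measure \x lt k)%E (@tcons R k)]_w `|g w|)%E)//.
  rewrite ge0_integral_pushforward//; [exact: measurable_tcons|exact: measurableT_comp].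
rewrite {1}/Jr /Rintegral.
rewrite (_ : (\int[lt k.+1]_w _)%E =
  (\int[pushforward (lebesgue_measure \x lt k)%E (@tcons R k)]_w g w)%E)//.
rewrite integral_pushforward//; last exact: measurable_tcons.
rewrite preimage_setT -integral12_prod_meas1//; congr fine; apply: eq_integral => y _.
rewrite /fubini_F /g /=.
have mfy : tmsb (fun w : k.-tuple R => f [the k.+1.-tuple R of y :: w]).
  apply: (measurableT_comp mf); apply: (@measurable_cons _ _ (k.-tuple RB) RB (fun=> y) k idfun).
    exact: measurable_cst.
  exact: measurable_id.
have iy := wt_itg y mfy (fun w => fB _).
under eq_integral do rewrite wtS mulrCA EFinM.
rewrite integralZl// /Jr /Rintegral EFinM fineK//.
exact: integrable_fin_num.
Qed.

End tuple_integral.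

(** * The given kernel, its action on waves and its symmetries *)

Section kernel.
Variables (R : realType) (N : nat).
Hypothesis N_even : ~~ odd N.
Hypothesis N_gt0 : (0 < N)%N.
Local Notation C := R[i].
Implicit Types (s x : R).

(** (- i)^N = (-1)^(N/2) because N is even, and [kappa] is the opposite sign. *)
Lemma kappa_pow (u t : R) : kappa R N * t%:C * (- 'i%C * u%:C) ^+ N = (- (t * u ^+ N))%:C.
Proof.
rewrite -(even_halfK N_even) -muln2 mulnC /kappa exprMn [(- 'i%C) ^+ _]exprM sqrrN sqr_i.
rewrite mulnC muln2 doubleK exprD expr1 rmorphN rmorphM rmorphXn /=.
have s1 : (-1) ^+ N./2 * (-1) ^+ N./2 = 1 :> C by rewrite -exprD addnn -mul2n exprM sqrrN expr1n expr1n.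
rewrite [LHS](_ : _ = - (((-1) ^+ N./2 * (-1) ^+ N./2) * (t%:C * u%:C ^+ N./2.*2))); last by ring.
by rewrite s1 mul1r.
Qed.

Lemma pp_kernelE s x : 0 < s -> pp_kernel N s x = (ker N s x)%:C.
Proof.
move=> s0; rewrite /pp_kernel /cintegral.
have Ex (u : R) : - 'i%C * x%:C * u%:C + kappa R N * s%:C * (- 'i%C * u%:C) ^+ N = (- (s * u ^+ N)) +i* (- (x * u)) :> C.
  rewrite kappa_pow; apply: complex_ext; rewrite ?ReD ?ImD ?ReM ?ImM /=; ring.
under [X in X +i* _]eq_Rintegral do rewrite Ex Re_cexp /= cosN.
under [X in _ +i* X]eq_Rintegral do rewrite Ex Im_cexp /= sinN.
have r1 := rapid_dec (pexp_rapid N_even N_gt0 1 s0); have rn := rapid_dec (pexp_rapid N_even N_gt0 (npi R)%:P s0).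
have p1 (u : R) : pexp N 1 s u = expR (- (s * u ^+ N)) by rewrite /pexp hornerC mul1r.
have Im0 : Int (fun u => expR (- (s * u ^+ N)) * - sin (x * u)) = 0.
  apply: Int_odd.
    have := itgN (itg_sin x (dec_itg r1)); congr itg; apply/funext => u.
    by rewrite p1 mulrN.
  by move=> u; rewrite exprNn -signr_odd (negbTE N_even) mul1r [x * - u]mulrN sinN; ring.
rewrite [X in _ +i* X]Im0; apply: complex_ext; last by rewrite ImCM mulr0.
rewrite ReCM /= /ker /fcos -IntZ.
  by apply: eq_Int => u; rewrite /pexp hornerC mulrA.
have := itg_cos x (dec_itg r1); congr itg; apply/funext => u.
by rewrite p1.
Qed.

(** The kernel has integral 1, so its modulus has integral at least 1. Hence ln rho >= 0, and the
    half-plane where the series is required to converge lies in Re lam > 0. *)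
Lemma pp_rho_ge1 : 1 <= pp_rho R N.
Proof.
have dk := ker_dec N_even N_gt0 (ltr01 : 0 < 1 :> R).
have -> : pp_rho R N = Int (fun x => `|ker N 1 x|).
  by apply: eq_Int => x; rewrite pp_kernelE// cmodR.
have := ker_moment N_even N_gt0 (ltr01 : 0 < 1 :> R) (leq0n N); rewrite eqxx => e.
rewrite -[leLHS]e.
apply: le_trans (le_abs_Int (dec_itg dk)); apply: le_trans (ler_norm _).
by rewrite le_eqVlt; apply/orP; left; apply/eqP; apply: eq_Int => x; rewrite expr0 mul1r.
Qed.

Lemma P_conv s f x B : 0 < s -> msb f -> (forall y, `|f y| <= B) ->
  P N s f x = Int (fun v => ker N s v * f (x - v)).
Proof.
move=> s0 mf fB; have i0 := P_itg_bnd N_even N_gt0 x s0 mf fB.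
have [i1 e1] := Int_affine x (ltr01 : 0 < 1 :> R) i0.
have [_ e2] := Int_opp i1; move: e2; rewrite e1 invr1 mul1r -/(P N s f x) => <-.
by apply: eq_Int => v; congr (ker N s _ * f _); ring.
Qed.

Lemma P_cst s b x : 0 < s -> P N s (fun=> b) x = b.
Proof.
move=> s0; rewrite (P_conv x s0 (msb_cst _) (fun=> lexx `|b|)).
have := ker_moment N_even N_gt0 s0 (leq0n N); rewrite eqxx => e.
rewrite IntZr; last exact/dec_itg/ker_dec.
rewrite -[RHS]mul1r -e; congr (_ * b); apply: eq_Int => v; by rewrite expr0 mul1r.
Qed.

Lemma P_cos s mu x : 0 < s -> P N s (fun y => cos (mu * y)) x = expR (- (s * mu ^+ N)) * cos (mu * x).
Proof.
move=> s0; have ik := dec_itg (ker_dec N_even N_gt0 s0).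
have [i1 i2] := (itg_cos mu ik, itg_sin mu ik).
rewrite (@P_conv _ _ _ 1)//; [|by move: (msb_cosM mu (R := R))|by move=> y; exact: cos_max].
rewrite -(ker_fourier N_even N_gt0 mu s0) -[RHS]addr0 -[X in _ + X](mulr0 (sin (mu * x))) -(ker_fsin N_even N_gt0 mu s0).
rewrite [fcos _ _ * _]mulrC /fcos /fsin -!IntZ// -IntD; [|exact: itgZ..].
by apply: eq_Int => v; rewrite mulrBr cosB; ring.
Qed.

Lemma P_sin s mu x : 0 < s -> P N s (fun y => sin (mu * y)) x = expR (- (s * mu ^+ N)) * sin (mu * x).
Proof.
move=> s0; have ik := dec_itg (ker_dec N_even N_gt0 s0).
have [i1 i2] := (itg_cos mu ik, itg_sin mu ik).
rewrite (@P_conv _ _ _ 1)//; [|by move: (msb_sinM mu (R := R))|by move=> y; exact: sin_max].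
rewrite -(ker_fourier N_even N_gt0 mu s0) -[RHS]subr0 -[X in _ - X](mulr0 (cos (mu * x))) -(ker_fsin N_even N_gt0 mu s0).
rewrite [fcos _ _ * _]mulrC /fcos /fsin -!IntZ// -IntB; [|exact: itgZ..].
by apply: eq_Int => v; rewrite mulrBr sinB; ring.
Qed.

Definition emu mu (x : R) : C := cexp (nu mu * x%:C).

Lemma Re_emu mu x : Re (emu mu x) = cos (mu * x).
Proof.
rewrite /emu Re_cexp Re_nu expR0 mul1r; congr cos.
by rewrite mulrC ImCM /nu [_ * mu%:C]mulrC ImCM /=; ring.
Qed.

Lemma Im_emu mu x : Im (emu mu x) = sin (mu * x).
Proof.
rewrite /emu Im_cexp Re_nu expR0 mul1r; congr sin.
by rewrite mulrC ImCM /nu [_ * mu%:C]mulrC ImCM /=; ring.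
Qed.

Lemma cmod_emu mu x : cmod (emu mu x) = 1.
Proof. exact: cmod_enu. Qed.

Lemma emu_cbd mu : cbd (emu mu).
Proof.
split; last by exists 1 => x; rewrite cmod_emu.
  by under eq_fun do rewrite Re_emu; exact: msb_cosM.
by under eq_fun do rewrite Im_emu; exact: msb_sinM.
Qed.

Lemma Pc_emu s mu x : 0 < s -> Pc N s (emu mu) x = (expR (- (s * mu ^+ N)))%:C * emu mu x.
Proof.
move=> s0; apply: complex_ext.
  rewrite ReCM Re_emu -P_cos//; transitivity (P N s (fun y => Re (emu mu y)) x) => //.
  by apply: eq_Int => y; rewrite Re_emu.
rewrite ImCM Im_emu -P_sin//; transitivity (P N s (fun y => Im (emu mu y)) x) => //.
by apply: eq_Int => y; rewrite Im_emu.
Qed.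

Lemma Pc_cst s b x : 0 < s -> Pc N s (fun=> b) x = b.
Proof. by move=> s0; apply: complex_ext; rewrite /= P_cst. Qed.

(** The kernel is even and the convolution commutes with translations; [sg] chooses between y -> a +
    y and y -> a - y, which brings both hitting times to the level 0 approached from the left. *)
Lemma P_reflect s f (sg : bool) a x B : 0 < s -> msb f -> (forall y, `|f y| <= B) ->
  P N s f (a + (-1) ^+ sg * x) = P N s (fun y => f (a + (-1) ^+ sg * y)) x.
Proof.
move=> s0 mf fB; have ml : msb (fun y => f (a + (-1) ^+ sg * y)).
  by apply: (msb_comp mf); apply: msbD; [exact: msb_cst|apply: msbM; [exact: msb_cst|exact: msb_id]].
rewrite (P_conv _ s0 mf fB) (P_conv _ s0 ml (fun y => fB _)).
case: sg {ml} => /=; last by apply: eq_Int => v; congr (_ * f _); ring.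
have ic : itg (fun v => ker N s v * f (a + (-1) ^+ true * x - v)).
  apply: (itgM (C := B) (dec_itg (ker_dec N_even N_gt0 s0))) => //.
  by apply: (msb_comp mf); apply: msbB; [exact: msb_cst|exact: msb_id].
have [_ <-] := Int_opp ic; apply: eq_Int => v.
by rewrite ker_even; congr (_ * f _); ring.
Qed.

Lemma Pc_reflect s F (sg : bool) a x : 0 < s -> cbd F ->
  Pc N s F (a + (-1) ^+ sg * x) = Pc N s (fun y => F (a + (-1) ^+ sg * y)) x.
Proof.
move=> s0 [m1 m2 [B hB]]; apply: complex_ext => /=.
  exact: P_reflect s0 m1 (fun y => le_trans (Re_cmod _) (hB y)).
exact: P_reflect s0 m2 (fun y => le_trans (Im_cmod _) (hB y)).
Qed.

End kernel.

(** * Peeling off the first step of the walk *)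

Section walk.
Variables (R : realType) (N : nat) (mu s : R).
Hypothesis N_even : ~~ odd N.
Hypothesis N_gt0 : (0 < N)%N.
Hypothesis s_gt0 : 0 < s.
Variable c : R -> bool.
Hypothesis mc : measurable_fun [set: measurableTypeR R] c.
Local Notation C := R[i].
Local Notation eX := (emu mu).
Variables al be : C.

Let q := ker N s.
Let iq : itg q := dec_itg (ker_dec N_even N_gt0 s_gt0).
Let phi : C := (expR (- (s * mu ^+ N)))%:C.

(* The flag [b] records a crossing before the start, so that the first step can
   be peeled off. *)
Definition hitf k (b : bool) (x : R) (w : k.+1.-tuple R) : C :=
  (al * eX (nth 0 (x :: w) k) + be * eX (nth 0 (x :: w) k.+1)) *
  (b || [exists j : 'I_k.+1, c (nth 0 (x :: w) j)])%:R.

Definition hitE k b x : C :=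
  Jr q x (fun w : k.+1.-tuple R => Re (hitf b x w)) +i*
  Jr q x (fun w : k.+1.-tuple R => Im (hitf b x w)).

Lemma boolC (b : bool) : b%:R = (b%:R : R)%:C.
Proof. by case: b. Qed.

Lemma exists_prod k (p : 'I_k -> bool) :
  (~~ [exists j, p j])%:R = \prod_(j < k) (~~ p j)%:R :> R.
Proof.
have [/existsP[j pj]|] := boolP [exists j, p j]; first by rewrite (bigD1 j)//= pj mul0r.
by rewrite negb_exists => /forallP h; rewrite big1// => j _; rewrite h.
Qed.

Lemma tmsb_hit k (b : bool) x :
  tmsb (fun w : k.+1.-tuple R => (b || [exists j : 'I_k.+1, c (nth 0 (x :: w) j)])%:R).
Proof.
have -> : (fun w : k.+1.-tuple R => (b || [exists j : 'I_k.+1, c (nth 0 (x :: w) j)])%:R : R) =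
    (fun w => 1 - (~~ b)%:R * \prod_(j < k.+1) (~~ c (nth 0 (x :: w) j))%:R).
  apply/funext => w; rewrite -(exists_prod (fun j => c (nth 0 (x :: w) j))).
  by case: b; case: [exists _, _]; rewrite /= ?mul0r ?mul1r ?subr0 ?subrr.
apply: measurable_funB; first exact: measurable_cst.
apply: measurable_funM; first exact: measurable_cst.
apply: (measurable_prod (s := index_enum _)) => j _.
have mn : msb (fun y => (~~ c y)%:R).
  rewrite (_ : (fun y => _) = (fun y => if c y then 0 else 1)); last first.
    by apply/funext => y; case: (c y).
  by apply: msb_if => //; exact: msb_cst.
by apply: (measurableT_comp mn); exact: tmsb_nth_cons.
Qed.

Lemma tmsb_comp k (f : R -> R) x j : msb f -> tmsb (fun w : k.-tuple R => f (nth 0 (x :: w) j)).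
Proof. by move=> mf; apply: (measurableT_comp mf); exact: tmsb_nth_cons. Qed.

Lemma hitf_tmsb k b x : tmsb (fun w : k.+1.-tuple R => Re (hitf b x w)) /\
  tmsb (fun w : k.+1.-tuple R => Im (hitf b x w)).
Proof.
have [m1 m2 _] := emu_cbd mu.
have mz (z : C) j : tmsb (fun w : k.+1.-tuple R => Re (z * eX (nth 0 (x :: w) j))) /\
    tmsb (fun w : k.+1.-tuple R => Im (z * eX (nth 0 (x :: w) j))).
  have t1 := @tmsb_comp k.+1 _ x j m1; have t2 := @tmsb_comp k.+1 _ x j m2.
  split.
    under eq_fun do rewrite (ReM z).
    by apply: measurable_funB; apply: measurable_funM => //; exact: measurable_cst.
  under eq_fun do rewrite (ImM z).
  by apply: measurable_funD; apply: measurable_funM => //; exact: measurable_cst.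
have [a1 a2] := mz al k; have [b1 b2] := mz be k.+1.
have mh := @tmsb_hit k b x.
split; rewrite /hitf.
  under eq_fun do rewrite boolC mulrC ReCM ReD.
  by apply: measurable_funM => //; apply: measurable_funD.
under eq_fun do rewrite boolC mulrC ImCM ImD.
by apply: measurable_funM => //; apply: measurable_funD.
Qed.

Lemma hitf_bnd k b x (w : k.+1.-tuple R) : cmod (hitf b x w) <= cmod al + cmod be.
Proof.
rewrite /hitf boolC (cmodM (_ + _)) cmodR.
apply: (@le_trans _ _ ((cmod al + cmod be) * 1)); last by rewrite mulr1.
apply: ler_pM; rewrite ?cmod_ge0//; last by case: (_ || _); rewrite ?normr0 ?normr1.
apply: le_trans (cmodD _ _) _; rewrite (cmodM al) (cmodM be) !cmod_emu.
by rewrite !mulr1.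
Qed.

Lemma existsS k x y (w : seq R) : [exists j : 'I_k.+2, c (nth 0 (x :: y :: w) j)] =
  c x || [exists j : 'I_k.+1, c (nth 0 (y :: w) j)].
Proof.
apply/existsP/orP => [[j]|[cx|/existsP[j cj]]].
- case: (unliftP ord0 j) => [i ->|->]; last by left.
  by move=> h; right; apply/existsP; exists i.
- by exists ord0.
- by exists (lift ord0 j).
Qed.

(** The starting point is tested against the level, and the outcome is stored in the flag before the
    first step is integrated. *)
Lemma hitES k b x : hitE k.+1 b x = Pc N s (hitE k (b || c x)) x.
Proof.
have [m1 m2] := hitf_tmsb k.+1 b x.
have E y (w : k.+1.-tuple R) : hitf b x [the k.+2.-tuple R of y :: w] = hitf (b || c x) y w.
  by rewrite /hitf /= existsS orbA.
apply: complex_ext.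
  transitivity (P N s (fun y => Re (hitE k (b || c x) y)) x) => //.
  rewrite /= (JrS iq x m1 (fun w => le_trans (Re_cmod _) (hitf_bnd b x w))).
  apply: eq_Int => y; congr (_ * _); congr (Jr _ _ _); apply/funext => w.
  by rewrite E.
transitivity (P N s (fun y => Im (hitE k (b || c x) y)) x) => //.
rewrite /= (JrS iq x m2 (fun w => le_trans (Im_cmod _) (hitf_bnd b x w))).
apply: eq_Int => y; congr (_ * _); congr (Jr _ _ _); apply/funext => w.
by rewrite E.
Qed.

Lemma cbdZ (z : C) F : cbd F -> cbd (fun x => z * F x).
Proof.
move=> [m1 m2 [B hB]]; split.
- by under eq_fun do rewrite (ReM z); apply: msbB; apply: msbM => //; exact: msb_cst.
- by under eq_fun do rewrite (ImM z); apply: msbD; apply: msbM => //; exact: msb_cst.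
- by exists (cmod z * B) => x; rewrite (cmodM z) ler_wpM2l ?cmod_ge0.
Qed.

Lemma cbdD F G : cbd F -> cbd G -> cbd (fun x : R => F x + G x : C).
Proof.
move=> [m1 m2 [B hB]] [m3 m4 [D hD]]; split.
- by under eq_fun do rewrite ReD; exact: msbD.
- by under eq_fun do rewrite ImD; exact: msbD.
- by exists (B + D) => x; apply: le_trans (cmodD _ _) _; exact: lerD.
Qed.

Lemma cbd_cst (z : C) : cbd (fun _ : R => z).
Proof. by split; [exact: msb_cst|exact: msb_cst|exists (cmod z)]. Qed.

Lemma tmsb0 (f : 0.-tuple R -> R) : tmsb f.
Proof.
rewrite (_ : f = (fun=> f [tuple])); first exact: measurable_cst.
by apply/funext => w; rewrite tuple0.
Qed.

Lemma hitE0 b x : hitE 0 b x = (al + be * phi) * eX x * (b || c x)%:R.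
Proof.
have [m1 m2] := hitf_tmsb 0 b x.
pose F y : C := (b || c x)%:R * (al * eX x + be * eX y).
have ex : forall y, [exists j : 'I_1, c (nth 0 [:: x; y] j)] = c x.
  by move=> y; apply/existsP/idP => [[j]|cx]; [rewrite ord1|exists ord0].
have E y : hitf b x [the 1.-tuple R of y :: [tuple]] = F y by rewrite /hitf /= ex mulrC.
have mF : cbd F by apply: cbdZ; apply: cbdD; [exact: cbd_cst|apply: cbdZ; exact: emu_cbd].
have -> : hitE 0 b x = Pc N s F x.
  apply: complex_ext.
    transitivity (P N s (fun y => Re (F y)) x) => //.
    rewrite /= (JrS iq x m1 (fun w => le_trans (Re_cmod _) (hitf_bnd b x w))).
    apply: eq_Int => y; congr (_ * _); rewrite -E Jr0//; exact: tmsb0.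
  transitivity (P N s (fun y => Im (F y)) x) => //.
  rewrite /= (JrS iq x m2 (fun w => le_trans (Im_cmod _) (hitf_bnd b x w))).
  apply: eq_Int => y; congr (_ * _); rewrite -E Jr0//; exact: tmsb0.
have bc : cbd (fun _ : R => al * eX x) by exact: cbd_cst.
have bz := cbdZ be (emu_cbd mu).
rewrite /F (PcZ N_even N_gt0 _ _ s_gt0 (cbdD bc bz)) (PcD N_even N_gt0 _ s_gt0 bc bz).
rewrite (Pc_cst N_even N_gt0 _ _ s_gt0) (PcZ N_even N_gt0 _ _ s_gt0 (emu_cbd mu)) (Pc_emu N_even N_gt0 _ _ s_gt0).
by rewrite -/phi mulrC; congr (_ * _); ring.
Qed.

(** Once the flag is set the indicator is 1, and exp (i mu x) is an eigenfunction of P with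
    eigenvalue phi. *)
Lemma hitE_true k x : hitE k true x = (al + be * phi) * phi ^+ k * eX x.
Proof.
elim: k x => [|k IH] x; first by rewrite hitE0 mulr1 expr0 mulr1.
rewrite hitES /= (_ : hitE k true = (fun y => (al + be * phi) * phi ^+ k * eX y)); last exact/funext.
rewrite (PcZ N_even N_gt0 _ _ s_gt0 (emu_cbd mu)) (Pc_emu N_even N_gt0 _ _ s_gt0) -/phi exprSr.
by ring.
Qed.

Variables (a : R) (sg : bool).
Let mu' := (-1) ^+ sg * mu.
Hypothesis cE : forall x, c x = (0 < (-1) ^+ sg * (x - a)).

(* [occ k] is the expectation of exp(i mu X) at the step k on the event that the
   level has been crossed by then. *)
Fixpoint occ k (y : R) : C :=
  if k is k'.+1 then phi * occ k' y + cseq N mu' s k' y else cstart mu' y.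

Lemma occ_cbd k : cbd (occ k).
Proof.
elim: k => [|k IH]; first exact: cstart_cbd.
by apply: cbdD; [exact: cbdZ|apply: cdec_cbd; exact: cseq_cdec].
Qed.

(** Two recursions agree: on the last step, in the definition of [occ], and on the first step, here.
    The induction rests on P mapping each [cseq] to the next one on the left. *)
Lemma Pc_occ k y : y <= 0 -> Pc N s (occ k) y = occ k.+1 y.
Proof.
move=> y0; elim: k => [|k IH]; first by rewrite /= {2}/cstart y0 mulr0 add0r.
have bc := cdec_cbd (cseq_cdec mu' N_even N_gt0 k s_gt0).
transitivity (phi * Pc N s (occ k) y + Pc N s (cseq N mu' s k) y).
  rewrite -(PcZ N_even N_gt0 _ _ s_gt0 (occ_cbd k)) -PcD//; exact/cbdZ/occ_cbd.
by rewrite IH /= y0.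
Qed.

Lemma occ_right k y : 0 < y -> occ k y = phi ^+ k * cstart mu' y.
Proof.
move=> y0; elim: k => [|k IH]; first by rewrite mul1r.
rewrite /= IH exprS mulrA (_ : cseq N mu' s k y = 0) ?addr0//.
by case: (k) => [|?] /=; rewrite leNgt y0.
Qed.

Lemma sgK (y : R) : (-1) ^+ sg * ((-1) ^+ sg * y) = y.
Proof. by rewrite mulrA -expr2 sqrr_sign mul1r. Qed.

Lemma emu_shift x : eX x = eX a * emu mu' ((-1) ^+ sg * (x - a)).
Proof.
rewrite /emu -cexpD; congr cexp; rewrite /nu -!mulrA -!rmorphM -mulrDr -rmorphD /=.
congr (_ * _%:C); rewrite /mu' mulrACA -expr2 sqrr_sign mul1r.
by ring.
Qed.

Lemma cbd_reflect F : cbd F -> cbd (fun x : R => F ((-1) ^+ sg * (x - a)) : C).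
Proof.
move=> [m1 m2 [B hB]]; have ml : msb (fun x => (-1) ^+ sg * (x - a)).
  by apply: msbM; [exact: msb_cst|apply: msbB; [exact: msb_id|exact: msb_cst]].
by split; [exact: (msb_comp m1)|exact: (msb_comp m2)|exists B].
Qed.

(** From a start beyond the level the flag is set at once and [hitE_true] applies; otherwise the
    first step is peeled off and [Pc_occ] applies in the reflected coordinate. *)
Lemma hitE_false k x : hitE k false x = (al + be * phi) * eX a * occ k ((-1) ^+ sg * (x - a)).
Proof.
elim: k x => [|k IH] x.
  rewrite hitE0 [false || _]/= cE emu_shift [occ _ _]/= /cstart leNgt.
  by case: (0 < _); rewrite /= ?mulr1 ?mulrA ?mulr0.
rewrite hitES [false || _]/= cE; have [y0|y0] := ltP 0 ((-1) ^+ sg * (x - a)).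
  rewrite -[Pc _ _ _ _](hitES k true) hitE_true emu_shift occ_right// /cstart leNgt y0 /=.
  by rewrite /emu; ring.
set y := _ * _ in y0 *.
have xE : x = a + (-1) ^+ sg * y by rewrite /y sgK addrC subrK.
have -> : hitE k false = (fun x => (al + be * phi) * eX a * occ k ((-1) ^+ sg * (x - a))) by exact/funext.
have br := cbd_reflect (occ_cbd k).
rewrite {1}xE (PcZ N_even N_gt0 _ _ s_gt0 br) (Pc_reflect N_even N_gt0 _ _ _ s_gt0 br).
congr (_ * _); rewrite -[RHS]Pc_occ//; congr (Pc _ _ _ _); apply/funext => t.
by rewrite addrC addKr sgK.
Qed.

End walk.

Section step_term.
Variables (R : realType) (N : nat) (n : nat).
Hypothesis N_even : ~~ odd N.
Hypothesis N_gt0 : (0 < N)%N.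
Local Notation C := R[i].
Let s : R := (2 ^+ n)^-1.

Lemma step_gt0 : 0 < s.
Proof. by rewrite invr_gt0 exprn_gt0. Qed.

Lemma dyadicE k : dyadic R n k = k%:R * s.
Proof. by []. Qed.

Lemma cexp_dyadic (lam z : C) k : cexp (- lam * (dyadic R n k)%:C + z) = zz lam s ^+ k * cexp z.
Proof.
rewrite cexpD /zz cexpX; congr (cexp _ * _); rewrite dyadicE rmorphM /=.
by rewrite rmorph_nat; ring.
Qed.

Lemma step_hit_termE crossed (c : R -> bool) x mu lam k :
  measurable_fun [set: measurableTypeR R] c ->
  (forall (X : nat -> R) i, crossed X i = [exists j : 'I_i.+1, c (X j)]) ->
  step_hit_term N crossed n x mu lam k = hitE N mu s c (zz lam s ^+ k) (- zz lam s ^+ k.+1) k false x.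
Proof.
move=> mc hc; rewrite /step_hit_term /pp_expectation.
set t := [tuple dyadic R n i.+1 | i < k.+1].
have tE i : (i <= k.+1)%N -> nth 0 (0 :: t) i = dyadic R n i.
  case: i => [|i] ik; first by rewrite /= dyadicE mul0r.
  by rewrite /= (nth_mktuple _ 0 (Ordinal ik)).
have F (w : k.+1.-tuple R) :
    (let X := nth 0 (x :: w) in
      (cexp (- lam * (dyadic R n k)%:C + 'i%C * mu%:C * (X k)%:C) -
       cexp (- lam * (dyadic R n k.+1)%:C + 'i%C * mu%:C * (X k.+1)%:C)) * (crossed X k)%:R) *
    \prod_(i < k.+1) pp_kernel N (nth 0 (0 :: t) i.+1 - nth 0 (0 :: t) i) (nth 0 (x :: w) i - nth 0 (x :: w) i.+1) =
    (wt (ker N s) k.+1 x w)%:C * hitf mu c (zz lam s ^+ k) (- zz lam s ^+ k.+1) false x w.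
  rewrite mulrC; congr (_ * _).
    rewrite /wt rmorph_prod; apply: eq_bigr => i _.
    rewrite !tE; [|exact: ltnW|exact: ltn_ord].
    have -> : dyadic R n i.+1 - dyadic R n i = s by rewrite !dyadicE -mulrBl -natrB// subSnn mul1r.
    by rewrite pp_kernelE// step_gt0.
  by rewrite /hitf /= hc; congr (_ * _); rewrite !cexp_dyadic mulNr.
apply: complex_ext; rewrite /= /Jr; apply: eq_Rintegral => w _.
  by rewrite F ReCM mulrC.
by rewrite F ImCM mulrC.
Qed.

Lemma aboveE a (X : nat -> R) i : above a X i = [exists j : 'I_i.+1, a < X j] :> bool.
Proof.
apply/bigmax_gtP/existsP => [[h|[j _ h]]|[j h]]; last by right; exists j.
  by exists ord0.
by exists j.
Qed.

Lemma belowE a (X : nat -> R) i : below a X i = [exists j : 'I_i.+1, X j < a] :> bool.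
Proof.
apply/bigmin_ltP/existsP => [[h|[j _ h]]|[j h]]; last by right; exists j.
  by exists ord0.
by exists j.
Qed.

Definition crossing (sg : bool) : R -> (nat -> R) -> nat -> bool := if sg then @below R else @above R.
Let lev (sg : bool) (a x : R) : bool := if sg then x < a else a < x.

Variables (mu a : R) (sg : bool).
Let mu' := (-1) ^+ sg * mu.
Local Notation occ := (occ N mu s sg).

Lemma step_hit_term_occ lam k x :
  step_hit_term N (crossing sg a) n x mu lam k =
  zz lam s ^+ k * (1 - zz lam s * (expR (- (s * mu ^+ N)))%:C) * emu mu a * occ k ((-1) ^+ sg * (x - a)).
Proof.
have ml : measurable_fun [set: measurableTypeR R] (lev sg a) by rewrite /lev; case: sg; [exact: mlt|exact: mgt].
rewrite (step_hit_termE (c := lev sg a))//; last first.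
  by move=> X i; rewrite /crossing /lev; case: sg; [exact: belowE|exact: aboveE].
have cE y : lev sg a y = (0 < (-1) ^+ sg * (y - a)).
  by rewrite /lev; case: sg; rewrite ?expr0 ?expr1 ?mul1r ?mulN1r ?opprB subr_gt0.
rewrite (hitE_false _ N_even N_gt0 step_gt0 ml _ _ cE).
by rewrite -/s exprSr; ring.
Qed.

(** Summation by parts: [occ] (i + 1) - phi [occ] i = [cseq] i and [occ] 0 = 0 for y <= 0, so the
    partial sums of the definition are those of the first-passage series up to one boundary term. *)
Lemma sum_occ lam k y : y <= 0 ->
  \sum_(i < k.+1) zz lam s ^+ i * (1 - zz lam s * (expR (- (s * mu ^+ N)))%:C) * occ i y =
  psum N mu' lam s k y - zz lam s ^+ k.+1 * (expR (- (s * mu ^+ N)))%:C * occ k y.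
Proof.
move=> y0; set z := zz lam s; set phi := (_)%:C; elim: k => [|k IH].
  by rewrite big_ord_recr /psum !big_ord0 /= /cstart y0 !mulr0 subrr add0r.
rewrite big_ord_recr IH [psum _ _ _ _ k.+1 _]/psum big_ord_recr /= -/(psum _ _ _ _ k y) -/z -/phi.
by rewrite -/mu' !exprS; ring.
Qed.

End step_term.

(** * Limits and analyticity *)

Section complex_limits.
Variable R : realType.
Local Notation C := R[i].
Implicit Types (u v g : nat -> C) (z l w : C).

(** Kept real-valued so that real limit theorems apply; [cconv_cvg] returns to the topology of
    R[i]. *)
Definition cconv u l : Prop := (fun n => cmod (u n - l)) @ \oo --> (0 : R).

(** In the partial order of R[i], 0 < e says that e is real and positive; so the radii of the
    topology reduce to their real parts. *)
Lemma ltc_real (r : R) (e : C) : 0 < e -> r < Re e -> r%:C < e.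
Proof. by rewrite !ltcE => /andP[/eqP /= -> _] re; rewrite eqxx. Qed.

Lemma cconv_cvg u l : cconv u l -> (u : nat -> R[i]^o) @ \oo --> (l : R[i]^o).
Proof.
move=> h; apply/cvgrPdist_lt => e e0.
have re0 : 0 < Re e by move: e0; rewrite ltcE => /andP[].
move/cvgr0Pnorm_lt : h => /(_ _ re0); apply: filterS => n.
rewrite ger0_norm ?cmod_ge0// => h.
rewrite (_ : `|_| = (cmod (u n - l))%:C); first exact: ltc_real.
by rewrite -cmodN opprB; exact: cmod_norm.
Qed.

Lemma cconvZ z u l : cconv u l -> cconv (fun n => z * u n) (z * l).
Proof.
apply: (cvg0_le (C := cmod z)) => n.
by rewrite ger0_norm ?cmod_ge0// -mulrBr (cmodM z).
Qed.

Lemma cconv0 u l (b : nat -> R) : b @ \oo --> (0 : R) -> (forall n, cmod (u n - l) <= b n) -> cconv u l.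
Proof.
move=> b0 h; apply: (cvg0_le (C := 1)) b0 => n.
by rewrite mul1r ger0_norm ?cmod_ge0.
Qed.

Lemma cconvD u v l w : cconv u l -> cconv v w -> cconv (fun n => u n + v n) (l + w).
Proof.
move=> h1 h2.
have h : (fun n => cmod (u n - l) + cmod (v n - w)) @ \oo --> (0 + 0 : R) by exact: cvgD.
rewrite addr0 in h; apply: (cconv0 h) => n.
by rewrite opprD addrACA; exact: cmodD.
Qed.

Lemma cconv_le u l w B (b : nat -> R) : cconv u l -> b @ \oo --> (0 : R) ->
  (forall n, cmod (u n - w) <= B + b n) -> cmod (l - w) <= B.
Proof.
move=> ul b0 h.
have hc : (fun n => cmod (u n - l) + (B + b n)) @ \oo --> (0 + (B + 0)).
  by apply: cvgD => //; apply: cvgD => //; exact: cvg_cst.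
rewrite !(add0r, addr0) in hc; rewrite -(cvg_lim _ hc)//.
apply: limr_ge; first by apply/cvg_ex; exists B.
near=> n; have -> : l - w = - (u n - l) + (u n - w) by ring.
by apply: le_trans (cmodD _ _) _; rewrite cmodN lerD2l.
Unshelve. all: by end_near. Qed.

Lemma series_conv g B q : 0 <= q < 1 -> (forall j, cmod (g j) <= B * q ^+ j) ->
  exists S, cconv (fun n => \sum_(j < n) g j) S.
Proof.
move=> /andP[q0 q1] hg.
have B0 : 0 <= B by have := hg 0%N; rewrite expr0 mulr1; exact: le_trans (cmod_ge0 _).
have hr (r : nat -> R) : (forall j, `|r j| <= cmod (g j)) -> cvgn (series r).
  move=> rg; apply: normed_cvg.
  apply: (@series_le_cvg _ _ (geometric B q)).
  - by move=> n /=.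
  - by move=> n; rewrite /geometric /= mulr_ge0 ?exprn_ge0.
  - by move=> n; apply: le_trans (rg n) (hg n).
  - by apply: is_cvg_geometric_series; rewrite ger0_norm.
have h1 := hr _ (fun j => Re_cmod (g j)); have h2 := hr _ (fun j => Im_cmod (g j)).
have sE (r : nat -> R) n : series r n = \sum_(j < n) r j by rewrite /series /= big_mkord.
exists (limn (series (fun j => Re (g j))) +i* limn (series (fun j => Im (g j)))).
have d (r : nat -> R) : cvgn (series r) -> (fun n => `|\sum_(j < n) r j - limn (series r)|) @ \oo --> (0 : R).
  move=> cr; have h : series r @ \oo --> limn (series r) by exact: cr.
  apply/cvgrPdist_lt => e e0; move/cvgrPdist_lt : h => /(_ _ e0); apply: filterS => n.
  by rewrite sE sub0r normrN normr_id distrC.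
have h : (fun n => `|\sum_(j < n) Re (g j) - limn (series (fun j => Re (g j)))| +
    `|\sum_(j < n) Im (g j) - limn (series (fun j => Im (g j)))|) @ \oo --> (0 + 0 : R).
  by apply: cvgD; exact: d.
rewrite addr0 in h; apply: (cconv0 h) => n; apply: le_trans (cmod_le _) _.
by rewrite ReB ImB Re_sum Im_sum.
Qed.

Lemma sum_geometric_le (q : R) n : 0 <= q < 1 -> \sum_(k < n) q ^+ k <= (1 - q)^-1.
Proof.
move=> /andP[q0 q1]; have q1' : 0 < 1 - q by rewrite subr_gt0.
rewrite -(ler_pM2l q1') mulfV ?gt_eqF//.
have -> : (1 - q) * \sum_(k < n) q ^+ k = 1 - q ^+ n.
  elim: n => [|n IH]; first by rewrite big_ord0 mulr0 expr0 subrr.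
  by rewrite big_ord_recr mulrDr IH exprS; ring.
by rewrite gerBl exprn_ge0.
Qed.

(* [t <= (8 / a) exp (a t / 8)] trades polynomial factors for a part of the
   exponential decay. *)
Lemma poly_expR (a t : R) : 0 < a -> 0 <= t ->
  t * expR (- (a * t)) <= 8 / a * expR (- (a * t / 4)) /\
  t ^+ 2 * expR (- (a * t / 2)) <= 64 / a ^+ 2 * expR (- (a * t / 4)).
Proof.
move=> a0 t0; pose E := expR (a * t / 8).
have at0 : 0 <= a * t by rewrite mulr_ge0// ltW.
have t1 : t <= 8 / a * E.
  have : a * t / 8 <= E by apply: le_trans (expR_ge1Dx _); lra.
  by rewrite [8 / a * E]mulrAC ler_pdivlMr//; lra.
have E0 : 0 <= E by exact: expR_ge0.
have a8 : 0 <= 8 / a by rewrite divr_ge0// ltW.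
split.
  apply: le_trans (ler_wpM2r (expR_ge0 _) t1) _; rewrite -[leLHS]mulrA ler_wpM2l// -expRD ler_expR; lra.
have t2 : t ^+ 2 <= (8 / a * E) ^+ 2 by rewrite lerXn2r// nnegrE mulr_ge0.
apply: le_trans (ler_wpM2r (expR_ge0 _) t2) _.
rewrite exprMn expr_div_n (_ : 8 ^+ 2 = 64 :> R); last by ring.
rewrite -[leLHS]mulrA ler_wpM2l ?divr_ge0 ?sqr_ge0// /E expr2 -!expRD ler_expR; lra.
Qed.

Lemma derivable_quadratic (f : C -> C) (z D : C) (r K : R) : 0 < r ->
  (forall h, cmod h <= r -> cmod (f (z + h) - f z - h * D) <= K * cmod h ^+ 2) ->
  derivable (f : R[i]^o -> R[i]^o) z 1.
Proof.
move=> r0 hf; apply/cvg_ex; exists D; apply/cvgrPdist_lt => e e0.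
have re0 : 0 < Re e by move: e0; rewrite ltcE => /andP[].
pose dl := Num.min r (Re e / (1 + `|K|)).
have K1 : 0 < 1 + `|K| by rewrite ltr_pwDl.
have dl0 : 0 < dl by rewrite lt_min r0 divr_gt0.
have dlC : 0 < dl%:C :> C by rewrite ltcE /= eqxx.
near=> h.
have h0 : (h : C) != 0 by near: h; exact: nbhs_dnbhs_neq.
have hd : cmod (h : C) < dl.
  have : `|h : R[i]^o| < dl%:C by near: h; exact: (dnbhs0_lt (V := R[i]^o)).
  rewrite (_ : `|_| = (cmod (h : C))%:C); first by rewrite ltcE => /andP[].
  exact: cmod_norm.
have ch : 0 < cmod (h : C) by rewrite lt_neqAle cmod_ge0 eq_sym cmod_eq0 h0.
have hr : cmod (h : C) <= r by apply/ltW/(lt_le_trans hd); rewrite ge_min lexx.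
set X := _ - _.
have EX : X = (h : C)^-1 * (- (f (z + h) - f z - h * D)).
  rewrite /X /GRing.scale /= mulr1 [z + h]addrC.
  by have := h0; move=> ?; field.
rewrite (_ : `|X| = (cmod (X : C))%:C); last exact: cmod_norm.
apply: ltc_real => //; rewrite EX (cmodM (h : C)^-1) cmodV cmodN.
rewrite mulrC ltr_pdivrMr//.
apply: le_lt_trans (hf _ hr) _; rewrite expr2 mulrA ltr_pM2r//.
apply: (@le_lt_trans _ _ ((1 + `|K|) * cmod (h : C))).
  by rewrite ler_wpM2r ?cmod_ge0//; have := ler_norm K; lra.
rewrite mulrC -ltr_pdivlMr//; apply: lt_le_trans hd _.
by rewrite ge_min lexx orbT.
Unshelve. all: by end_near. Qed.

Section dirichlet.
Variables (s M : R) (cs : nat -> C) (E : C -> C).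
Hypothesis s0 : 0 < s.
Hypothesis hM : forall k, cmod (cs k) <= M.
Hypothesis hE : forall z, 0 < Re z -> cconv (fun K => \sum_(k < K) zz z s ^+ k.+1 * cs k) (E z).

Let t (k : nat) : R := k.+1%:R * s.
Let t_ge0 k : 0 <= t k.
Proof. by rewrite mulr_ge0// ltW. Qed.
Let M0 : 0 <= M. Proof. exact: le_trans (cmod_ge0 _) (hM 0). Qed.

Lemma zz_pow (z : C) k : zz z s ^+ k.+1 = cexp (- z * (t k)%:C).
Proof. by rewrite /zz cexpX /t rmorphM /= rmorph_nat; congr cexp; ring. Qed.

Lemma Re_mulr (z : C) (r : R) : Re (z * r%:C) = Re z * r.
Proof. by rewrite mulrC ReCM mulrC. Qed.

Lemma geom_bound (a : R) : 0 < a -> exists2 q, 0 <= q < 1 & forall k, expR (- (a * t k / 4)) = q * q ^+ k.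
Proof.
move=> a0; exists (expR (- (a * s / 4))).
  by rewrite expR_ge0 expR_lt1 oppr_lt0 divr_gt0// mulr_gt0.
by move=> k; rewrite -exprS -expRM_natl /t; congr expR; ring.
Qed.

(** The series of termwise derivatives converges, and the second-order Taylor bounds of the terms
    have a sum O(|h|^2); [derivable_quadratic] concludes. *)
Lemma dirichlet_holomorphic : holomorphic_on [set z | 0 < Re z] E.
Proof.
move=> z /= z0; pose a := Re z; have [q q01 hq] := geom_bound (z0 : 0 < a).
have /andP[q0 q1] := q01.
(* The derivative of exp (- z t) in z is - t exp (- z t). *)
pose g k := - (t k)%:C * zz z s ^+ k.+1 * cs k.
have [|D hD] := @series_conv g (M * (8 / a) * q) q q01.
  move=> k; rewrite /g (cmodM (_ * _)) (cmodM (- _)) cmodN cmodR ger0_norm// zz_pow cmod_cexp Re_mulr ReN mulNr.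
  have [h _] := poly_expR z0 (t_ge0 k).
  rewrite [leRHS](_ : _ = 8 / a * (q * q ^+ k) * M); last by ring.
  by rewrite -hq; apply: ler_pM => //; rewrite ?cmod_ge0// mulr_ge0 ?expR_ge0.
(* For |h| <= a / 2 the remainder grows at most like t^2 exp (a t / 2), which uses up half of the
   decay exp (- a t); the other half absorbs t^2. *)
apply: (@derivable_quadratic _ _ D (a / 2) (4 * M * (64 / a ^+ 2) * q / (1 - q))).
  by rewrite divr_gt0.
move=> h ha.
have zh0 : 0 < Re (z + h).
  have := le_trans (Re_cmod h) ha; rewrite ler_norml ReD => /andP[h1 _].
  by rewrite -/a; have : 0 < a by []; lra.
have conv := cconvD (cconvD (hE zh0) (cconvZ (-1) (hE z0))) (cconvZ (- h) hD).
have -> : E (z + h) - E z - h * D = E (z + h) + -1 * E z + - h * D - 0 by ring.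
apply: (cconv_le (b := fun=> 0) conv); first exact: cvg_cst.
move=> K; rewrite addr0 subr0 !mulr_sumr -!big_split /=.
apply: le_trans (cmod_sum _ _ _) _.
have term k : cmod (zz (z + h) s ^+ k.+1 * cs k + -1 * (zz z s ^+ k.+1 * cs k) + - h * g k) <=
    4 * M * (64 / a ^+ 2) * q * cmod h ^+ 2 * q ^+ k.
  rewrite [X in cmod X](_ : _ = zz z s ^+ k.+1 * ((cexp (- h * (t k)%:C) - texp 2 (- h * (t k)%:C)) * cs k)); last first.
    rewrite /g !zz_pow opprD mulrDl cexpD /texp !big_ord_recr big_ord0 /= expr0 expr1 add0r !divr1.
    by ring.
  rewrite zz_pow (cmodM (cexp _)) cmod_cexp Re_mulr ReN mulNr (cmodM (_ - _)).
  have th : Num.max (Re (- h * (t k)%:C)) 0 <= a * t k / 2.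
    rewrite ge_max Re_mulr ReN; apply/andP; split; last by rewrite !mulr_ge0// ltW.
    rewrite mulrAC ler_wpM2r//; apply: le_trans ha.
    by apply: le_trans (Re_cmod h); rewrite -normrN ler_norm.
  have h1 : cmod (cexp (- h * (t k)%:C) - texp 2 (- h * (t k)%:C)) <= 4 * (cmod h ^+ 2 * t k ^+ 2) * expR (a * t k / 2).
    apply: le_trans (cexp_taylor _ _) _; rewrite (cmodM (- h)) cmodN cmodR ger0_norm// exprMn.
    rewrite (_ : 2 ^+ 2 = 4 :> R); last by ring.
    by rewrite ler_wpM2l ?ler_expR// mulr_ge0// mulr_ge0 ?sqr_ge0.
  have [_ h2] := poly_expR z0 (t_ge0 k).
  apply: le_trans (ler_wpM2l (expR_ge0 _) (ler_pM (cmod_ge0 _) (cmod_ge0 _) h1 (hM k))) _.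
  rewrite [leRHS](_ : _ = 4 * M * cmod h ^+ 2 * (64 / a ^+ 2 * (q * q ^+ k))); last by ring.
  have p0 : 0 <= 4 * M * cmod h ^+ 2 by rewrite mulr_ge0 ?sqr_ge0// mulr_ge0.
  rewrite -hq; apply: le_trans (ler_wpM2l p0 h2).
  rewrite [leLHS](_ : _ = 4 * M * cmod h ^+ 2 * (t k ^+ 2 * (expR (- (a * t k)) * expR (a * t k / 2)))); last by ring.
  by rewrite -expRD (_ : - (a * t k) + a * t k / 2 = - (a * t k / 2)); last by lra.
apply: (@le_trans _ _ (\sum_(k < K) 4 * M * (64 / a ^+ 2) * q * cmod h ^+ 2 * q ^+ k)).
  by apply: ler_sum => k _; exact: term.
rewrite -mulr_sumr [leRHS](_ : _ = 4 * M * (64 / a ^+ 2) * q * cmod h ^+ 2 * (1 - q)^-1); last by ring.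
apply: ler_wpM2l (sum_geometric_le K q01).
rewrite mulr_ge0 ?sqr_ge0// mulr_ge0// mulr_ge0 ?mulr_ge0//.
by rewrite invr_ge0 sqr_ge0.
Qed.

End dirichlet.
End complex_limits.

(** * Passage to the limit in the dyadic time step *)

Section hitting.
Variables (R : realType) (N : nat).
Hypothesis N_even : ~~ odd N.
Hypothesis N_gt2 : (2 < N)%N.
Local Notation C := R[i].

Let N_gt0 : (0 < N)%N. Proof. exact: ltn_trans N_gt2. Qed.

Lemma psum_conv (mu s y : R) (z : C) : 0 < s -> 0 < Re z -> exists S, cconv (fun K => psum N mu z s K y) S.
Proof.
move=> s0 z0; have [M M0 hM] := cseq_bnd mu N_even N_gt0 s0.
pose q := cmod (zz z s).
have q1 : q < 1 by rewrite /q cmod_zz expR_lt1 oppr_lt0 mulr_gt0.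
apply: (@series_conv _ (fun k => zz z s ^+ k.+1 * cseq N mu s k y) (M * q) q); first by rewrite q1 cmod_ge0.
move=> j; rewrite (cmodM (_ ^+ _)) cmodX -/q mulrC -mulrA -exprS.
by rewrite ler_wpM2r ?exprn_ge0 ?cmod_ge0.
Qed.

(** Each step adds at most M and phi <= 1: the growth is linear in k, which the geometric decay of
    |z|^k beats in [occ_vanish]. *)
Lemma occ_bnd (mu s M y : R) (sg : bool) k : 0 < s -> 0 <= M -> (forall j, cmod (cseq N ((-1) ^+ sg * mu) s j y) <= M) -> y <= 0 ->
  cmod (occ N mu s sg k y) <= k%:R * M.
Proof.
move=> s0 M0 hM y0; elim: k => [|k IH]; first by rewrite /= /cstart y0 cmod0 mul0r.
apply: le_trans (cmodD _ _) _; rewrite -natr1 mulrDl mul1r; apply: lerD => //.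
rewrite (cmodM (_%:C)) cmodR ger0_norm ?expR_ge0//; apply: le_trans IH.
rewrite ler_piMl ?cmod_ge0// expR_le1 oppr_le0 mulr_ge0 ?(ltW s0)//.
by rewrite -(even_halfK N_even) -muln2 exprM sqr_ge0.
Qed.

Lemma occ_vanish (mu s y : R) (sg : bool) (z : C) : 0 < s -> 0 < Re z -> y <= 0 ->
  cconv (fun K => zz z s ^+ K.+1 * (expR (- (s * mu ^+ N)))%:C * occ N mu s sg K y) 0.
Proof.
move=> s0 z0 y0; have [M M0 hM] := cseq_bnd ((-1) ^+ sg * mu) N_even N_gt0 s0.
have [q /andP[q0 q1] hq] := geom_bound s0 z0.
have : (fun K => q * q ^+ K : R) @ \oo --> (q * 0 : R).
  by apply: cvgM; [exact: cvg_cst|apply: cvg_expr; rewrite ger0_norm].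
rewrite mulr0 => h.
apply: (cvg0_le (C := M / s * (8 / Re z))) h => K.
rewrite subr0 ger0_norm ?cmod_ge0// (cmodM (_ * _)) (cmodM (_ ^+ _)) cmodX cmod_zz cmodR ger0_norm ?expR_ge0//.
have t0 : 0 <= K.+1%:R * s by rewrite mulr_ge0// ltW.
have [h1 _] := poly_expR z0 t0.
rewrite -hq -[leRHS]mulrA; apply: le_trans (ler_wpM2l _ h1); last by rewrite divr_ge0// ltW.
have -> : expR (- (Re z * s)) ^+ K.+1 = expR (- (Re z * (K.+1%:R * s))).
  by rewrite -expRM_natl; congr expR; ring.
rewrite [leRHS](_ : _ = expR (- (Re z * (K.+1%:R * s))) * 1 * (K.+1%:R * M)); last first.
  by have := lt0r_neq0 s0; move=> ?; field.
apply: ler_pM; rewrite ?cmod_ge0 ?mulr_ge0 ?expR_ge0//.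
  rewrite ler_wpM2l ?expR_ge0// expR_le1 oppr_le0 mulr_ge0 ?(ltW s0)//.
  by rewrite -(even_halfK N_even) -muln2 exprM sqr_ge0.
apply: le_trans (occ_bnd (sg := sg) (mu := mu) K s0 M0 (fun j => hM j y) y0) _.
by rewrite ler_wpM2r// ler_nat.
Qed.

Variables (I : finType) (A : {set I}) (c : I -> C) (lam : C) (a mu x : R) (sg : bool).
Hypothesis lam_gt0 : 0 < Re lam.
Hypothesis c_gt0 : forall j, j \in A -> 0 < Re (c j).
Hypothesis c_inj : {in A &, injective c}.
Hypothesis A_card : (N./2 <= #|A|)%N.
Hypothesis c_root : forall j, j \in A -> (kapR R N)%:C * c j ^+ N = lam.
Let mu' := (-1) ^+ sg * mu.
Let y := (-1) ^+ sg * (x - a).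
Hypothesis y_le0 : y <= 0.

Let s n : R := (2 ^+ n)^-1.
Let r n : R := s n `^ N%:R^-1.

Lemma root_pow n : r n ^+ N = s n.
Proof.
rewrite /r -powR_mulrn ?powR_ge0// -powRrM mulVf ?powRr1//; first by rewrite ltW// step_gt0.
by rewrite pnatr_eq0 -lt0n.
Qed.

Lemma root_itv n : 0 < r n <= 1.
Proof.
have s0 : 0 < s n by exact: step_gt0.
have r0 : 0 < r n by exact: powR_gt0.
rewrite r0 /=; have : r n ^+ N <= 1 by rewrite root_pow invf_le1 ?exprn_gt0// exprn_ege1// ler1n.
by rewrite expr_le1// ltW.
Qed.

Lemma root_small e : 0 < e -> \forall n \near \oo, r n < e.
Proof.
move=> e0; have eN : 0 < e ^+ N by exact: exprn_gt0.
have : (fun n => 2^-1 ^+ n : R) @ \oo --> (0 : R).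
  by apply: cvg_expr; rewrite ger0_norm ?invr_ge0// invf_lt1// ltr1n.
move/cvgr0Pnorm_lt => /(_ _ eN); apply: filterS => n.
rewrite ger0_norm ?exprn_ge0 ?invr_ge0// exprVn -/(s n) -root_pow.
by rewrite ltr_pXn2r// nnegrE ?powR_ge0// ltW.
Qed.

Lemma hit_expectation : is_hit_expectation N (crossing sg a) x mu lam (emu mu a * vlim A c mu' y).
Proof.
(* For Re z <= 0 the value is irrelevant; 0 makes the limit a total function of z. *)
have hS n z : exists S, 0 < Re z -> cconv (fun K => psum N mu' z (s n) K y) S.
  case: (pselect (0 < Re z)) => [z0|?]; last by exists 0.
  by have [S hS] := psum_conv mu' y (step_gt0 R n) z0; exists S.
have [E0 hE0] : exists E0 : nat -> C -> C, forall n z, 0 < Re z -> cconv (fun K => psum N mu' z (s n) K y) (E0 n z).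
  have [E0 h] := choice (fun p : nat * C => hS p.1 p.2).
  by exists (fun n z => E0 (n, z)) => n z; exact: (h (n, z)).
exists (fun n z => emu mu a * E0 n z); split=> [n|].
  have s0 : 0 < s n by exact: step_gt0.
  have [M M0 hM] := cseq_bnd mu' N_even N_gt0 s0.
  split.
    apply: (@dirichlet_holomorphic _ (s n) M (fun k => emu mu a * cseq N mu' (s n) k y)) => //.
      by move=> k; rewrite (cmodM (emu _ _)) cmod_emu mul1r.
    move=> z z0; have := cconvZ (emu mu a) (hE0 n z z0); congr cconv.
    apply/funext => K; rewrite /psum mulr_sumr; apply: eq_bigr => k _; ring.
  move=> z hz; have z0 : 0 < Re z.
    by apply: le_lt_trans hz; rewrite mulr_ge0 ?exprn_ge0// ln_ge0// pp_rho_ge1.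
  (* [sum_occ] relates k + 1 terms of the series to k terms of [psum], hence the shift. *)
  apply: cconv_cvg; rewrite /cconv -cvg_shiftS.
  have h := cconvD (hE0 n z z0) (cconvZ (-1) (occ_vanish mu sg s0 z0 y_le0)).
  rewrite mulr0 addr0 in h; have := cconvZ (emu mu a) h.
  apply: (cvg0_le (C := 1)) => K; rewrite mul1r ger0_norm ?cmod_ge0//.
  rewrite le_eqVlt; apply/orP; left; apply/eqP; congr (cmod (_ - _)).
  rewrite /series /= big_mkord.
  under eq_bigr do rewrite (step_hit_term_occ n N_even N_gt0).
  rewrite mulN1r -(sum_occ N n mu sg z K y_le0) mulr_sumr; apply: eq_bigr => k _.
  by rewrite -/y -/(s n); ring.
apply: cconv_cvg.
have : cconv (fun n => E0 n lam) (vlim A c mu' y); last exact: cconvZ.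
have [C0 C00 hC] := first_passage_limit mu' N_even N_gt2 c_gt0 c_inj A_card lam_gt0 c_root.
apply/cvgr0Pnorm_lt => e e0.
(* The shift parameter is fixed first so that C0 eta < e / 2; C2 depends on it and is beaten
   afterwards by r n. *)
pose eta := Num.min 1 (e / 2 / (1 + C0)).
have C1 : 0 < 1 + C0 by rewrite ltr_pwDl.
have eta01 : 0 < eta <= 1 by rewrite lt_min ltr01 !divr_gt0// ge_min lexx.
have [C2 hC2] := hC _ eta01.
have C21 : 0 < 1 + `|C2| by rewrite ltr_pwDl.
have e2 : 0 < e / 2 / (1 + `|C2|) by rewrite !divr_gt0.
apply: filterS (root_small e2) => n rn.
rewrite ger0_norm ?cmod_ge0//.
have [M hM] := hC2 _ (root_itv n).
have [rn0 rn1] := andP (root_itv n).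
apply: (@le_lt_trans _ _ (C0 * eta + C2 * r n)).
  have s0 : 0 < s n by exact: step_gt0.
  pose q := expR (- (Re lam * s n)).
  have q1 : q < 1 by rewrite expR_lt1 oppr_lt0 mulr_gt0.
  have h : (fun K => M * q * q ^+ K : R) @ \oo --> (M * q * 0 : R).
    by apply: cvgM; [exact: cvg_cst|apply: cvg_expr; rewrite ger0_norm ?expR_ge0].
  rewrite mulr0 in h; apply: (cconv_le (hE0 n lam lam_gt0) h) => K.
  by have := hM K y y_le0; rewrite root_pow exprS mulrA.
have h1 : C0 * eta < e / 2.
  apply: (@lt_le_trans _ _ ((1 + C0) * eta)).
    by rewrite ltr_pM2r; [rewrite ltrDr|case/andP: eta01].
  by rewrite mulrC -ler_pdivlMr// ge_min lexx orbT.
have h2 : C2 * r n <= e / 2.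
  apply: (@le_trans _ _ ((1 + `|C2|) * r n)).
    by rewrite ler_wpM2r ?(ltW rn0)//; have := ler_norm C2; lra.
  by rewrite mulrC -ler_pdivlMr// ltW.
lra.
Qed.

End hitting.

(** * The roots of kappa *)

Section roots.
Variables (R : realType) (N : nat).
Hypothesis N_gt2 : (2 < N)%N.
Hypothesis N_even : ~~ odd N.
Local Notation C := R[i].
Let N_gt0 : (0 < N)%N. Proof. exact: ltn_trans N_gt2. Qed.
Let NR0 : 0 < N%:R :> R. Proof. by rewrite ltr0n. Qed.
Let NR : N%:R != 0 :> R. Proof. by rewrite gt_eqF. Qed.

Lemma cexp_imag (t : R) : cexp ('i%C * t%:C : C) = cos t +i* sin t.
Proof. by rewrite iM_real /cexp expR0 mul1r. Qed.

(* [theta l = exp (i (pi / 2 + rang l))]. *)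
Definition rang (l : nat) : R := (2 * l + 1)%:R * pi / N%:R.

Lemma halfN : N%:R = 2 * (N./2)%:R :> R.
Proof. by rewrite -{1}(even_halfK N_even) -mul2n natrM. Qed.

Lemma thetaE (l : 'I_N) : theta R l = - sin (rang l) +i* cos (rang l).
Proof.
rewrite /theta cexp_imag.
have -> : (2 * l + N./2 + 1)%:R * pi / N%:R = rang l + pi / 2 :> R.
  rewrite /rang addnAC natrD mulrDl mulrDl; congr (_ + _).
  by have := NR; rewrite halfN mulf_eq0 negb_or => /andP[_ h2]; field.
by rewrite cosDpihalf sinDpihalf.
Qed.

Lemma theta_pow (l : 'I_N) : theta R l ^+ N = kappa R N.
Proof.
rewrite /theta cexpX (_ : N%:R * _ = 'i%C * ((2 * l + N./2 + 1)%:R * pi)%:C); last first.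
  rewrite mulrCA; congr (_ * _); rewrite -(rmorph_nat (real_complex R)) -rmorphM /=.
  by congr (_%:C); field.
rewrite cexp_imag /kappa.
have h m : cos (m%:R * pi) +i* sin (m%:R * pi) = (-1) ^+ m :> C.
  elim: m => [|m IH]; first by rewrite mul0r cos0 sin0.
  rewrite -natr1 mulrDl mul1r cosDpi sinDpi exprS -IH.
  by apply: complex_ext; rewrite mulN1r ?ReN ?ImN.
rewrite h -addnA exprD exprM sqrrN expr1n expr1n mul1r addnC //.
Qed.

Lemma theta_neq0 (l : 'I_N) : theta R l != 0.
Proof. exact: cexp_neq0. Qed.

Lemma conj_theta (l : 'I_N) : (theta R l)^*%C = (theta R l)^-1.
Proof.
apply: (mulfI (theta_neq0 l)); rewrite mulfV ?theta_neq0//.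
apply: complex_ext; rewrite thetaE /=; last by ring.
by rewrite mulrNN mulrN opprK -!expr2 addrC cos2Dsin2.
Qed.

(** The angles stay at least pi / N away from the multiples of pi, which leaves room for the
    argument of the N-th root of lam. *)
Lemma rang_itv (l : 'I_N) : if (l < N./2)%N then pi / N%:R <= rang l <= pi - pi / N%:R
  else pi + pi / N%:R <= rang l <= 2 * pi - pi / N%:R.
Proof.
have e : pi = (2 * N./2)%:R * (pi / N%:R) :> R.
  by rewrite natrM -halfN mulrC mulfVK.
have p0 : 0 <= pi / N%:R :> R by rewrite divr_ge0 ?pi_ge0.
have rE : rang l = (2 * l + 1)%:R * (pi / N%:R) by rewrite /rang mulrA.
have lN : (l < 2 * N./2)%N by rewrite mul2n even_halfK.
set p := pi / N%:R in e p0 rE *.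
have pS (m : nat) : m%:R * p + p = m.+1%:R * p by rewrite -natr1 mulrDl mul1r.
have p2 : 2 * pi = (2 * (2 * N./2))%:R * p by rewrite natrM -mulrA -e.
rewrite rE; case: ltnP => hl.
  rewrite lerBrDr e pS -{1}[p]mul1r !ler_wpM2r// ?ler1n ?ler_nat ?addn1//; lia.
by rewrite lerBrDr p2 {1}e !pS !ler_wpM2r// ler_nat; lia.
Qed.

Section principal_root.
Variable lam : C.
Hypothesis lam_gt0 : 0 < Re lam.

Let lam0 : 0 < cmod lam.
Proof. by rewrite lt_neqAle cmod_ge0 eq_sym cmod_eq0 andbT; apply/eqP => h; move: lam_gt0; rewrite h ltxx. Qed.

Let quot_itv : -1 <= Re lam / cmod lam <= 1.
Proof.
rewrite -ler_norml normrM normfV (ger0_norm (cmod_ge0 _)) ler_pdivrMr// mul1r.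
exact: Re_cmod.
Qed.

Lemma carg_cos : cos (carg lam) = Re lam / cmod lam.
Proof. by rewrite /carg; case: ifP => _; rewrite ?cosN acosK. Qed.

Lemma carg_sin : sin (carg lam) = Im lam / cmod lam.
Proof.
have h : sin (acos (Re lam / cmod lam)) = `|Im lam| / cmod lam.
  rewrite sin_acos// -[RHS]ger0_norm ?divr_ge0 ?cmod_ge0// -sqrtr_sqr; congr Num.sqrt.
  rewrite !expr_div_n real_normK ?num_real//.
  apply: (@mulIf _ (cmod lam ^+ 2)); first by rewrite expf_neq0// gt_eqF.
  rewrite mulrBl mul1r !mulfVK ?expf_neq0 ?gt_eqF//.
  by rewrite cmod_sqr; ring.
rewrite /carg; case: ifPn => i0; first by rewrite h ger0_norm.
by rewrite sinN h ltr0_norm ?mulNr ?opprK// ltNge.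
Qed.

(** This is where Re lam > 0 enters: the argument of the root is less than pi / (2 N) in absolute
    value, so [sin_sign] applies and multiplying by the root moves no theta across the imaginary
    axis. *)
Lemma carg_itv : - (pi / 2) < carg lam < pi / 2.
Proof.
have a1 : acos (Re lam / cmod lam) < pi / 2.
  rewrite ltNge; apply/negP => h.
  have : 0 <= sin (acos (Re lam / cmod lam) - pi / 2).
    apply: sin_ge0_pi; rewrite subr_ge0 h /= lerBlDr.
    by apply: le_trans (acos_lepi quot_itv) _; rewrite lerDl divr_ge0 ?pi_ge0.
  rewrite sinBpihalf acosK// oppr_ge0 leNgt divr_gt0//.
have a0 := acos_ge0 quot_itv; have p0 := pihalf_ge1 R.
by rewrite /carg; case: ifP => _; apply/andP; split; lra.
Qed.

Lemma croot_pow : croot N lam ^+ N = lam.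
Proof.
rewrite /croot exprMn cexpX -rmorphXn /= -powR_mulrn ?powR_ge0// -powRrM mulVf// powRr1 ?cmod_ge0//.
rewrite (_ : N%:R * _ = 'i%C * (carg lam)%:C); last first.
  rewrite mulrCA; congr (_ * _); rewrite -(rmorph_nat (real_complex R)) -rmorphM /=.
  by congr (_%:C); field.
rewrite cexp_imag carg_cos carg_sin.
by apply: complex_ext; rewrite ?ReCM ?ImCM /= mulrC mulfVK// gt_eqF.
Qed.

Lemma croot_neq0 : croot N lam != 0.
Proof.
apply/eqP => h; have := croot_pow; rewrite h expr0n gtn_eqF//= => h0.
by move: lam_gt0; rewrite -h0 ltxx.
Qed.

Lemma Re_theta_croot (l : 'I_N) : Re (theta R l * croot N lam) =
  (cmod lam `^ N%:R^-1) * - sin (rang l + carg lam / N%:R).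
Proof.
rewrite /croot mulrCA ReCM; congr (_ * _).
by rewrite cexp_imag thetaE sinD ReM /=; ring.
Qed.

Lemma sin_sign (w : R) (l : 'I_N) : `|w| < pi / N%:R / 2 ->
  if (l < N./2)%N then 0 < sin (rang l + w) else sin (rang l + w) < 0.
Proof.
have p0 : 0 < pi / N%:R :> R by rewrite divr_gt0 ?pi_gt0.
rewrite ltr_norml => /andP[w1 w2]; have := rang_itv l; case: ifP => _ /andP[h1 h2].
  by apply: sin_gt0_pi; apply/andP; split; lra.
rewrite -oppr_gt0 -[rang l](subrK pi) addrAC sinDpi opprK.
by apply: sin_gt0_pi; apply/andP; split; lra.
Qed.

Lemma carg_small : `|carg lam / N%:R| < pi / N%:R / 2.
Proof.
rewrite normrM normfV (ger0_norm (ler0n _ _)) mulrAC ltr_pM2r ?invr_gt0//.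
by rewrite ltr_norml carg_itv.
Qed.

Lemma Re_theta (l : 'I_N) : Re (theta R l) = - sin (rang l + 0).
Proof. by rewrite thetaE addr0. Qed.

Lemma indexK_lt (l : 'I_N) : (l \in indexK R N) = (l < N./2)%N.
Proof.
have w0 : `|0 : R| < pi / N%:R / 2 by rewrite normr0 !divr_gt0 ?pi_gt0.
rewrite inE Re_theta oppr_lt0; have := sin_sign l w0; case: ifP => // _ h.
by rewrite ltNge ltW.
Qed.

Lemma indexJ_ge (l : 'I_N) : (l \in indexJ R N) = (N./2 <= l)%N.
Proof.
have w0 : `|0 : R| < pi / N%:R / 2 by rewrite normr0 !divr_gt0 ?pi_gt0.
rewrite inE Re_theta oppr_gt0 leqNgt; have := sin_sign l w0; case: ifP => // _ h.
by rewrite ltNge ltW.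
Qed.

Lemma Re_theta_sign (l : 'I_N) : if (l < N./2)%N then 0 < - Re (theta R l * croot N lam)
  else 0 < Re (theta R l * croot N lam).
Proof.
have c0 : 0 < cmod lam `^ N%:R^-1 by exact: powR_gt0.
rewrite Re_theta_croot; have := sin_sign l carg_small; case: ifP => _ h.
  by rewrite mulrN opprK mulr_gt0.
by rewrite mulr_gt0// oppr_gt0.
Qed.

End principal_root.

(** Equal values at l < m would give cos (2 d) = 1 for some d strictly between 0 and pi, where sin d
    > 0. *)
Lemma theta_inj : injective (theta R (N := N)).
Proof.
have key (l m : 'I_N) : (l < m)%N -> theta R l = theta R m -> False.
  move=> lm; rewrite !thetaE => -[/oppr_inj hs hc].
  pose d : R := (m - l)%:R * pi / N%:R.
  have dE : rang m - rang l = d + d.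
    have rE (i : nat) : rang i = (2 * i%:R + 1) * pi / N%:R by rewrite /rang natrD natrM.
    by rewrite /d !rE natrB 1?ltnW//; ring.
  have c1 : cos (d + d) = 1 by rewrite -dE cosB hs hc -!expr2 cos2Dsin2.
  have d0 : 0 < sin d.
    apply: sin_gt0_pi; rewrite /d !mulr_gt0 ?pi_gt0 ?invr_gt0 ?ltr0n ?subn_gt0//=.
    rewrite ltr_pdivrMr// mulrC ltr_pM2l ?pi_gt0// ltr_nat.
    by apply: leq_ltn_trans (leq_subr _ _) (ltn_ord m).
  have := cos2Dsin2 d; move: c1; rewrite cosD -!expr2 => c1 c2.
  have : sin d ^+ 2 = 0 by lra.
  by move/eqP; rewrite sqrf_eq0 gt_eqF.
move=> l m e; apply/val_inj; case: (ltngtP l m) => // h; first by case: (key _ _ h e).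
by case: (key _ _ h (esym e)).
Qed.

Lemma card_half (A : {set 'I_N}) (f : 'I_(N./2) -> 'I_N) : injective f -> (forall i, f i \in A) -> (N./2 <= #|A|)%N.
Proof.
move=> fi fA; rewrite -[X in (X <= _)%N](card_ord N./2) -(card_imset _ fi).
by apply: subset_leq_card; apply/fintype.subsetP => _ /imsetP[i _ ->].
Qed.

Lemma indexK_card : (N./2 <= #|indexK R N|)%N.
Proof.
have hN : (N./2 <= N)%N by rewrite leq_half_double; lia.
apply: (@card_half _ (widen_ord hN)) => [i j /(congr1 val) /= /val_inj//|i].
by rewrite indexK_lt /=.
Qed.

Lemma indexJ_card : (N./2 <= #|indexJ R N|)%N.
Proof.
have hN (i : 'I_(N./2)) : (N./2 + i < N)%N.
  by rewrite -[X in (_ < X)%N](even_halfK N_even) -addnn ltn_add2l.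
apply: (@card_half _ (fun i => Ordinal (hN i))) => [i j /(congr1 val) /= /addnI /val_inj//|i].
by rewrite indexJ_ge /= leq_addr.
Qed.

Lemma kapR_pow (z : C) : (kapR R N)%:C * (kappa R N * z) = z.
Proof.
rewrite mulrA [X in X * _](_ : _ = 1) ?mul1r//.
have -> : (kapR R N)%:C = kappa R N.
  by rewrite /kappa /kapR exprD expr1 mulN1r rmorphN rmorph_sign.
by rewrite /kappa -exprD addnn -mul2n exprM sqrrN !expr1n.
Qed.

(** Each factor (c_l - nu) / (c_l - c_j) is theta_l / (theta_l - theta_j) times 1 - nu / c_l; the
    signs cancel, and 1 / theta_l is the conjugate of theta_l because its modulus is 1. *)
Lemma lag_theta (A : {set 'I_N}) (B : 'I_N -> C) (sg : bool) (mu : R) (La : C) (j : 'I_N) : La != 0 ->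
  B j = \prod_(l in A :\ j) (theta R l / (theta R l - theta R j)) ->
  L A (fun l => (-1) ^+ sg * (theta R l * La)) ((-1) ^+ sg * mu) j =
  B j * \prod_(l in A :\ j) (1 - 'i%C * mu%:C / La * (theta R l)^*%C).
Proof.
move=> La0 ->; rewrite /L /lag -big_split.
apply: eq_bigr => l; rewrite in_setD1 => /andP[lj _]; rewrite conj_theta.
have tl := theta_neq0 l.
have d : theta R l - theta R j != 0 by rewrite subr_eq0; apply: contra lj => /eqP/theta_inj ->.
have -> : nu ((-1) ^+ sg * mu) = (-1) ^+ sg * ('i%C * mu%:C) :> C.
  by rewrite /nu rmorphM rmorph_sign /=; ring.
have d' : theta R j - theta R l != 0 by rewrite -oppr_eq0 opprB.
rewrite -!mulrBr invfM mulrACA divff ?signr_eq0// mul1r.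
clear d'; move: (theta R l) (theta R j) ('i%C * mu%:C) tl d => p q w p0 pq.
by rewrite -mulrBl /=; field; rewrite La0 p0 pq.
Qed.

End roots.

(** With [sg] true the line is reflected at the level, so that crossing downwards becomes crossing
    upwards; the exponents are then the opposites of theta_k lam^(1/N), which have positive real
    part for k in K. *)
Lemma hit_expectation_theta (R : realType) (N : nat) (A : {set 'I_N}) (B : 'I_N -> R[i])
    (sg : bool) (a mu x : R) (lam : R[i]) : (2 < N)%N -> ~~ odd N -> 0 < Re lam ->
  (forall l, l \in A -> 0 < Re ((-1) ^+ sg * (theta R l * croot N lam))) ->
  (N./2 <= #|A|)%N ->
  (forall j, B j = \prod_(l in A :\ j) (theta R l / (theta R l - theta R j))) ->
  (-1) ^+ sg * (x - a) <= 0 ->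
  is_hit_expectation N (crossing sg a) x mu lam
    (\sum_(j in A) B j *
       (\prod_(l in A :\ j) (1 - 'i%C * mu%:C / croot N lam * (theta R l)^*%C)) *
       cexp (theta R j * croot N lam * (x - a)%:C) * cexp ('i%C * mu%:C * a%:C)).
Proof.
move=> N2 Ne lam0 Apos Acard BE ya; have La0 := croot_neq0 N2 lam0.
have sn0 : (-1) ^+ sg != 0 :> R[i] by rewrite signr_eq0.
have c_inj : {in A &, injective (fun l => (-1) ^+ sg * (theta R l * croot N lam))}.
  move=> l m _ _ /(mulfI sn0) /(mulIf La0); exact: theta_inj.
(* N is even, so the sign of the reflection disappears in the N-th power. *)
have c_root l : l \in A -> (kapR R N)%:C * ((-1) ^+ sg * (theta R l * croot N lam)) ^+ N = lam.
  by move=> _; rewrite exprMn -exprM mulnC exprM -signr_odd (negbTE Ne) expr1n mul1r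
    exprMn theta_pow// croot_pow// kapR_pow.
have := hit_expectation Ne N2 (sg := sg) (a := a) (x := x) mu lam0 Apos c_inj Acard c_root ya.
congr is_hit_expectation.
rewrite /vlim ya mulrC /Vexp mulr_suml; apply: eq_bigr => j _.
rewrite (lag_theta N2 Ne sg mu La0 (BE j)); congr (_ * cexp _ * _).
have s1 : (-1) ^+ sg * (-1) ^+ sg = 1 :> R[i] by rewrite -expr2 sqrr_sign.
by rewrite rmorphM rmorph_sign /= mulrACA s1 mul1r.
Qed.

Theorem theorem5p2 (R : realType) (N : nat) (N_gt2 : (2 < N)%N)
    (N_even : ~~ odd N) (a mu : R) (lam : R[i])
    (lam_gt0 : 0 < complex.Re lam) :
  (forall x : R, x <= a ->
     is_hit_expectation N (above a) x mu lam
       (\sum_(j in indexJ R N)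
          rootA R j *
          (\prod_(l in indexJ R N :\ j)
             (1 - 'i%C * mu%:C / croot N lam * (theta R l)^*%C)) *
          cexp (theta R j * croot N lam * (x - a)%:C) *
          cexp ('i%C * mu%:C * a%:C))) /\
  (forall x : R, a <= x ->
     is_hit_expectation N (below a) x mu lam
       (\sum_(k in indexK R N)
          rootB R k *
          (\prod_(l in indexK R N :\ k)
             (1 - 'i%C * mu%:C / croot N lam * (theta R l)^*%C)) *
          cexp (theta R k * croot N lam * (x - a)%:C) *
          cexp ('i%C * mu%:C * a%:C))).
Proof.
split=> x xa.
  apply: (hit_expectation_theta (sg := false)) => //.
  - move=> l; rewrite expr0 mul1r indexJ_ge// => hl.
    by have := Re_theta_sign N_gt2 N_even lam_gt0 l; rewrite ltnNge hl.
  - exact: indexJ_card.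
  - by rewrite expr0 mul1r subr_le0.
apply: (hit_expectation_theta (sg := true)) => //.
- move=> l; rewrite expr1 mulN1r indexK_lt// => hl.
  by have := Re_theta_sign N_gt2 N_even lam_gt0 l; rewrite hl ReN.
- exact: indexK_card.
- by rewrite expr1 mulN1r oppr_le0 subr_ge0.
Qed.
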